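(* Let $u,v,k$ be positive integers with $v+k$ even. Let $a_1,\dots,a_u\in\{1,2,4,8\}$, $b_1,\dots,b_v\in\{1,2,3,6\}$, $c_1,\dots,c_k\in\{1,2,3,4,6\}$, and put $\mathbf{h}=c_1+\cdots+c_k$. Let $$\Phi(\tau)=\prod_{i=1}^u\mathcal{F}(a_i\tau)\prod_{i=1}^v\theta(b_i\tau)\prod_{j=1}^k\Psi(c_j\tau)$$ be the generating function of the mixed form $\mathcal{M}(\mathbf{x},\mathbf{y},\mathbf{z})$ in $2u+v+k$ variables. If $\mathbf{h}$ is divisible by $8$, then $q^{\mathbf{h}/8}\Phi(\tau)$ is a modular form in $M_{u+\frac{v+k}{2}}(\Gamma_0(N_1),\omega)$, where $M=\mathrm{lcm}\big[4\,\mathrm{lcm}[b_1,\dots,b_v],2\,\mathrm{lcm}[c_1,\dots,c_k]\big]$, $N_1=\mathrm{lcm}\big[3\,\mathrm{lcm}[a_1,\dots,a_u],M\big]$, $\omega=\chi''$ if $u$ is even, $\omega=\left(\frac{\cdot}{3}\right)\chi''$ if $u$ is odd, and $$\chi''=\begin{cases}\left(\dfrac{(-1)^{(v+k)/2}\,4\prod_{i=1}^v b_i\prod_{j=1}^k c_j}{\cdot}\right) & \text{if } v \text{ and } k \text{ are even},\\[2mm] \left(\dfrac{(-1)^{(v+k)/2}\,8\prod_{i=1}^v b_i\prod_{j=1}^k c_j}{\cdot}\right) & \text{if } v \text{ and } k \text{ are odd}.\end{cases}$$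
   Context: Here $q=e^{2\pi i\tau}$ with $\tau$ in the upper half-plane. $\mathcal{F}(\tau)=\sum_{m,n\in\mathbb{Z}}q^{m^2+mn+n^2}$, $\theta(\tau)=\sum_{n\in\mathbb{Z}}q^{n^2}$, $\Psi(\tau)=\sum_{n\ge 0}q^{n(n+1)/2}$. The mixed form is $\mathcal{M}(\mathbf{x},\mathbf{y},\mathbf{z})=\sum_{i=1}^u a_i(x_{2i-1}^2+x_{2i-1}x_{2i}+x_{2i}^2)+\sum_{i=1}^v b_iy_i^2+\sum_{i=1}^k c_i\frac{z_i(z_i+1)}{2}$ for $\mathbf{x}\in\mathbb{Z}^{2u}$, $\mathbf{y}\in\mathbb{Z}^v$, $\mathbf{z}\in\mathbb{Z}_{\ge 0}^k$. $M_w(\Gamma_0(N),\psi)$ is the space of (holomorphic) modular forms of weight $w$, level $N$ and character $\psi$. The symbols $\left(\frac{m}{\cdot}\right)$ and $\left(\frac{\cdot}{3}\right)$ are Kronecker/Legendre symbols. *)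

(* Defs.v *)
From Stdlib Require Import Reals ZArith.
From Coquelicot Require Import Coquelicot.
From mathcomp Require Import all_boot.

Set Implicit Arguments.
Unset Strict Implicit.
Unset Printing Implicit Defensive.

Definition Cexp (z : C) : C :=
  (exp (Re z) * cos (Im z), exp (Re z) * sin (Im z))%R.

(* [qpow t x] is q^x with q = e^(2 pi i t); going through the exponential makes
   rational exponents such as h/8 independent of any choice of root of q. *)
Definition qpow (t : C) (x : R) : C :=
  Cexp (RtoC (2 * PI * x) * Ci * t)%C.

Definition Cseries (f : nat -> C) : C :=
  (Series (fun n => Re (f n)), Series (fun n => Im (f n))).

(* For the series below, which converge absolutely on the upper half-plane,
   this is the usual sum over Z, and its iteration is the sum over Z^2. *)
Definition Zseries (f : Z -> C) : C :=
  (Cseries (fun n => f (Z.of_nat n)) +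
   Cseries (fun n => f (- Z.of_nat n.+1)%Z))%C.

Definition calF (t : C) : C :=
  Zseries (fun m => Zseries (fun n => qpow t (IZR (m * m + m * n + n * n)))).

Definition theta (t : C) : C :=
  Zseries (fun n => qpow t (IZR (n * n))).

Definition Psi (t : C) : C :=
  Cseries (fun n => qpow t (INR n * (INR n + 1) / 2)).

(* The symbol (a/p) at a prime p, including the Kronecker value at p = 2. *)
Definition kronecker_prime (a : Z) (p : nat) : Z :=
  if p == 2%N then
    if Z.even a then 0%Z
    else if (Z.eqb (a mod 8) 1 || Z.eqb (a mod 8) 7)%Z then 1%Z else (-1)%Z
  else
    if Z.eqb (a mod Z.of_nat p) 0 then 0%Z
    else if has (fun x => Z.eqb ((Z.of_nat x * Z.of_nat x - a) mod Z.of_nat p) 0)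
                (iota 0%N p)
    then 1%Z else (-1)%Z.

(* The Kronecker symbol (a/n) for arbitrary integers a, n, with the
   conventions (a/0) = [|a| = 1] and (a/-1) = -1 exactly when a < 0. *)
Definition kronecker (a n : Z) : Z :=
  if Z.eqb n 0 then (if Z.eqb (Z.abs a) 1 then 1%Z else 0%Z)
  else
    ((if Z.ltb n 0 && Z.ltb a 0 then -1 else 1) *
     \big[Z.mul/1%Z]_(p <- primes (Z.abs_nat n))
        (kronecker_prime a p ^ Z.of_nat (logn p (Z.abs_nat n))))%Z.

Definition upper_half_plane (t : C) : Prop := (0 < Im t)%R.

Definition automorphy (c d : Z) (t : C) : C :=
  (RtoC (IZR c) * t + RtoC (IZR d))%C.

Definition mobius (a b c d : Z) (t : C) : C :=
  (automorphy a b t / automorphy c d t)%C.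

(* The weight w slash action of the matrix (a, b; c, d). *)
Definition slash (w : nat) (a b c d : Z) (f : C -> C) (t : C) : C :=
  (f (mobius a b c d t) / automorphy c d t ^ w)%C.

(* Membership in M_w(Gamma_0(N), psi). Only the values of f on the upper
   half-plane matter, and only those of psi at integers prime to N, so psi may
   be given by a Dirichlet character of any modulus with the same values there.
   The last clause is holomorphy at every cusp: for each g in SL_2(Z), f|g
   remains bounded as Im t tends to infinity. *)
Record modular_form (w N : nat) (psi : Z -> C) (f : C -> C) : Prop :=
  ModularForm {
  mf_holomorphic : forall t : C, upper_half_plane t ->
    @ex_derive C_AbsRing C_NormedModule f t;
  mf_transform : forall a b c d : Z,
    (a * d - b * c = 1)%Z -> Z.divide (Z.of_nat N) c ->
    forall t : C, upper_half_plane t ->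
    f (mobius a b c d t) = (psi d * automorphy c d t ^ w * f t)%C;
  mf_cusps : forall a b c d : Z, (a * d - b * c = 1)%Z ->
    exists A B : R, (0 < A)%R /\
      forall t : C, (A <= Im t)%R -> (Cmod (slash w a b c d f t) <= B)%R }.

Definition Phi (u v k : nat) (a : 'I_u -> nat) (b : 'I_v -> nat)
    (c : 'I_k -> nat) (t : C) : C :=
  (\big[Cmult/RtoC 1]_(i < u) calF (RtoC (INR (a i)) * t) *
   \big[Cmult/RtoC 1]_(i < v) theta (RtoC (INR (b i)) * t) *
   \big[Cmult/RtoC 1]_(j < k) Psi (RtoC (INR (c j)) * t))%C.

Definition level_M (v k : nat) (b : 'I_v -> nat) (c : 'I_k -> nat) : nat :=
  lcmn (4 * \big[lcmn/1%N]_(i < v) b i)%N (2 * \big[lcmn/1%N]_(j < k) c j)%N.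

Definition level_N1 (u v k : nat) (a : 'I_u -> nat) (b : 'I_v -> nat)
    (c : 'I_k -> nat) : nat :=
  lcmn (3 * \big[lcmn/1%N]_(i < u) a i)%N (level_M b c).

(* Used only when v and k have the same parity. *)
Definition chi'' (v k : nat) (b : 'I_v -> nat) (c : 'I_k -> nat) (n : Z) : Z :=
  kronecker
    ((-1) ^ Z.of_nat ((v + k)./2) * (if odd v && odd k then 8 else 4) *
     Z.of_nat (\prod_(i < v) b i * \prod_(j < k) c j)%N)%Z n.

Definition omega (u v k : nat) (b : 'I_v -> nat) (c : 'I_k -> nat) (n : Z) : C :=
  RtoC (IZR (if odd u then kronecker n 3 * chi'' b c n else chi'' b c n)%Z).

(* Main.v *)
(* Up to the factor q^(h/8), Phi is a product of values of the theta constants theta3(z) = sum exp(i pi n^2 z)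
   and theta2(z) = theta3(z/4) - theta3(z): theta(t) = theta3(2t), q^(1/8) Psi(t) = theta2(t)/2, and, splitting
   the form m^2 + mn + n^2 by the parity of m, F(t) = theta3(2t) theta3(6t) + theta2(2t) theta2(6t).

   The inversion theta3(-1/z) = sqrt(-iz) theta3(z) is Poisson summation for a complex Gaussian, obtained as a
   limit of finite Fourier inversion. Euclid's algorithm then gives, for a matrix of the theta group, a multiplier
   J with theta3(gz) = J(z) theta3(z) and J(z)^2 equal to a fourth root of unity times cz + d, together with
   companion formulas for theta3(2z) and theta3(3z). A continuous square root of cz + d on the upper half-plane is
   determined by one value, so the same J serves all theta3(nz) with n = 2^i 3^j and 2n | c, up to a quadratic
   character of d; no formula for J itself is needed, since v + k is even. For F, the relations
   F(t + 1) = F(t) and F(-1/(3t)) = -i sqrt(3) t F(t) generate the action of Gamma_0(3).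

   As 8 | h, the product is invariant under t -> t + 1. If 12 | c and ad - bc = 1, then d^2 = 1 mod 24, so
   multiplying by a power of this translation reduces to the case 24 | b, where the matrix becomes
   (a, b/12; 12c, d) in the variable t/12 and every theta constant is a combination of functions theta3(n t/12).
   The characters are identified with Kronecker symbols by computing the quadratic characters of -1, 2 and 3 in a
   finite field containing a primitive 24th root of unity. At the cusps, |theta2| + |theta3| + |theta4| is
   invariant under translation and is multiplied by |z|^(1/2) under inversion, so Euclid's algorithm for integer
   matrices of positive determinant bounds all factors at once. *)
Require Import Defs.
From Stdlib Require Import Reals ZArith Lra Lia Ranalysis5.
From Coquelicot Require Import Coquelicot.
From mathcomp Require Import all_boot.
From mathcomp Require all_algebra all_field ring.

Set Implicit Arguments.
Unset Strict Implicit.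

(** * Mean value estimates for the complex exponential *)

Section ComplexExponential.
Local Open Scope R_scope.

(** In half-integral weight the multiplier of one theta constant combines a square root of cz + d
    with a Jacobi symbol in c and d. Comparison avoids that symbol: every factor is measured against
    one [J], so only ratios of multipliers, which are quadratic characters of d, and powers of
    [J ^ 2] reach the result. The descent that produces [J] meets matrices outside Gamma_0(4) and
    Gamma_0(3). Hence [theta3 (2 z)] and [theta3 (3 z)] have to be followed through the whole theta
    group, which brings in [theta2], [theta4] and the arguments z/2 and (z + 4cd)/3. Interchanges of
    limits and sums rest on one majorant, exp(-|n|), below which a Gaussian falls, up to a constant,
    even after multiplication by exp(K|n|). The Gaussian integral is never computed: it enters the
    inversion formula as an unknown constant, which the fixed point z = i determines. The Kronecker
    symbols to be identified have upper entry plus or minus 2^i 3^j, so the quadratic characters of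
    -1, 2 and 3 suffice and reciprocity is not invoked. *)

Lemma Cexp_add (u v : C) : Cexp (u + v)%C = (Cexp u * Cexp v)%C.
Proof.
case: u => a b; case: v => c d.
rewrite /Cexp /Cmult /Cplus /= exp_plus cos_plus sin_plus.
by congr pair; ring.
Qed.

Lemma Cexp_0 : Cexp (RtoC 0) = RtoC 1.
Proof. by rewrite /Cexp /RtoC /= exp_0 cos_0 sin_0; congr pair; ring. Qed.

Lemma Cmod_Cexp (u : C) : Cmod (Cexp u) = exp (Re u).
Proof.
rewrite /Cmod /Cexp /= !Rmult_1_r.
rewrite -[RHS](sqrt_Rsqr (exp (Re u))); last by apply/Rlt_le/exp_pos.
congr sqrt; rewrite /Rsqr.
have h := sin2_cos2 (Im u); rewrite /Rsqr in h.
transitivity (exp (Re u) * exp (Re u) * (sin (Im u) * sin (Im u) + cos (Im u) * cos (Im u))); [ring | by rewrite h; ring].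
Qed.

Lemma Cexp_neq_0 (u : C) : Cexp u <> RtoC 0.
Proof. by apply/Cmod_gt_0; rewrite Cmod_Cexp; apply: exp_pos. Qed.

Lemma Cexp_Ci (x : R) : Cexp (RtoC x * Ci)%C = (cos x, sin x).
Proof.
rewrite /Cexp /Ci /RtoC /= !Rmult_0_r Rmult_0_l Rmult_1_r Rminus_0_r Rplus_0_r exp_0.
by rewrite !Rmult_1_l.
Qed.

Lemma im_le_Cmod (c : C) : Rabs (Im c) <= Cmod c.
Proof. by apply: Rle_trans (Rmax_Cmod c); apply: Rmax_r. Qed.

Lemma Ceq (x y : C) : Re x = Re y -> Im x = Im y -> x = y.
Proof. by case: x => a b; case: y => c d /= -> ->. Qed.

Lemma Cmod_le_2 (z : C) : Cmod z <= Rabs (Re z) + Rabs (Im z).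
Proof.
have -> : z = (RtoC (Re z) + Ci * RtoC (Im z))%C.
  by case: z => a b; rewrite /Cplus /Cmult /=; congr pair; ring.
apply: Rle_trans (Cmod_triangle _ _) _.
by rewrite Cmod_mult Cmod_Ci !Cmod_R /= ; right; rewrite -!/(Re _) -!/(Im _) !Rmult_0_l !Rmult_1_l ?Rmult_0_r ?Rminus_0_r ?Rplus_0_r ?Rplus_0_l.
Qed.

(* Projecting [f] on the direction of [f 1 - f 0] reduces the estimate to a real-valued function. *)
Lemma C_mean_value (f df : R -> C) (B : R) :
  (forall t, 0 <= t <= 1 -> is_derive (fun t => Re (f t)) t (Re (df t))) ->
  (forall t, 0 <= t <= 1 -> is_derive (fun t => Im (f t)) t (Im (df t))) ->
  (forall t, 0 <= t <= 1 -> Cmod (df t) <= B) ->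
  Cmod (f 1 - f 0)%C <= B.
Proof.
move=> hr hi hB.
set u := (f 1 - f 0)%C.
pose phi t := Re u * Re (f t) + Im u * Im (f t).
pose dphi t := Re u * Re (df t) + Im u * Im (df t).
have CS (t : R) : Rabs (dphi t) <= Cmod u * Cmod (df t).
  have -> : dphi t = Re (Cconj u * df t)%C.
    by rewrite re_mult re_conj im_conj /dphi; ring.
  by rewrite -(Cmod_conj u) -Cmod_mult; apply: re_le_Cmod.
have dphiP (t : R) : 0 <= t <= 1 -> is_derive phi t (dphi t).
  by move=> ht; apply: @is_derive_plus; apply: is_derive_scal; [apply: hr | apply: hi].
have [] := @MVT_gen phi 0 1 dphi; rewrite /Rmin /Rmax; case: Rle_dec => [_|]; try lra.
- by move=> t ht; apply: dphiP; lra.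
- by move=> t ht; apply/continuity_pt_filterlim/(@ex_derive_continuous R_AbsRing R_NormedModule); exists (dphi t); apply: dphiP.
move=> t [ht].
have -> : phi 1 - phi 0 = Cmod u * Cmod u.
  transitivity (Cmod u ^ 2); last by ring.
  by rewrite Cmod2_alt /phi /u /Cminus re_plus im_plus re_opp im_opp; ring.
rewrite Rminus_0_r Rmult_1_r => e.
have u0 := Cmod_ge_0 u.
case: (Rle_lt_or_eq_dec _ _ u0) => hu; last first.
  by rewrite -hu; apply: Rle_trans (Cmod_ge_0 (df 0)) (hB 0 _); lra.
apply: (Rmult_le_reg_l _ _ _ hu); rewrite e.
apply: Rle_trans (Rle_abs _) _; apply: Rle_trans (CS t) _.
by apply: Rmult_le_compat_l => //; apply: hB.
Qed.

Lemma Cexp_scal (t : R) (u : C) :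
  Cexp (RtoC t * u)%C = (exp (t * Re u) * cos (t * Im u), exp (t * Re u) * sin (t * Im u)).
Proof. by rewrite /Cexp re_scal_l im_scal_l. Qed.

Lemma Cexp_path_Re (u : C) (t : R) :
  is_derive (fun t => Re (Cexp (RtoC t * u)%C)) t (Re (u * Cexp (RtoC t * u))%C).
Proof.
apply: (is_derive_ext (fun t => exp (t * Re u) * cos (t * Im u))).
  by move=> s; rewrite Cexp_scal.
rewrite re_mult Cexp_scal /=; auto_derive => //; ring.
Qed.

Lemma Cexp_path_Im (u : C) (t : R) :
  is_derive (fun t => Im (Cexp (RtoC t * u)%C)) t (Im (u * Cexp (RtoC t * u))%C).
Proof.
apply: (is_derive_ext (fun t => exp (t * Re u) * sin (t * Im u))).
  by move=> s; rewrite Cexp_scal.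
rewrite im_mult Cexp_scal /=; auto_derive => //; ring.
Qed.

Lemma Re_le_norm (u : C) : Re u <= Cmod u.
Proof. by apply: Rle_trans (Rle_abs _) (re_le_Cmod u). Qed.

Lemma Cmod_scal (t : R) (u : C) : 0 <= t -> Cmod (RtoC t * u)%C = t * Cmod u.
Proof. by move=> t0; rewrite Cmod_mult Cmod_R Rabs_pos_eq. Qed.

Lemma exp_le (x y : R) : x <= y -> exp x <= exp y.
Proof. by case => [/exp_increasing|->]; lra. Qed.

(** Mean value inequality along t u for t in [0, 1]; the second-order bound below feeds this one
    into its derivative. The crude factor [exp (Cmod u)] is harmless, since a Gaussian absorbs it
    later. *)
Lemma Cexp_bound1 (u : C) : Cmod (Cexp u - 1)%C <= Cmod u * exp (Cmod u).
Proof.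
have := @C_mean_value (fun t => Cexp (RtoC t * u)%C) (fun t => u * Cexp (RtoC t * u))%C (Cmod u * exp (Cmod u)).
rewrite Cmult_1_l Cmult_0_l Cexp_0; apply.
- by move=> t _; apply: Cexp_path_Re.
- by move=> t _; apply: Cexp_path_Im.
move=> t ht; rewrite Cmod_mult Cmod_Cexp.
apply: Rmult_le_compat_l; first exact: Cmod_ge_0.
apply: exp_le; apply: Rle_trans (Re_le_norm _) _.
rewrite Cmod_scal; last by lra.
by have := Cmod_ge_0 u; nra.
Qed.

Lemma Cexp_bound2 (u : C) : Cmod (Cexp u - 1 - u)%C <= Cmod u ^ 2 * exp (Cmod u).
Proof.
have := @C_mean_value (fun t => Cexp (RtoC t * u) - RtoC t * u)%C (fun t => u * (Cexp (RtoC t * u) - 1))%C (Cmod u ^ 2 * exp (Cmod u)).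
rewrite Cmult_1_l Cmult_0_l Cexp_0.
have -> : (Cexp u - u - (1 - 0) = Cexp u - 1 - u)%C by ring.
apply.
- move=> t _; apply: (is_derive_ext (fun t => minus (Re (Cexp (RtoC t * u)%C)) (t * Re u))).
    by move=> s; rewrite re_plus re_opp re_scal_l.
  have -> : Re (u * (Cexp (RtoC t * u) - 1))%C = minus (Re (u * Cexp (RtoC t * u))%C) (Re u).
    have -> : (u * (Cexp (RtoC t * u) - 1) = u * Cexp (RtoC t * u) - u)%C by ring.
    by rewrite re_plus re_opp.
  apply: @is_derive_minus; first exact: Cexp_path_Re.
  by auto_derive => //; ring.
- move=> t _; apply: (is_derive_ext (fun t => minus (Im (Cexp (RtoC t * u)%C)) (t * Im u))).
    by move=> s; rewrite im_plus im_opp im_scal_l.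
  have -> : Im (u * (Cexp (RtoC t * u) - 1))%C = minus (Im (u * Cexp (RtoC t * u))%C) (Im u).
    have -> : (u * (Cexp (RtoC t * u) - 1) = u * Cexp (RtoC t * u) - u)%C by ring.
    by rewrite im_plus im_opp.
  apply: @is_derive_minus; first exact: Cexp_path_Im.
  by auto_derive => //; ring.
move=> t ht; rewrite Cmod_mult.
have -> : Cmod u ^ 2 * exp (Cmod u) = Cmod u * (Cmod u * exp (Cmod u)) by ring.
apply: Rmult_le_compat_l; first exact: Cmod_ge_0.
apply: Rle_trans (Cexp_bound1 _) _.
rewrite Cmod_scal; last by lra.
have u0 := Cmod_ge_0 u.
by apply: Rmult_le_compat; [nra | apply/Rlt_le/exp_pos | nra | apply: exp_le; nra].
Qed.

Lemma Cmod_minus_sym (x y : C) : Cmod (x - y)%C = Cmod (y - x)%C.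
Proof. by rewrite -Cmod_opp; congr Cmod; ring. Qed.

Lemma Cmod_triangle_minus (x y : C) : Cmod (x - y)%C <= Cmod x + Cmod y.
Proof. by rewrite -(Cmod_opp y); apply: Cmod_triangle. Qed.

Lemma Cmod_triangle_inv (x y : C) : Cmod x <= Cmod (x - y)%C + Cmod y.
Proof.
have {1}-> : x = (x - y + y)%C by ring.
exact: Cmod_triangle.
Qed.

End ComplexExponential.

(** * Limits and finite sums of complex sequences *)

Section Limits.
Local Open Scope R_scope.

Definition Clim (u : nat -> C) (l : C) : Prop :=
  forall eps, 0 < eps -> exists N0, forall N, (N0 <= N)%coq_nat -> Cmod (u N - l)%C < eps.

Lemma Clim_ext (u v : nat -> C) (l : C) : (forall n, u n = v n) -> Clim u l -> Clim v l.
Proof. by move=> h hu eps he; have [N0 H] := hu _ he; exists N0 => N hN; rewrite -h; apply: H. Qed.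

Lemma Clim_plus (u v : nat -> C) (l m : C) :
  Clim u l -> Clim v m -> Clim (fun n => u n + v n)%C (l + m)%C.
Proof.
move=> hu hv eps he.
have [N1 H1] := hu (eps / 2) ltac:(lra); have [N2 H2] := hv (eps / 2) ltac:(lra).
exists (Nat.max N1 N2) => N hN.
have -> : (u N + v N - (l + m) = (u N - l) + (v N - m))%C by ring.
apply: Rle_lt_trans (Cmod_triangle _ _) _.
by have := H1 N ltac:(lia); have := H2 N ltac:(lia); lra.
Qed.

Lemma Clim_scal (k : C) (u : nat -> C) (l : C) : Clim u l -> Clim (fun n => k * u n)%C (k * l)%C.
Proof.
move=> hu eps he; have k0 := Cmod_ge_0 k.
have [N H] := hu (eps / (Cmod k + 1)) ltac:(apply: Rdiv_lt_0_compat; lra).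
exists N => n hn; have -> : (k * u n - k * l = k * (u n - l))%C by ring.
rewrite Cmod_mult; have := H n hn; set x := Cmod _ => hx.
have x0 : 0 <= x by apply: Cmod_ge_0.
have : x * (Cmod k + 1) < eps.
  by apply: (Rmult_lt_reg_r (/ (Cmod k + 1))); [apply: Rinv_0_lt_compat; lra | field_simplify; lra].
by nra.
Qed.

Lemma Clim_const (l : C) : Clim (fun _ => l) l.
Proof. by move=> eps he; exists 0%nat => N _; rewrite /Cminus Cplus_opp_r Cmod_0. Qed.

Lemma Clim_opp (u : nat -> C) (l : C) : Clim u l -> Clim (fun n => - u n)%C (- l)%C.
Proof.
move=> /(Clim_scal (RtoC (-1))) h.
have -> : (- l = RtoC (-1) * l)%C by ring.
by apply: Clim_ext h => n; ring.
Qed.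

Lemma Clim_minus (u v : nat -> C) (l m : C) :
  Clim u l -> Clim v m -> Clim (fun n => u n - v n)%C (l - m)%C.
Proof. by move=> hu /Clim_opp hv; apply: Clim_plus. Qed.

Lemma Clim_le (u : nat -> C) (l : C) (B : R) :
  Clim u l -> (exists N0, forall N, (N0 <= N)%coq_nat -> Cmod (u N) <= B) -> Cmod l <= B.
Proof.
move=> hu [N0 hB]; apply: le_epsilon => eps he.
have [N1 H] := hu _ he; have := H (Nat.max N0 N1) ltac:(lia).
have := hB (Nat.max N0 N1) ltac:(lia); set x := u _ => hx.
by rewrite Cmod_minus_sym => h2; have := Cmod_triangle_inv l x; lra.
Qed.

Lemma Clim_unique (u : nat -> C) (l m : C) : Clim u l -> Clim u m -> l = m.
Proof.
move=> hl hm; apply/Ceq_minus/Cmod_eq_0/Rle_antisym; last exact: Cmod_ge_0.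
apply: (@Clim_le (fun n => u n - u n)%C); first exact: Clim_minus.
by exists 0%nat => N _; rewrite /Cminus Cplus_opp_r Cmod_0; lra.
Qed.

Lemma Clim_sub (u : nat -> C) (l : C) (phi : nat -> nat) :
  (forall n, (n <= phi n)%coq_nat) -> Clim u l -> Clim (fun n => u (phi n)) l.
Proof.
by move=> hp hu eps he; have [N H] := hu _ he; exists N => n hn; apply: H; have := hp n; lia.
Qed.

Lemma Clim_0 (u : nat -> C) (v : nat -> R) :
  (forall n, Cmod (u n) <= v n) -> is_lim_seq v 0 -> Clim u 0.
Proof.
move=> h /is_lim_seq_spec hv eps he; have [N H] := hv (mkposreal _ he).
exists N => n hn; have := H n hn => /=; rewrite Rminus_0_r /Cminus Copp_0 Cplus_0_r => h2.
by apply: Rle_lt_trans (h n) _; apply: Rle_lt_trans (Rle_abs _) h2.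
Qed.

Lemma Clim_components (u : nat -> C) (l : C) :
  is_lim_seq (fun n => Re (u n)) (Re l) -> is_lim_seq (fun n => Im (u n)) (Im l) -> Clim u l.
Proof.
move=> /is_lim_seq_spec hr /is_lim_seq_spec hi eps he.
have he2 : 0 < eps / 2 by lra.
have [N1 H1] := hr (mkposreal _ he2); have [N2 H2] := hi (mkposreal _ he2).
exists (Nat.max N1 N2) => N hN; apply: Rle_lt_trans (Cmod_le_2 _) _.
rewrite re_plus im_plus re_opp im_opp.
have := H1 N ltac:(lia); have := H2 N ltac:(lia) => /=; rewrite /Rminus; lra.
Qed.

Fixpoint Csum (u : nat -> C) (N : nat) : C :=
  if N is S n then (Csum u n + u n)%C else RtoC 0.

Lemma CsumS (u : nat -> C) (N : nat) : Csum u N.+1 = (Csum u N + u N)%C.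
Proof. by []. Qed.

Lemma Csum_ext (u v : nat -> C) (N : nat) :
  (forall n, (n < N)%coq_nat -> u n = v n) -> Csum u N = Csum v N.
Proof.
elim: N => [//|N IH] h /=; rewrite IH; last by move=> n hn; apply: h; lia.
by rewrite h //; lia.
Qed.

Lemma Csum_plus (u v : nat -> C) (N : nat) : Csum (fun n => u n + v n)%C N = (Csum u N + Csum v N)%C.
Proof. by elim: N => [|N IH] /=; [ring | rewrite IH; ring]. Qed.

Lemma Csum_scal (k : C) (u : nat -> C) (N : nat) : Csum (fun n => k * u n)%C N = (k * Csum u N)%C.
Proof. by elim: N => [|N IH] /=; [ring | rewrite IH; ring]. Qed.

Lemma Csum_minus (u v : nat -> C) (N : nat) : Csum (fun n => u n - v n)%C N = (Csum u N - Csum v N)%C.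
Proof. by elim: N => [|N IH] /=; [ring | rewrite IH; ring]. Qed.

Lemma Csum_const (k : C) (N : nat) : Csum (fun _ => k) N = (RtoC (INR N) * k)%C.
Proof. by elim: N => [|N IH]; [rewrite /=; ring | rewrite S_INR RtoC_plus /= IH; ring]. Qed.

Lemma Csum_recl (u : nat -> C) (N : nat) : Csum u N.+1 = (u 0%nat + Csum (fun n => u n.+1) N)%C.
Proof. by elim: N => [|N IH]; [rewrite /=; ring | rewrite [LHS]/= -/(Csum u N.+1) IH /=; ring]. Qed.

Lemma Csum_swap (u : nat -> nat -> C) (N M : nat) :
  Csum (fun i => Csum (fun j => u i j) M) N = Csum (fun j => Csum (fun i => u i j) N) M.
Proof.
elim: N => [|N IH] /=; last by rewrite IH -Csum_plus.
by elim: M => [//|M IHM] /=; rewrite -IHM; ring.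
Qed.

Lemma Csum_bound (u : nat -> C) (B : R) (N : nat) :
  (forall n, (n < N)%coq_nat -> Cmod (u n) <= B) -> Cmod (Csum u N) <= INR N * B.
Proof.
elim: N => [|N IH] h; first by rewrite /= Cmod_0; lra.
rewrite S_INR /=; apply: Rle_trans (Cmod_triangle _ _) _.
have := h N ltac:(lia); have := IH (fun n hn => h n (Nat.lt_lt_succ_r _ _ hn)); lra.
Qed.

Lemma Re_Csum (u : nat -> C) (N : nat) : Re (Csum u N.+1) = sum_n (fun n => Re (u n)) N.
Proof.
elim: N => [|N IH]; first by rewrite sum_O /= Rplus_0_l.
by rewrite sum_Sn -IH [Csum _ N.+2]/= re_plus.
Qed.

Lemma Im_Csum (u : nat -> C) (N : nat) : Im (Csum u N.+1) = sum_n (fun n => Im (u n)) N.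
Proof.
elim: N => [|N IH]; first by rewrite sum_O /= Rplus_0_l.
by rewrite sum_Sn -IH [Csum _ N.+2]/= im_plus.
Qed.

(** [Series] is a total function, so [Cseries] carries no information by itself; geometric
    domination turns it into an actual limit of partial sums. *)
Lemma Cseries_lim (u : nat -> C) (K : R) :
  (forall n, Cmod (u n) <= K * (/ 2) ^ n) -> Clim (Csum u) (Cseries u).
Proof.
move=> h.
have hg : ex_series (fun n => K * (/ 2) ^ n).
  by apply: (@ex_series_scal R_AbsRing R_NormedModule K); apply: ex_series_geom; rewrite Rabs_pos_eq; lra.
(* [sum_n] includes its upper index and [Csum] does not, hence the shift by one. *)
have hs : Clim (fun n => Csum u n.+1) (Cseries u).
  apply: Clim_components; rewrite /Cseries /=.
  - apply: (is_lim_seq_ext (sum_n (fun n => Re (u n)))); first by move=> n; rewrite -Re_Csum.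
    apply: Series_correct; apply: (@ex_series_le R_AbsRing R_CompleteNormedModule) hg => n.
    exact: Rle_trans (re_le_Cmod _) (h n).
  - apply: (is_lim_seq_ext (sum_n (fun n => Im (u n)))); first by move=> n; rewrite -Im_Csum.
    apply: Series_correct; apply: (@ex_series_le R_AbsRing R_CompleteNormedModule) hg => n.
    exact: Rle_trans (im_le_Cmod _) (h n).
move=> eps he; have [N H] := hs _ he; exists N.+1 => -[|n] hn; first by lia.
by apply: H; lia.
Qed.

Lemma exp_half (n : nat) : exp (- INR n) <= (/ 2) ^ n.
Proof.
elim: n => [|n IH]; first by rewrite /= Ropp_0 exp_0; lra.
rewrite S_INR Ropp_plus_distr exp_plus /= Rmult_comm exp_Ropp.
have h : / exp 1 <= / 2 by apply: Rinv_le_contravar; have := @exp_ineq1 1; lra.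
apply: Rmult_le_compat => //; [apply/Rlt_le/Rinv_0_lt_compat/exp_pos | apply/Rlt_le/exp_pos].
Qed.

End Limits.

(** * Exponentially dominated sums over the integers *)

Section IntegerSums.
Local Open Scope R_scope.

(** This majorant is stable, up to the constant, under the substitutions n + k and 2n + k, and one
    explicit [K] controls both the sum and its tails. *)
Definition dominated (K : R) (f : Z -> C) : Prop :=
  forall n, Cmod (f n) <= K * exp (- Rabs (IZR n)).

(** The range is -N <= n < N: 2N consecutive integers, hence a full period modulo 2N, as finite
    Fourier inversion requires. *)
Definition Zpart (f : Z -> C) (N : nat) : C :=
  Csum (fun n => f (Z.of_nat n) + f (- Z.of_nat n.+1)%Z)%C N.

Lemma dominated_pos (K : R) (f : Z -> C) : dominated K f -> 0 <= K.
Proof.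
move=> /(_ 0%Z); rewrite Rabs_R0 Ropp_0 exp_0 Rmult_1_r.
exact: Rle_trans (Cmod_ge_0 _).
Qed.

Lemma dominated_le (K L : R) (f : Z -> C) : K <= L -> dominated K f -> dominated L f.
Proof.
by move=> hKL h n; apply: Rle_trans (h n) _; apply: Rmult_le_compat_r => //; apply/Rlt_le/exp_pos.
Qed.

Lemma dominated_ext (K : R) (f g : Z -> C) : (forall n, f n = g n) -> dominated K f -> dominated K g.
Proof. by move=> e h n; rewrite -e. Qed.

Lemma dominated_nat (K : R) (f : Z -> C) : dominated K f ->
  (forall n : nat, Cmod (f (Z.of_nat n)) <= K * (/ 2) ^ n) /\
  (forall n : nat, Cmod (f (- Z.of_nat n.+1)%Z) <= K * (/ 2) ^ n).
Proof.
move=> h; have K0 := dominated_pos h; split=> n.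
- apply: Rle_trans (h _) _; apply: Rmult_le_compat_l => //.
  by rewrite -INR_IZR_INZ Rabs_pos_eq; [apply: exp_half | apply: pos_INR].
- apply: Rle_trans (h _) _; apply: Rmult_le_compat_l => //.
  rewrite opp_IZR Rabs_Ropp -INR_IZR_INZ Rabs_pos_eq; last exact: pos_INR.
  by apply: Rle_trans (exp_half n); apply: exp_le; rewrite S_INR; lra.
Qed.

Lemma Zseries_lim (K : R) (f : Z -> C) : dominated K f -> Clim (Zpart f) (Zseries f).
Proof.
move=> /dominated_nat [h1 h2].
apply: (Clim_ext (fun n => esym (Csum_plus _ _ n))).
by apply: Clim_plus; apply: Cseries_lim.
Qed.

Lemma Zpart_bound (K : R) (f : Z -> C) (N : nat) : dominated K f -> Cmod (Zpart f N) <= 4 * K.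
Proof.
move=> h; have K0 := dominated_pos h; have [h1 h2] := dominated_nat h.
suff : Cmod (Zpart f N) <= 4 * K * (1 - (/ 2) ^ N).
  have h3 : 0 <= (/ 2) ^ N by apply: pow_le; lra.
  by move=> h4; nra.
elim: N => [|N IH]; first by rewrite /Zpart /= Cmod_0; lra.
rewrite /Zpart /= -/(Zpart f N); apply: Rle_trans (Cmod_triangle _ _) _.
have := Cmod_triangle (f (Z.of_nat N)) (f (- Z.of_nat N.+1)%Z).
by have := h1 N; have := h2 N; rewrite /=; lra.
Qed.

Lemma Zseries_bound (K : R) (f : Z -> C) : dominated K f -> Cmod (Zseries f) <= 4 * K.
Proof.
move=> h; apply: Clim_le (Zseries_lim h) _; exists 0%nat => N _; exact: Zpart_bound.
Qed.

Lemma Zseries_ext (f g : Z -> C) : (forall n, f n = g n) -> Zseries f = Zseries g.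
Proof.
move=> h; rewrite /Zseries /Cseries.
by congr (Cplus (_, _) (_, _)); apply: Series_ext => n; rewrite h.
Qed.

Lemma dominated_plus (K L : R) (f g : Z -> C) :
  dominated K f -> dominated L g -> dominated (K + L) (fun n => f n + g n)%C.
Proof.
move=> hf hg n; apply: Rle_trans (Cmod_triangle _ _) _.
by have := hf n; have := hg n; lra.
Qed.

Lemma dominated_scal (K : R) (k : C) (f : Z -> C) :
  dominated K f -> dominated (Cmod k * K) (fun n => k * f n)%C.
Proof.
by move=> hf n; rewrite Cmod_mult Rmult_assoc; apply: Rmult_le_compat_l => //; apply: Cmod_ge_0.
Qed.

Lemma Zseries_plus (K L : R) (f g : Z -> C) : dominated K f -> dominated L g ->
  Zseries (fun n => f n + g n)%C = (Zseries f + Zseries g)%C.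
Proof.
move=> hf hg; apply: Clim_unique (Zseries_lim (dominated_plus hf hg)) _.
apply: Clim_ext (Clim_plus (Zseries_lim hf) (Zseries_lim hg)) => N.
by rewrite /Zpart -Csum_plus; apply: Csum_ext => n _; ring.
Qed.

Lemma Zseries_scal (K : R) (k : C) (f : Z -> C) : dominated K f ->
  Zseries (fun n => k * f n)%C = (k * Zseries f)%C.
Proof.
move=> hf; apply: Clim_unique (Zseries_lim (dominated_scal k hf)) _.
apply: Clim_ext (Clim_scal k (Zseries_lim hf)) => N.
by rewrite /Zpart -Csum_scal; apply: Csum_ext => n _; ring.
Qed.

Lemma dominated_minus (K L : R) (f g : Z -> C) :
  dominated K f -> dominated L g -> dominated (K + L) (fun n => f n - g n)%C.
Proof.
move=> hf hg n; apply: Rle_trans (Cmod_triangle_minus _ _) _.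
by have := hf n; have := hg n; lra.
Qed.

Lemma Zseries_minus (K L : R) (f g : Z -> C) : dominated K f -> dominated L g ->
  Zseries (fun n => f n - g n)%C = (Zseries f - Zseries g)%C.
Proof.
move=> hf hg; apply: Clim_unique (Zseries_lim (dominated_minus hf hg)) _.
apply: Clim_ext (Clim_minus (Zseries_lim hf) (Zseries_lim hg)) => N.
by rewrite /Zpart -Csum_minus; apply: Csum_ext => n _; ring.
Qed.

Lemma dominated_0 : dominated 0 (fun _ => RtoC 0).
Proof. by move=> n; rewrite Cmod_0; lra. Qed.

Lemma Zseries_0 : Zseries (fun _ => RtoC 0) = RtoC 0.
Proof.
apply/Cmod_eq_0/Rle_antisym; last exact: Cmod_ge_0.
by have := Zseries_bound dominated_0; lra.
Qed.

Lemma Csum_Zseries (K : R) (f : nat -> Z -> C) (N : nat) : 0 <= K -> (forall j, dominated K (f j)) ->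
  dominated (INR N * K) (fun n => Csum (fun j => f j n) N) /\
  Zseries (fun n => Csum (fun j => f j n) N) = Csum (fun j => Zseries (f j)) N.
Proof.
move=> K0 hf; elim: N => [|N [IH1 IH2]].
  by split; [rewrite /= Rmult_0_l; apply: dominated_0 | apply: Zseries_0].
split; last by rewrite /= -IH2 -(Zseries_plus IH1 (hf N)).
rewrite S_INR Rmult_plus_distr_r Rmult_1_l.
exact: dominated_plus IH1 (hf N).
Qed.

Lemma dominated_shift (K : R) (f : Z -> C) (k : Z) :
  dominated K f -> dominated (K * exp (Rabs (IZR k))) (fun n => f (n + k)%Z).
Proof.
move=> h n; apply: Rle_trans (h _) _; rewrite Rmult_assoc -exp_plus.
apply: Rmult_le_compat_l; first exact: dominated_pos h.
apply: exp_le; rewrite plus_IZR.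
have -> : IZR n = (IZR n + IZR k) + - IZR k by ring.
have := Rabs_triang (IZR n + IZR k) (- IZR k); rewrite Rabs_Ropp.
have -> : IZR n + IZR k + - IZR k + IZR k = IZR n + IZR k by ring.
by lra.
Qed.

Lemma dominated_lim0 (K : R) (f : Z -> C) : dominated K f ->
  Clim (fun n => f (Z.of_nat n)) 0 /\ Clim (fun n => f (- Z.of_nat n)%Z) 0.
Proof.
move=> h; have K0 := dominated_pos h.
have hl : is_lim_seq (fun n => K * (/ 2) ^ n) 0.
  rewrite -(Rmult_0_r K); apply: (is_lim_seq_scal_l _ K 0).
  by apply: is_lim_seq_geom; rewrite Rabs_pos_eq; lra.
split; apply: Clim_0 hl => n; first exact: (proj1 (dominated_nat h)).
apply: Rle_trans (h _) _; apply: Rmult_le_compat_l => //.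
by rewrite opp_IZR Rabs_Ropp -INR_IZR_INZ Rabs_pos_eq; [apply: exp_half | apply: pos_INR].
Qed.

(** Over -N <= n < N the differences collapse to the two end values. This serves both the invariance
    under shifts and the integrals over the real line, given by a primitive. *)
Lemma Zseries_telescope (K : R) (F : Z -> C) : dominated K (fun n => F (n + 1)%Z - F n)%C ->
  Clim (fun N => F (Z.of_nat N) - F (- Z.of_nat N)%Z)%C (Zseries (fun n => F (n + 1)%Z - F n)%C).
Proof.
move=> h; apply: Clim_ext (Zseries_lim h) => N; rewrite /Zpart.
elim: N => [|N IH]; first by rewrite /=; ring.
rewrite CsumS IH.
have -> : (Z.of_nat N + 1)%Z = Z.of_nat N.+1 by lia.
have -> : (- Z.of_nat N.+1 + 1)%Z = (- Z.of_nat N)%Z by lia.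
by ring.
Qed.

(** No rearrangement is involved: the difference of the two sums telescopes and the dominated terms
    vanish at both ends. *)
Lemma Zseries_shift1 (K : R) (f : Z -> C) : dominated K f ->
  Zseries (fun n => f (n + 1)%Z) = Zseries f.
Proof.
move=> h; have hs := dominated_shift 1 h.
apply/Ceq_minus; rewrite -(Zseries_minus hs h).
apply: Clim_unique (Zseries_telescope (dominated_minus hs h)) _.
have -> : RtoC 0 = (0 - 0)%C by ring.
by have [h1 h2] := dominated_lim0 h; apply: Clim_minus.
Qed.

Lemma Zseries_shift (K : R) (f : Z -> C) (k : Z) : dominated K f ->
  Zseries (fun n => f (n + k)%Z) = Zseries f.
Proof.
move=> h.
have hpos (m : nat) : Zseries (fun n => f (n + Z.of_nat m)%Z) = Zseries f.
  elim: m => [|m IH]; first by apply: Zseries_ext => n; congr f; lia.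
  rewrite -IH -(Zseries_shift1 (dominated_shift (Z.of_nat m) h)).
  by apply: Zseries_ext => n; congr f; lia.
have [m [->|->]] : exists m : nat, k = Z.of_nat m \/ k = (- Z.of_nat m)%Z.
  by exists (Z.abs_nat k); lia.
  exact: hpos.
have hs := dominated_shift (- Z.of_nat m) h.
elim: m hs => [|m IH] hs; first by apply: Zseries_ext => n; congr f; lia.
rewrite -(IH (dominated_shift _ h)) -(Zseries_shift1 hs).
by apply: Zseries_ext => n; congr f; lia.
Qed.

Lemma dominated_double (K : R) (f : Z -> C) (k : Z) : dominated K f ->
  dominated (K * exp (Rabs (IZR k))) (fun n => f (2 * n + k)%Z).
Proof.
move=> /(dominated_shift k) h n.
apply: Rle_trans (h (2 * n)%Z) _; apply: Rmult_le_compat_l; first exact: dominated_pos h.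
by apply: exp_le; rewrite mult_IZR Rabs_mult (Rabs_pos_eq 2); have := Rabs_pos (IZR n); lra.
Qed.

(** The partial sum of order 2N is exactly the sum of the partial sums of order N over even and over
    odd indices. *)
Lemma Zseries_parity (K : R) (f : Z -> C) : dominated K f ->
  Zseries f = (Zseries (fun n => f (2 * n)%Z) + Zseries (fun n => f (2 * n + 1)%Z))%C.
Proof.
move=> h.
have h0 : dominated (K * exp (Rabs 0)) (fun n => f (2 * n)%Z).
  by apply: dominated_ext (dominated_double 0 h) => n; congr f; lia.
apply: (@Clim_unique (fun N => Zpart f (2 * N)%coq_nat)).
  by apply: Clim_sub (Zseries_lim h) => n; lia.
apply: Clim_ext (Clim_plus (Zseries_lim h0) (Zseries_lim (dominated_double 1 h))) => N.
rewrite /Zpart -Csum_plus; elim: N => [//|N IH].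
have -> : (2 * N.+1)%coq_nat = ((2 * N)%coq_nat).+2 by lia.
rewrite !CsumS IH.
have -> : (2 * Z.of_nat N)%Z = Z.of_nat (2 * N)%coq_nat by lia.
have -> : (2 * - Z.of_nat N.+1)%Z = (- Z.of_nat ((2 * N)%coq_nat).+2)%Z by lia.
have -> : (Z.of_nat (2 * N)%coq_nat + 1)%Z = Z.of_nat ((2 * N)%coq_nat).+1 by lia.
have -> : (- Z.of_nat ((2 * N)%coq_nat).+2 + 1)%Z = (- Z.of_nat ((2 * N)%coq_nat).+1)%Z by lia.
ring.
Qed.

End IntegerSums.

(** * The principal square root *)

Section SquareRoot.
Local Open Scope R_scope.

(* The principal branch; the junk value [0] on the closed negative real axis. *)
Definition Csqrt (z : C) : C :=
  let p := sqrt ((Cmod z + Re z) / 2) in (p, Im z / (2 * p)).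

Definition slit_plane (z : C) : Prop := 0 < Cmod z + Re z.

Lemma slit_Re (z : C) : 0 < Re z -> slit_plane z.
Proof. by rewrite /slit_plane => h; have := Cmod_ge_0 z; lra. Qed.

Lemma Csqrt_Re_pos (z : C) : slit_plane z -> 0 < Re (Csqrt z).
Proof. by rewrite /slit_plane => h; apply: sqrt_lt_R0; lra. Qed.

Lemma Csqrt_Re_ge0 (z : C) : 0 <= Re (Csqrt z).
Proof. exact: sqrt_pos. Qed.

Lemma Csqrt_sqr (z : C) : slit_plane z -> (Csqrt z * Csqrt z = z)%C.
Proof.
move=> h; have hp := Csqrt_Re_pos h; have e := Cmod2_alt z.
move: hp h e; rewrite /slit_plane /Csqrt /=; set m := Cmod z.
set p := sqrt _ => hp h e.
have pp : p * p = (m + Re z) / 2 by rewrite /p sqrt_sqrt //; lra.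
apply: Ceq; [rewrite re_mult /= | by rewrite im_mult /=; field; lra].
have -> : p * p - Im z / (2 * p) * (Im z / (2 * p)) = p * p - Im z * Im z / (4 * (p * p)).
  by field; lra.
rewrite pp.
have -> : Im z * Im z = (m - Re z) * (m + Re z) by lra.
by field; lra.
Qed.

Lemma sqr_eq_C (u v : C) : (u * u = v * v)%C -> u = v \/ u = (- v)%C.
Proof.
move=> h; have : ((u - v) * (u + v) = 0)%C by transitivity (u * u - v * v)%C; [ring | rewrite h; ring].
case: (Ceq_dec (u - v)%C 0) => [h1 _|h1]; first by left; apply/Ceq_minus.
case: (Ceq_dec (u + v)%C 0) => [h2|h2] h3; last by case: (Cmult_neq_0 _ _ h1 h2).
by right; rewrite -[RHS]Cplus_0_l -h2; ring.
Qed.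

Lemma sqr_eq_Re_pos (u v : C) : (u * u = v * v)%C -> 0 < Re u -> 0 < Re v -> u = v.
Proof. by move=> /sqr_eq_C [//|->]; rewrite re_opp; lra. Qed.

Lemma Csqrt_unique (u z : C) : (u * u = z)%C -> 0 < Re u -> slit_plane z -> Csqrt z = u.
Proof.
by move=> h hu hz; apply: sqr_eq_Re_pos => //; [rewrite Csqrt_sqr | apply: Csqrt_Re_pos].
Qed.

(** The right half-plane is sent into the sector |arg| < pi/4. Two such roots multiply into the
    right half-plane, which is how signs of products of square roots are decided below. *)
Lemma Csqrt_cone (z : C) : 0 < Re z -> Rabs (Im (Csqrt z)) < Re (Csqrt z).
Proof.
move=> h; have hs := slit_Re h; have hp := Csqrt_Re_pos hs.
have := f_equal Re (Csqrt_sqr hs); rewrite re_mult => e.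
by apply: Rabs_def1; nra.
Qed.

Lemma Csqrt_scal (t : R) (z : C) : 0 < t -> slit_plane z ->
  Csqrt (RtoC t * z)%C = (RtoC (sqrt t) * Csqrt z)%C.
Proof.
move=> ht hz; have st := sqrt_lt_R0 _ ht.
apply: Csqrt_unique.
- transitivity (RtoC (sqrt t * sqrt t) * (Csqrt z * Csqrt z))%C; first by rewrite RtoC_mult; ring.
  by rewrite Csqrt_sqr // sqrt_sqrt //; lra.
- by rewrite re_scal_l; apply: Rmult_lt_0_compat => //; apply: Csqrt_Re_pos.
- move: hz; rewrite /slit_plane re_scal_l Cmod_scal; last by lra.
  by move=> hz; nra.
Qed.

(** The difference of squares factors, and the sum of the two roots has real part at least that of
    [Csqrt z0]. *)
Lemma Csqrt_lipschitz (z z0 : C) : slit_plane z -> slit_plane z0 ->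
  Cmod (Csqrt z - Csqrt z0)%C * Re (Csqrt z0) <= Cmod (z - z0)%C.
Proof.
move=> hz hz0.
have -> : (z - z0 = (Csqrt z - Csqrt z0) * (Csqrt z + Csqrt z0))%C.
  by rewrite -{1}(Csqrt_sqr hz) -{1}(Csqrt_sqr hz0); ring.
rewrite Cmod_mult; apply: Rmult_le_compat_l; first exact: Cmod_ge_0.
apply: Rle_trans (Re_le_norm _); rewrite re_plus.
by have := Csqrt_Re_ge0 z; lra.
Qed.

Lemma Csqrt_RtoC (t : R) : 0 < t -> Csqrt (RtoC t) = RtoC (sqrt t).
Proof.
move=> ht; apply: Csqrt_unique; last by apply: slit_Re; rewrite re_RtoC.
  by rewrite -RtoC_mult sqrt_sqrt //; lra.
by rewrite re_RtoC; apply: sqrt_lt_R0.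
Qed.

End SquareRoot.

(** * An entire primitive of the Gaussian *)

Section GaussianPrimitive.
Local Open Scope R_scope.

Lemma is_derive_quadratic (f : R -> R) (t d M rho : R) : 0 < rho ->
  (forall e, Rabs e <= rho -> Rabs (f (t + e) - f t - e * d) <= M * e ^ 2) -> is_derive f t d.
Proof.
move=> hr h; apply/is_derive_Reals => eps he.
have M0 : 0 <= M.
  have := h rho ltac:(rewrite Rabs_pos_eq; lra).
  have h2 : 0 < rho ^ 2 by apply: pow_lt.
  by have := Rabs_pos (f (t + rho) - f t - rho * d); nra.
have hd : 0 < Rmin rho (eps / (M + 1)) by apply: Rmin_pos => //; apply: Rdiv_lt_0_compat; lra.
exists (mkposreal _ hd) => e e0 /= he2.
have h1 : Rabs e <= rho by have := Rmin_l rho (eps / (M + 1)); lra.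
have h2 : Rabs e < eps / (M + 1) by have := Rmin_r rho (eps / (M + 1)); lra.
have -> : (f (t + e) - f t) / e - d = (f (t + e) - f t - e * d) / e by field.
rewrite Rabs_div //; have a0 : 0 < Rabs e by apply: Rabs_pos_lt.
apply: (Rmult_lt_reg_r (Rabs e)) => //.
rewrite /Rdiv Rmult_assoc Rinv_l ?Rmult_1_r; last by lra.
apply: Rle_lt_trans (h e h1) _; rewrite -(pow2_abs e).
have : Rabs e * (M + 1) < eps.
  by apply: (Rmult_lt_reg_r (/ (M + 1))); [apply: Rinv_0_lt_compat; lra | field_simplify; lra].
by move=> h3; nra.
Qed.

(** Complex differentiability with a quadratic remainder on the unit disc; such a bound restricts
    directly to real paths. *)
Definition Cquad_deriv (F : C -> C) (z D : C) : Prop :=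
  exists M, forall h, Cmod h <= 1 -> Cmod (F (z + h) - F z - h * D)%C <= M * Cmod h ^ 2.

Lemma Cquad_deriv_path (F : C -> C) (z h D : C) (t : R) : Cquad_deriv F (z + RtoC t * h)%C D ->
  is_derive (fun t => Re (F (z + RtoC t * h)%C)) t (Re (h * D)%C) /\
  is_derive (fun t => Im (F (z + RtoC t * h)%C)) t (Im (h * D)%C).
Proof.
move=> [M hM].
have h0 := Cmod_ge_0 h.
have hr : 0 < / (Cmod h + 1) by apply: Rinv_0_lt_compat; lra.
have est (e : R) : Rabs e <= / (Cmod h + 1) ->
    Cmod (F (z + RtoC (t + e) * h) - F (z + RtoC t * h) - RtoC e * (h * D))%C <= M * Cmod h ^ 2 * e ^ 2.
  move=> he; have := hM (RtoC e * h)%C; rewrite Cmod_mult Cmod_R.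
  have -> : (z + RtoC t * h + RtoC e * h = z + RtoC (t + e) * h)%C by rewrite RtoC_plus; ring.
  have -> : (RtoC e * h * D = RtoC e * (h * D))%C by ring.
  have -> : M * (Rabs e * Cmod h) ^ 2 = M * Cmod h ^ 2 * e ^ 2 by rewrite -(pow2_abs e); ring.
  apply; have := Rmult_le_compat_r _ _ _ (Rlt_le _ _ (_ : 0 < Cmod h + 1)) he.
  rewrite Rinv_l; last by lra.
  by move=> /(_ ltac:(lra)); have := Rabs_pos e; nra.
split; apply: (is_derive_quadratic hr) => e /est; apply: Rle_trans.
- apply: Rle_trans (re_le_Cmod _); right.
  by rewrite /Cminus !re_plus !re_opp re_scal_l.
- apply: Rle_trans (im_le_Cmod _); right.
  by rewrite /Cminus !im_plus !im_opp im_scal_l.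
Qed.

Definition Cgauss (z : C) : C := Cexp (RtoC (- PI) * (z * z))%C.

Definition gauss_ray (z : C) (t : R) : C := (z * Cexp (RtoC (t * t) * (RtoC (- PI) * (z * z))))%C.

(* The integral of [Cgauss] along the segment from [0] to [z]. *)
Definition Cerf (z : C) : C :=
  (RInt (fun t => Re (gauss_ray z t)) 0 1, RInt (fun t => Im (gauss_ray z t)) 0 1).

Lemma continuous_gauss_ray (z : C) (t : R) :
  continuous (fun t => Re (gauss_ray z t)) t /\ continuous (fun t => Im (gauss_ray z t)) t.
Proof.
set u := (RtoC (- PI) * (z * z))%C.
split; apply: (@ex_derive_continuous R_AbsRing R_NormedModule).
- apply: (ex_derive_ext (fun t => Re z * (exp (t * t * Re u) * cos (t * t * Im u)) - Im z * (exp (t * t * Re u) * sin (t * t * Im u)))).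
    by move=> s; rewrite /gauss_ray Cexp_scal re_mult.
  by auto_derive.
- apply: (ex_derive_ext (fun t => Re z * (exp (t * t * Re u) * sin (t * t * Im u)) + Im z * (exp (t * t * Re u) * cos (t * t * Im u)))).
    by move=> s; rewrite /gauss_ray Cexp_scal im_mult.
  by auto_derive.
Qed.

(** The derivative of [gauss_ray] in z. It is also the derivative in t of t exp(t^2 u), so its
    integral over [0, 1] is exactly [Cgauss z]; this coincidence makes [Cerf] a primitive without
    Cauchy's theorem. *)
Definition gauss_ray_deriv (z : C) (t : R) : C :=
  let u := (RtoC (- PI) * (z * z))%C in ((1 + RtoC (2 * (t * t)) * u) * Cexp (RtoC (t * t) * u))%C.

Lemma RInt_gauss_ray_deriv (z : C) :
  is_RInt (fun t => Re (gauss_ray_deriv z t)) 0 1 (Re (Cgauss z)) /\ is_RInt (fun t => Im (gauss_ray_deriv z t)) 0 1 (Im (Cgauss z)).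
Proof.
rewrite /gauss_ray_deriv /Cgauss; set u := (RtoC (- PI) * (z * z))%C; cbv zeta; clearbody u.
have eR t : Re ((1 + RtoC (2 * (t * t)) * u) * Cexp (RtoC (t * t) * u))%C =
   (1 + 2 * (t * t) * Re u) * (exp (t * t * Re u) * cos (t * t * Im u)) -
   2 * (t * t) * Im u * (exp (t * t * Re u) * sin (t * t * Im u)).
  by rewrite Cexp_scal re_mult re_plus im_plus re_scal_l im_scal_l /=; ring.
have eI t : Im ((1 + RtoC (2 * (t * t)) * u) * Cexp (RtoC (t * t) * u))%C =
   (1 + 2 * (t * t) * Re u) * (exp (t * t * Re u) * sin (t * t * Im u)) +
   2 * (t * t) * Im u * (exp (t * t * Re u) * cos (t * t * Im u)).
  by rewrite Cexp_scal im_mult re_plus im_plus re_scal_l im_scal_l /=; ring.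
split.
- pose f t := t * (exp (t * t * Re u) * cos (t * t * Im u)).
  have -> : Re (Cexp u) = minus (f 1) (f 0).
    by rewrite /f /minus /plus /opp /= !Rmult_1_l; ring.
  apply: (is_RInt_ext (fun t => (1 + 2 * (t * t) * Re u) * (exp (t * t * Re u) * cos (t * t * Im u)) -
   2 * (t * t) * Im u * (exp (t * t * Re u) * sin (t * t * Im u)))) => [t _|]; first by rewrite eR.
  apply: (@is_RInt_derive R_CompleteNormedModule) => t _; last first.
    by apply: (@ex_derive_continuous R_AbsRing R_NormedModule); auto_derive.
  by rewrite /f; auto_derive => //; ring.
- pose f t := t * (exp (t * t * Re u) * sin (t * t * Im u)).
  have -> : Im (Cexp u) = minus (f 1) (f 0).
    by rewrite /f /minus /plus /opp /= !Rmult_1_l; ring.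
  apply: (is_RInt_ext (fun t => (1 + 2 * (t * t) * Re u) * (exp (t * t * Re u) * sin (t * t * Im u)) +
   2 * (t * t) * Im u * (exp (t * t * Re u) * cos (t * t * Im u)))) => [t _|]; first by rewrite eI.
  apply: (@is_RInt_derive R_CompleteNormedModule) => t _; last first.
    by apply: (@ex_derive_continuous R_AbsRing R_NormedModule); auto_derive.
  by rewrite /f; auto_derive => //; ring.
Qed.

Lemma RInt_C_bound (f g d : R -> R) (If Ig Id B : R) :
  is_RInt f 0 1 If -> is_RInt g 0 1 Ig -> is_RInt d 0 1 Id ->
  (forall t, 0 <= t <= 1 -> Rabs (f t - g t - d t) <= B) -> Rabs (If - Ig - Id) <= B.
Proof.
move=> hf hg hd hB.
have h := is_RInt_minus _ _ _ _ _ _ (is_RInt_minus _ _ _ _ _ _ hf hg) hd.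
have e : If - Ig - Id = RInt (fun t => minus (minus (f t) (g t)) (d t)) 0 1 by rewrite (is_RInt_unique _ _ _ _ h).
rewrite e; have -> : B = (1 - 0) * B by ring.
by apply: abs_RInt_le_const; [lra | exists (minus (minus If Ig) Id) | exact: hB].
Qed.

(** Differentiation under the integral sign: the quadratic remainder of the integrand is uniform in
    t. *)
Lemma Cerf_deriv (z : C) : Cquad_deriv Cerf z (Cgauss z).
Proof.
set u := (RtoC (- PI) * (z * z))%C.
have z0 := Cmod_ge_0 z; have pi0 := PI_RGT_0.
(* For |h| <= 1 the increment v of the exponent satisfies |v| <= P |h|. [M] collects the three error
   terms, and the factor 2 pays for treating real and imaginary parts separately. *)
pose P := PI * (2 * Cmod z + 1).
have P0 : 0 < P by apply: Rmult_lt_0_compat; lra.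
pose M := exp (Cmod u) * (Cmod z * P ^ 2 * exp P + P * exp P + PI * Cmod z).
exists (2 * M) => h hh; have h0 := Cmod_ge_0 h.
have est t : 0 <= t <= 1 ->
    Cmod (gauss_ray (z + h) t - gauss_ray z t - h * gauss_ray_deriv z t)%C <= M * Cmod h ^ 2.
  move=> ht; have ht2 : 0 <= t * t <= 1 by nra.
  pose v := (RtoC (t * t) * (RtoC (- PI) * (2 * z * h + h * h)))%C.
  have -> : (gauss_ray (z + h) t - gauss_ray z t - h * gauss_ray_deriv z t =
      Cexp (RtoC (t * t) * u) * (z * (Cexp v - 1 - v) + h * (Cexp v - 1) + RtoC (t * t * - PI) * (z * (h * h))))%C.
    rewrite /gauss_ray /gauss_ray_deriv -/u.
    have -> : (RtoC (t * t) * (RtoC (- PI) * ((z + h) * (z + h))) = RtoC (t * t) * u + v)%C.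
      by rewrite /u /v; ring.
    by rewrite Cexp_add; set e1 := Cexp _; set e2 := Cexp _; rewrite /u /v !RtoC_mult; ring.
  have hv : Cmod v <= P * Cmod h.
    rewrite /v !Cmod_mult !Cmod_R Rabs_pos_eq; last by lra.
    rewrite Rabs_Ropp Rabs_pos_eq; last by lra.
    have -> : (2 * z * h + h * h = h * (2 * z + h))%C by ring.
    rewrite Cmod_mult /P.
    have : Cmod (2 * z + h)%C <= 2 * Cmod z + 1.
      by apply: Rle_trans (Cmod_triangle _ _) _; rewrite Cmod_scal; lra.
    have q0 := Cmod_ge_0 (2 * z + h)%C => q1.
    have a1 : Cmod h * Cmod (2 * z + h)%C <= Cmod h * (2 * Cmod z + 1) by apply: Rmult_le_compat_l.
    have a2 : 0 <= Cmod h * Cmod (2 * z + h)%C by apply: Rmult_le_pos.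
    have a3 : PI * (Cmod h * Cmod (2 * z + h)%C) <= PI * (Cmod h * (2 * Cmod z + 1)) by apply: Rmult_le_compat_l; lra.
    have a4 : 0 <= PI * (Cmod h * Cmod (2 * z + h)%C) by apply: Rmult_le_pos; lra.
    have := Rmult_le_compat_r _ _ _ a4 (proj2 ht2).
    by lra.
  have v0 := Cmod_ge_0 v.
  have hv1 : Cmod v <= P by nra.
  have eP := exp_pos P.
  have b1 : Cmod (Cexp v - 1)%C <= P * exp P * Cmod h.
    apply: Rle_trans (Cexp_bound1 _) _.
    have -> : P * exp P * Cmod h = P * Cmod h * exp P by ring.
    by apply: Rmult_le_compat => //; [apply/Rlt_le/exp_pos | apply: exp_le].
  have b2 : Cmod (Cexp v - 1 - v)%C <= P ^ 2 * exp P * Cmod h ^ 2.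
    apply: Rle_trans (Cexp_bound2 _) _.
    have -> : P ^ 2 * exp P * Cmod h ^ 2 = (P * Cmod h) ^ 2 * exp P by ring.
    apply: Rmult_le_compat; [exact: pow2_ge_0 | apply/Rlt_le/exp_pos | | exact: exp_le].
    by apply: pow_incr.
  have -> : M * Cmod h ^ 2 = exp (Cmod u) * ((Cmod z * P ^ 2 * exp P + P * exp P + PI * Cmod z) * Cmod h ^ 2).
    by rewrite /M; ring.
  rewrite Cmod_mult; apply: Rmult_le_compat; try exact: Cmod_ge_0.
    rewrite Cmod_Cexp; apply: exp_le; apply: Rle_trans (Re_le_norm _) _.
    by rewrite Cmod_scal; have := Cmod_ge_0 u; nra.
  apply: Rle_trans (Cmod_triangle _ _) _.
  have b3 : Cmod (RtoC (t * t * - PI) * (z * (h * h)))%C <= PI * Cmod z * Cmod h ^ 2.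
    rewrite !Cmod_mult Cmod_R.
    have -> : t * t * - PI = - (t * t * PI) by ring.
    rewrite Rabs_Ropp Rabs_pos_eq; last by nra.
    have : 0 <= PI * (Cmod z * (Cmod h * Cmod h)).
      by apply: Rmult_le_pos; [lra | apply: Rmult_le_pos => //; apply: Rmult_le_pos].
    set q := Cmod z * (Cmod h * Cmod h) => hq.
    have -> : PI * Cmod z * Cmod h ^ 2 = PI * q by rewrite /q; ring.
    by have := Rmult_le_compat_r _ _ _ hq (proj2 ht2); lra.
  have := Cmod_triangle (z * (Cexp v - 1 - v))%C (h * (Cexp v - 1))%C.
  rewrite (Cmod_mult z) (Cmod_mult h) => b4.
  have b5 : Cmod z * Cmod (Cexp v - 1 - v)%C <= Cmod z * (P ^ 2 * exp P * Cmod h ^ 2) by apply: Rmult_le_compat_l.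
  have b6 : Cmod h * Cmod (Cexp v - 1)%C <= Cmod h * (P * exp P * Cmod h) by apply: Rmult_le_compat_l.
  by lra.
have ex x : ex_RInt (fun t => Re (gauss_ray x t)) 0 1 /\ ex_RInt (fun t => Im (gauss_ray x t)) 0 1.
  by split; apply: (@ex_RInt_continuous R_CompleteNormedModule) => t _; have [] := continuous_gauss_ray x t.
have [r1 i1] := ex (z + h)%C; have [r2 i2] := ex z.
have [r3 i3] := RInt_gauss_ray_deriv z.
apply: Rle_trans (Cmod_le_2 _) _.
have -> : 2 * M * Cmod h ^ 2 = M * Cmod h ^ 2 + M * Cmod h ^ 2 by ring.
have lin a b c d : is_RInt a 0 1 c -> is_RInt b 0 1 d ->
   forall p q, is_RInt (fun t => p * a t + q * b t) 0 1 (p * c + q * d).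
  move=> ha hb p q; apply: (@is_RInt_plus R_NormedModule); exact: is_RInt_scal.
apply: Rplus_le_compat.
- have -> : Re (Cerf (z + h) - Cerf z - h * Cgauss z)%C =
     RInt (fun t => Re (gauss_ray (z + h)%C t)) 0 1 - RInt (fun t => Re (gauss_ray z t)) 0 1
     - (Re h * Re (Cgauss z) + - Im h * Im (Cgauss z)).
    by rewrite /Cminus !re_plus !re_opp re_mult /=; ring.
  apply: (RInt_C_bound (RInt_correct _ _ _ r1) (RInt_correct _ _ _ r2) (lin _ _ _ _ r3 i3 _ _)) => t ht.
  apply: Rle_trans (est t ht); apply: Rle_trans (re_le_Cmod _); right; congr Rabs.
  by rewrite /Cminus !re_plus !re_opp re_mult; ring.
- have -> : Im (Cerf (z + h) - Cerf z - h * Cgauss z)%C =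
     RInt (fun t => Im (gauss_ray (z + h)%C t)) 0 1 - RInt (fun t => Im (gauss_ray z t)) 0 1
     - (Re h * Im (Cgauss z) + Im h * Re (Cgauss z)).
    by rewrite /Cminus !im_plus !im_opp im_mult /=; ring.
  apply: (RInt_C_bound (RInt_correct _ _ _ i1) (RInt_correct _ _ _ i2) (lin _ _ _ _ i3 r3 _ _)) => t ht.
  apply: Rle_trans (est t ht); apply: Rle_trans (im_le_Cmod _); right; congr Rabs.
Qed.

End GaussianPrimitive.

(** * Estimates for the Gaussian primitive along segments *)

Section GaussianPrimitiveEstimates.
Local Open Scope R_scope.

Lemma is_derive_lin (a t : R) : is_derive (fun t => t * a) t a.
Proof. by auto_derive => //; ring. Qed.

Lemma Clim_0_inv (u : nat -> C) (A : R) (N0 : nat) :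
  (forall N, (N0 <= N)%coq_nat -> (1 <= N)%coq_nat -> Cmod (u N) <= A / INR N) -> Clim u 0.
Proof.
move=> h eps he.
have [N1 hN1] := nfloor_ex (Rabs A / eps) ltac:(apply: Rdiv_le_0_compat => //; apply: Rabs_pos).
exists (N0 + N1)%coq_nat.+1 => N hN; rewrite /Cminus Copp_0 Cplus_0_r.
have N_pos : 0 < INR N by apply: lt_0_INR; lia.
have hN1' : (N0 <= N)%coq_nat by lia.
have hN2' : (1 <= N)%coq_nat by lia.
have hN2 := h N hN1' hN2'.
apply: Rle_lt_trans hN2 _.
apply: (Rmult_lt_reg_r (INR N)) => //; rewrite /Rdiv Rmult_assoc Rinv_l ?Rmult_1_r; last by lra.
apply: Rle_lt_trans (Rle_abs A) _.
have : INR N1 + 1 <= INR N by rewrite -S_INR; apply: le_INR; lia.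
have : Rabs A < eps * (INR N1 + 1).
  apply: (Rmult_lt_reg_r (/ eps)); first exact: Rinv_0_lt_compat.
  by have -> : eps * (INR N1 + 1) * / eps = INR N1 + 1 by [field; lra]; lra.
by nra.
Qed.

Lemma Cmod_Cgauss (z : C) : Cmod (Cgauss z) = exp (- PI * (Re z * Re z - Im z * Im z)).
Proof. by rewrite /Cgauss Cmod_Cexp re_scal_l re_mult. Qed.

(** The slope [k] is free: [Cgauss z] gives the local second-order remainder, and 0 gives the bound
    needed to move an endpoint. *)
Lemma Cerf_segment (z h k : C) (B : R) :
  (forall t, 0 <= t <= 1 -> Cmod (h * (Cgauss (z + RtoC t * h) - k))%C <= B) ->
  Cmod (Cerf (z + h) - Cerf z - h * k)%C <= B.
Proof.
move=> hB.
have := @C_mean_value (fun t => Cerf (z + RtoC t * h) - RtoC t * (h * k))%C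
  (fun t => h * (Cgauss (z + RtoC t * h) - k))%C B.
have -> : (z + RtoC 1 * h = z + h)%C by ring.
have -> : (z + RtoC 0 * h = z)%C by ring.
have -> : (Cerf (z + h) - RtoC 1 * (h * k) - (Cerf z - RtoC 0 * (h * k)) = Cerf (z + h) - Cerf z - h * k)%C by ring.
apply=> // t _; have [dR dI] := Cquad_deriv_path (Cerf_deriv (z + RtoC t * h)%C).
- apply: (is_derive_ext (fun t => minus (Re (Cerf (z + RtoC t * h)%C)) (t * Re (h * k)%C))).
    by move=> s; rewrite /Cminus re_plus re_opp re_scal_l.
  have -> : Re (h * (Cgauss (z + RtoC t * h) - k))%C = minus (Re (h * Cgauss (z + RtoC t * h))%C) (Re (h * k)%C).
    have -> : (h * (Cgauss (z + RtoC t * h) - k) = h * Cgauss (z + RtoC t * h) - h * k)%C by ring.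
    by rewrite /Cminus re_plus re_opp.
  by apply: @is_derive_minus => //; apply: is_derive_lin.
- apply: (is_derive_ext (fun t => minus (Im (Cerf (z + RtoC t * h)%C)) (t * Im (h * k)%C))).
    by move=> s; rewrite /Cminus im_plus im_opp im_scal_l.
  have -> : Im (h * (Cgauss (z + RtoC t * h) - k))%C = minus (Im (h * Cgauss (z + RtoC t * h))%C) (Im (h * k)%C).
    have -> : (h * (Cgauss (z + RtoC t * h) - k) = h * Cgauss (z + RtoC t * h) - h * k)%C by ring.
    by rewrite /Cminus im_plus im_opp.
  by apply: @is_derive_minus => //; apply: is_derive_lin.
Qed.

(** Keeping [Cmod (Cgauss z)] as a factor, instead of a bound uniform in z, is what makes these
    errors summable over the integers. *)
Lemma Cerf_remainder (z h : C) :
  let Q := PI * (2 * Cmod z + Cmod h) in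
  Cmod (Cerf (z + h) - Cerf z - h * Cgauss z)%C <=
    Cmod (Cgauss z) * (Q * Cmod h ^ 2 * exp (Q * Cmod h)).
Proof.
move=> Q; have pi0 := PI_RGT_0; have z0 := Cmod_ge_0 z; have h0 := Cmod_ge_0 h.
have Q0 : 0 <= Q by apply: Rmult_le_pos; lra.
apply: Cerf_segment => t ht.
pose v := (RtoC (- PI) * (RtoC t * h * (2 * z + RtoC t * h)))%C.
have -> : (h * (Cgauss (z + RtoC t * h) - Cgauss z) = Cgauss z * (h * (Cexp v - 1)))%C.
  rewrite /Cgauss.
  have -> : (RtoC (- PI) * ((z + RtoC t * h) * (z + RtoC t * h)) = RtoC (- PI) * (z * z) + v)%C.
    by rewrite /v; ring.
  by rewrite Cexp_add; ring.
rewrite Cmod_mult; apply: Rmult_le_compat_l; first exact: Cmod_ge_0.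
rewrite Cmod_mult.
have hv : Cmod v <= Q * Cmod h.
  rewrite /v !Cmod_mult !Cmod_R Rabs_Ropp (Rabs_pos_eq PI) ?(Rabs_pos_eq t); try lra.
  have q1 : Cmod (2 * z + RtoC t * h)%C <= 2 * Cmod z + Cmod h.
    by apply: Rle_trans (Cmod_triangle _ _) _; rewrite !Cmod_scal; try lra; nra.
  have q0 := Cmod_ge_0 (2 * z + RtoC t * h)%C.
  have -> : Q * Cmod h = PI * (Cmod h * (2 * Cmod z + Cmod h)) by rewrite /Q; ring.
  apply: Rmult_le_compat_l; first by lra.
  by apply: Rmult_le_compat => //; nra.
have v0 := Cmod_ge_0 v.
have -> : Q * Cmod h ^ 2 * exp (Q * Cmod h) = Cmod h * (Q * Cmod h * exp (Q * Cmod h)) by ring.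
apply: Rmult_le_compat_l => //; apply: Rle_trans (Cexp_bound1 _) _.
by apply: Rmult_le_compat => //; [apply/Rlt_le/exp_pos | apply: exp_le].
Qed.

Lemma exp_neg_sqr_le (u : R) : 0 < u -> exp (- PI * (u * u)) <= / (u * u).
Proof.
move=> u0; have pi := PI2_3_2; have uu : 0 < u * u by apply: Rmult_lt_0_compat.
rewrite -Ropp_mult_distr_l exp_Ropp; apply: Rinv_le_contravar => //.
have := exp_ineq1_le (PI * (u * u)); nra.
Qed.

(* The segment from [M] to [p M + eta] stays in a region where the Gaussian decays. *)
Lemma Cerf_rotation (p eta : C) (sg : R) : sg * sg = 1 -> Rabs (Im p) < Re p ->
  Clim (fun M => Cerf (RtoC sg * (p * RtoC (INR M) + eta)) - Cerf (RtoC sg * RtoC (INR M)))%C 0.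
Proof.
move=> hsg hp.
have e0 := Cmod_ge_0 eta; have p0 := Cmod_ge_0 (p - 1)%C.
pose d := Rmin 1 (Re p - Rabs (Im p)).
have d0 : 0 < d by apply: Rmin_pos; lra.
have d1 : d <= 1 by apply: Rmin_l.
have d2 : d <= Re p - Rabs (Im p) by apply: Rmin_r.
pose c := Cmod eta.
have asg : Rabs sg = 1.
  have h := Rabs_pos sg; have : Rabs sg * Rabs sg = 1 by rewrite -Rabs_mult hsg Rabs_R1.
  by nra.
(* On the segment Re - |Im| is at least u = M d - 2 c, so the Gaussian is at most exp(-pi u^2) <=
   1/u^2, while the length is O(M). The product is O(1/M). *)
pose b (M : nat) := (INR M * Cmod (p - 1)%C + c) * / ((INR M * d - 2 * c) * (INR M * d - 2 * c)).
have key (M : nat) : 0 < INR M * d - 2 * c ->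
   Cmod (Cerf (RtoC sg * (p * RtoC (INR M) + eta)) - Cerf (RtoC sg * RtoC (INR M)))%C <= b M.
  move=> hM; have M0 := pos_INR M.
  have := @Cerf_segment (RtoC sg * RtoC (INR M))%C (RtoC sg * ((p - 1) * RtoC (INR M) + eta))%C 0 (b M).
  have -> : (RtoC sg * RtoC (INR M) + RtoC sg * ((p - 1) * RtoC (INR M) + eta) = RtoC sg * (p * RtoC (INR M) + eta))%C by ring.
  have sub0 (x : C) : (x - 0 = x)%C by ring.
  rewrite Cmult_0_r sub0; apply=> t ht; rewrite sub0.
  pose z := (RtoC (INR M) + RtoC t * ((p - 1) * RtoC (INR M) + eta))%C.
  have -> : Cgauss (RtoC sg * RtoC (INR M) + RtoC t * (RtoC sg * ((p - 1) * RtoC (INR M) + eta)))%C = Cgauss z.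
    rewrite /Cgauss; congr Cexp; congr Cmult.
    transitivity (RtoC (sg * sg) * (z * z))%C; first by rewrite /z RtoC_mult; ring.
    by rewrite hsg; ring.
  rewrite !Cmod_mult Cmod_R asg Rmult_1_l /b.
  apply: Rmult_le_compat; try exact: Cmod_ge_0.
    apply: Rle_trans (Cmod_triangle _ _) _; rewrite Cmod_mult Cmod_R Rabs_pos_eq // /c; lra.
  rewrite Cmod_Cgauss; set u := INR M * d - 2 * c.
  apply: Rle_trans (exp_neg_sqr_le hM); apply: exp_le.
  have rz : Re z = INR M * ((1 - t) + t * Re p) + t * Re eta.
    by rewrite /z /Cminus re_plus re_scal_l re_plus re_scal_r re_plus re_opp !re_RtoC; ring.
  have iz : Im z = INR M * (t * Im p) + t * Im eta.
    by rewrite /z /Cminus im_plus im_scal_l im_plus im_scal_r im_plus im_opp !im_RtoC; ring.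
  have hre := re_le_Cmod eta; have him := im_le_Cmod eta.
  have a1 : u <= Re z - Rabs (Im z).
    have i1 : Rabs (Im z) <= INR M * (t * Rabs (Im p)) + c.
      rewrite iz; apply: Rle_trans (Rabs_triang _ _) _.
      rewrite !Rabs_mult (Rabs_pos_eq (INR M)) // (Rabs_pos_eq t); last by lra.
      have : t * Rabs (Im eta) <= 1 * Rabs (Im eta) by apply: Rmult_le_compat_r; [apply: Rabs_pos | lra].
      by rewrite /c; lra.
    have i2 : - c <= t * Re eta.
      have : Rabs (t * Re eta) <= c.
        rewrite Rabs_mult (Rabs_pos_eq t); last by lra.
        have : t * Rabs (Re eta) <= 1 * Rabs (Re eta) by apply: Rmult_le_compat_r; [apply: Rabs_pos | lra].
        by rewrite /c; lra.
      by move=> /Rabs_le_between; lra.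
    have i3 : d <= (1 - t) + t * (Re p - Rabs (Im p)) by nra.
    have : INR M * d <= INR M * ((1 - t) + t * (Re p - Rabs (Im p))) by apply: Rmult_le_compat_l.
    by rewrite rz /u; nra.
  have a2 : u <= Re z + Rabs (Im z) by have := Rabs_pos (Im z); lra.
  have u0 : 0 < u by [].
  have a3 : u * u <= (Re z - Rabs (Im z)) * (Re z + Rabs (Im z)) by apply: Rmult_le_compat; lra.
  have a4 : Rabs (Im z) * Rabs (Im z) = Im z * Im z by rewrite -Rabs_mult Rabs_pos_eq //; nra.
  have pi0 := PI_RGT_0.
  have a5 : u * u <= Re z * Re z - Im z * Im z by nra.
  have := Rmult_le_compat_l _ _ _ (Rlt_le _ _ pi0) a5; rewrite -/u; lra.
have [M0 hM0] := nfloor_ex (4 * c / d) ltac:(apply: Rdiv_le_0_compat => //; rewrite /c; lra).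
apply: (@Clim_0_inv _ (4 * (Cmod (p - 1)%C + c) / (d * d)) M0.+1) => M hM hM1.
have h1 : 1 <= INR M by apply: (le_INR 1).
have h2 : INR M0 + 1 <= INR M by rewrite -S_INR; apply: le_INR; lia.
have h3 : 4 * c <= INR M * d.
  have : 4 * c / d <= INR M by lra.
  by move=> /(Rmult_le_compat_r d _ _ (Rlt_le _ _ d0)); rewrite /Rdiv Rmult_assoc Rinv_l ?Rmult_1_r; lra.
have h4 : INR M * d / 2 <= INR M * d - 2 * c by lra.
have h5 : 0 < INR M * d by apply: Rmult_lt_0_compat; lra.
have c0 : 0 <= c by [].
apply: Rle_trans (key M _) _; first by lra.
have -> : 4 * (Cmod (p - 1)%C + c) / (d * d) / INR M =
   (INR M * (Cmod (p - 1)%C + c)) * / ((INR M * d / 2) * (INR M * d / 2)) by field; lra.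
rewrite /b; apply: Rmult_le_compat.
- by have := Rmult_le_pos (INR M) _ ltac:(lra) p0; lra.
- by apply/Rlt_le/Rinv_0_lt_compat/Rmult_lt_0_compat; lra.
- by nra.
- by apply: Rinv_le_contravar; [apply: Rmult_lt_0_compat; lra | apply: Rmult_le_compat; lra].
Qed.

End GaussianPrimitiveEstimates.

(** * Gaussians summed over integer translates *)

Section Periodization.
Local Open Scope R_scope.

Definition turn (t : R) : C := Cexp (RtoC (2 * PI * t) * Ci)%C.

Lemma turn_add (s t : R) : turn (s + t) = (turn s * turn t)%C.
Proof. by rewrite /turn -Cexp_add; congr Cexp; rewrite Rmult_plus_distr_l RtoC_plus; ring. Qed.

Lemma turn_0 : turn 0 = RtoC 1.
Proof. by rewrite /turn Rmult_0_r Cmult_0_l Cexp_0. Qed.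

Lemma turn_nat (n : nat) : turn (INR n) = RtoC 1.
Proof.
elim: n => [|n IH]; first exact: turn_0.
by rewrite S_INR turn_add IH /turn Cexp_Ci Rmult_1_r cos_2PI sin_2PI Cmult_1_l.
Qed.

Lemma turn_Z (n : Z) : turn (IZR n) = RtoC 1.
Proof.
have [m [->|->]] : exists m : nat, n = Z.of_nat m \/ n = (- Z.of_nat m)%Z by exists (Z.abs_nat n); lia.
  by rewrite -INR_IZR_INZ turn_nat.
have := turn_add (INR m) (IZR (- Z.of_nat m)); rewrite turn_nat opp_IZR -INR_IZR_INZ Rplus_opp_r turn_0.
by rewrite Cmult_1_l.
Qed.

Lemma Cmod_turn (t : R) : Cmod (turn t) = 1.
Proof. by rewrite /turn Cmod_Cexp re_scal_l /= Rmult_0_r exp_0. Qed.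

Definition gauss (w : C) (y : R) : C := Cexp (RtoC (- PI * (y * y)) * w)%C.

Lemma Cmod_gauss (w : C) (y : R) : Cmod (gauss w y) = exp (- (PI * Re w) * (y * y)).
Proof. by rewrite /gauss Cmod_Cexp re_scal_l; congr exp; ring. Qed.

(** Completing the square: (K + 1)^2/(4r) is the maximum of (K + 1) y - r y^2. The extra 1 leaves
    room for exp(-|n|), and X pays for replacing |x + n| by |n|. *)
Definition gauss_const (r K X : R) : R := exp ((K + 1) * (K + 1) / (4 * r) + X).

Lemma gauss_absorb (r K X x : R) (n : Z) : 0 < r -> Rabs x <= X ->
  exp (- r * ((x + IZR n) * (x + IZR n)) + K * Rabs (x + IZR n)) <=
  gauss_const r K X * exp (- Rabs (IZR n)).
Proof.
move=> hr hx; rewrite -exp_plus; apply: exp_le.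
set y := x + IZR n.
have hy : Rabs (IZR n) <= Rabs y + X.
  have -> : IZR n = y + - x by rewrite /y; ring.
  by apply: Rle_trans (Rabs_triang _ _) _; rewrite Rabs_Ropp; lra.
have e : y * y = Rabs y * Rabs y by rewrite -Rabs_mult Rabs_pos_eq //; nra.
have : 0 <= (2 * r * Rabs y - (K + 1)) * (2 * r * Rabs y - (K + 1)) / (4 * r).
  by apply: Rdiv_le_0_compat; [exact: Rle_0_sqr | lra].
have -> : (2 * r * Rabs y - (K + 1)) * (2 * r * Rabs y - (K + 1)) / (4 * r) =
  r * (y * y) - (K + 1) * Rabs y + (K + 1) * (K + 1) / (4 * r) by rewrite e; field; lra.
lra.
Qed.

Lemma gauss_const_pos (r K X : R) : 0 < gauss_const r K X.
Proof. exact: exp_pos. Qed.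

Lemma dominated_gauss (w : C) (x X : R) : 0 < Re w -> Rabs x <= X ->
  dominated (gauss_const (PI * Re w) 0 X) (fun n => gauss w (x + IZR n)).
Proof.
move=> hw hx n; rewrite Cmod_gauss.
have := @gauss_absorb (PI * Re w) 0 X x n (Rmult_lt_0_compat _ _ PI_RGT_0 hw) hx.
by rewrite Rmult_0_l Rplus_0_r.
Qed.

Definition wrapped_gauss (w : C) (x : R) : C := Zseries (fun n => gauss w (x + IZR n)).

Lemma wrapped_gauss_period (w : C) (x : R) : 0 < Re w -> wrapped_gauss w (x + 1) = wrapped_gauss w x.
Proof.
move=> hw; rewrite /wrapped_gauss.
rewrite -(Zseries_shift1 (dominated_gauss (x := x) (X := Rabs x) hw (Rle_refl _))).
by apply: Zseries_ext => n; congr gauss; rewrite plus_IZR; ring.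
Qed.

Lemma sqr_le_exp (t : R) : 0 <= t -> (1 + t) ^ 2 <= exp (2 * t).
Proof.
move=> ht; have := exp_ineq1_le t => h.
have -> : 2 * t = t + t by ring.
by rewrite exp_plus; have := exp_pos t; nra.
Qed.

(** The first-order terms at +h and -h cancel up to a multiple of h^2. The growth exp(K |y|) left by
    the exponential remainders is later absorbed by [gauss_absorb]. *)
Lemma gauss_second_difference (w : C) : 0 < Re w -> exists D K, 0 <= D /\
  forall y h, Rabs h <= 1 ->
  Cmod (gauss w (y + h) + gauss w (y - h) - 2 * gauss w y)%C <=
    D * h ^ 2 * exp (- (PI * Re w) * (y * y) + K * Rabs y).
Proof.
move=> hw; pose W := PI * Cmod w; have w0 := Cmod_ge_0 w; have pi0 := PI_RGT_0.
have W0 : 0 <= W by apply: Rmult_le_pos; lra.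
exists (2 * W ^ 2 * exp W + 2 * W), (4 + 2 * W); split.
  by have := exp_pos W; nra.
move=> y h hh; have y0 := Rabs_pos y; have h0 := Rabs_pos h.
(* The increment of the exponent when y moves by e h, with e = 1 or -1; the two increments add up to
   -2 pi h^2 w. *)
pose u e := (RtoC (- PI * (2 * (y * (e * h)) + h * h)) * w)%C.
have hu e : Rabs e = 1 -> e * e = 1 -> gauss w (y + e * h) = (gauss w y * Cexp (u e))%C.
  move=> _ ee; rewrite /gauss -Cexp_add; congr Cexp; rewrite /u -Cmult_plus_distr_r -RtoC_plus.
  by congr (RtoC _ * _)%C; have -> : h * h = (e * e) * (h * h) by [rewrite ee; ring]; ring.
have bu e : Rabs e = 1 -> Cmod (u e) <= W * (2 * Rabs y + 1) * Rabs h.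
  move=> ae; rewrite /u Cmod_mult Cmod_R Rabs_mult Rabs_Ropp (Rabs_pos_eq PI); last by lra.
  have : Rabs (2 * (y * (e * h)) + h * h) <= (2 * Rabs y + 1) * Rabs h.
    apply: Rle_trans (Rabs_triang _ _) _.
    by rewrite !Rabs_mult ae (Rabs_pos_eq 2); nra.
  move=> /(Rmult_le_compat_l W _ _ W0); rewrite /W; lra.
have r1 : Rabs 1 = 1 by apply: Rabs_R1.
have r2 : Rabs (-1) = 1 by rewrite Rabs_Ropp Rabs_R1.
have -> : y + h = y + 1 * h by ring.
have -> : y - h = y + -1 * h by ring.
rewrite !hu //; try ring.
pose up := u 1; pose um := u (-1).
have -> : (gauss w y * Cexp up + gauss w y * Cexp um - 2 * gauss w y =
  gauss w y * ((Cexp up - 1 - up) + (Cexp um - 1 - um) + RtoC (- 2 * PI * (h * h)) * w))%C.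
  have -> : (RtoC (- 2 * PI * (h * h)) * w = up + um)%C.
    by rewrite /up /um /u -Cmult_plus_distr_r -RtoC_plus; congr (RtoC _ * _)%C; ring.
  by ring.
rewrite Cmod_mult Cmod_gauss exp_plus.
set E := exp (- _ * _); have E0 : 0 < E by apply: exp_pos.
set Y := 2 * Rabs y in bu *.
have b1 e : Rabs e = 1 -> Cmod (Cexp (u e) - 1 - u e)%C <= W ^ 2 * exp W * h ^ 2 * exp ((4 + 2 * W) * Rabs y).
  move=> /bu hb; apply: Rle_trans (Cexp_bound2 _) _; have q0 := Cmod_ge_0 (u e).
  have -> : (4 + 2 * W) * Rabs y = 2 * Y + W * Y by rewrite /Y; ring.
  rewrite exp_plus -(pow2_abs h).
  have -> : W ^ 2 * exp W * Rabs h ^ 2 * (exp (2 * Y) * exp (W * Y)) =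
    (W ^ 2 * Rabs h ^ 2 * exp (2 * Y)) * (exp (W * Y) * exp W) by ring.
  rewrite -exp_plus; apply: Rmult_le_compat; [exact: pow2_ge_0 | apply/Rlt_le/exp_pos | | ].
    apply: (Rle_trans _ ((W * (Y + 1) * Rabs h) ^ 2)); first by apply: pow_incr.
    have -> : (W * (Y + 1) * Rabs h) ^ 2 = W ^ 2 * Rabs h ^ 2 * (1 + Y) ^ 2 by ring.
    apply: Rmult_le_compat_l; last by apply: sqr_le_exp; rewrite /Y; lra.
    by apply: Rmult_le_pos; apply: pow2_ge_0.
  apply: exp_le; apply: Rle_trans hb _.
  have : 0 <= W * (Y + 1) by apply: Rmult_le_pos => //; rewrite /Y; lra.
  by nra.
have b2 : Cmod (RtoC (- 2 * PI * (h * h)) * w)%C <= 2 * W * h ^ 2 * exp ((4 + 2 * W) * Rabs y).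
  rewrite Cmod_mult Cmod_R.
  have -> : - 2 * PI * (h * h) = - (2 * PI * (h * h)) by ring.
  rewrite Rabs_Ropp Rabs_pos_eq; last by nra.
  have q1 : 1 <= exp ((4 + 2 * W) * Rabs y).
    rewrite -exp_0; apply: exp_le; apply: Rmult_le_pos; lra.
  have -> : 2 * PI * (h * h) * Cmod w = 2 * W * h ^ 2 * 1 by rewrite /W; ring.
  apply: Rmult_le_compat_l => //; apply: Rmult_le_pos; [lra | exact: pow2_ge_0].
have -> : (2 * W ^ 2 * exp W + 2 * W) * h ^ 2 * (E * exp ((4 + 2 * W) * Rabs y)) =
  E * (W ^ 2 * exp W * h ^ 2 * exp ((4 + 2 * W) * Rabs y) + W ^ 2 * exp W * h ^ 2 * exp ((4 + 2 * W) * Rabs y)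
   + 2 * W * h ^ 2 * exp ((4 + 2 * W) * Rabs y)) by ring.
apply: Rmult_le_compat_l; first by lra.
apply: Rle_trans (Cmod_triangle _ _) _; apply: Rplus_le_compat => //.
by apply: Rle_trans (Cmod_triangle _ _) _; apply: Rplus_le_compat; apply: b1.
Qed.

Lemma wrapped_gauss_second_difference (w : C) : 0 < Re w -> exists D, 0 <= D /\
  forall x h, Rabs x <= 1 -> Rabs h <= 1 ->
  Cmod (wrapped_gauss w (x + h) + wrapped_gauss w (x - h) - 2 * wrapped_gauss w x)%C <= D * h ^ 2.
Proof.
move=> hw; have [D [K [D0 hD]]] := gauss_second_difference hw.
pose A := gauss_const (PI * Re w) K 1.
exists (4 * (D * A)); split.
  by have := gauss_const_pos (PI * Re w) K 1; rewrite -/A; nra.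
move=> x h hx hh.
have x1 : Rabs (x + h) <= 2 by apply: Rle_trans (Rabs_triang _ _) _; lra.
have x2 : Rabs (x - h) <= 2 by apply: Rle_trans (Rabs_triang _ _) _; rewrite Rabs_Ropp; lra.
have d1 := dominated_gauss hw x1; have d2 := dominated_gauss hw x2; have d3 := dominated_gauss hw hx.
rewrite /wrapped_gauss -(Zseries_plus d1 d2) -(Zseries_scal (RtoC 2) d3).
rewrite -(Zseries_minus (dominated_plus d1 d2) (dominated_scal (RtoC 2) d3)).
have -> : 4 * (D * A) * h ^ 2 = 4 * (D * A * h ^ 2) by ring.
apply: Zseries_bound => n.
have -> : x + h + IZR n = (x + IZR n) + h by ring.
have -> : x - h + IZR n = (x + IZR n) - h by ring.
apply: Rle_trans (hD _ _ hh) _.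
have -> : D * A * h ^ 2 * exp (- Rabs (IZR n)) = D * h ^ 2 * (A * exp (- Rabs (IZR n))) by ring.
apply: Rmult_le_compat_l; first by apply: Rmult_le_pos => //; apply: pow2_ge_0.
by apply: gauss_absorb => //; apply: Rmult_lt_0_compat => //; apply: PI_RGT_0.
Qed.

End Periodization.

(** * Fourier coefficients of the periodized Gaussian *)

Section FourierCoefficients.
Local Open Scope R_scope.

Definition wave (w : C) (k y : R) : C := (gauss w y * turn (- (k * y)))%C.

(** Completing the square writes [wave w k y] as exp(-pi k^2/w) times the Gaussian at sqrt(w) y + i
    k/sqrt(w), which [Cerf] integrates in y. *)
Definition wave_primitive (w : C) (k y : R) : C :=
  (Cexp (RtoC (- PI * (k * k)) / w) / Csqrt w * Cerf (Csqrt w * RtoC y + Ci * RtoC k / Csqrt w))%C.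

Lemma Csqrt_neq_0 (w : C) : 0 < Re w -> Csqrt w <> RtoC 0.
Proof. by move=> hw h; have := Csqrt_Re_pos (slit_Re hw); rewrite h re_RtoC; lra. Qed.

Lemma Re_neq_0 (w : C) : 0 < Re w -> w <> RtoC 0.
Proof. by move=> hw h; move: hw; rewrite h re_RtoC; lra. Qed.

Lemma Ci_sqr : (Ci * Ci = - 1)%C.
Proof. by rewrite /Ci /Cmult /Copp /RtoC /=; congr pair; ring. Qed.

Lemma wave_Cgauss (w : C) (k y : R) : 0 < Re w ->
  (Cexp (RtoC (- PI * (k * k)) / w) * Cgauss (Csqrt w * RtoC y + Ci * RtoC k / Csqrt w))%C = wave w k y.
Proof.
move=> hw; have s0 := Csqrt_neq_0 hw; have w0 := Re_neq_0 hw.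
have ss := Csqrt_sqr (slit_Re hw).
rewrite /wave /Cgauss /gauss /turn -!Cexp_add; congr Cexp.
have -> : ((Csqrt w * RtoC y + Ci * RtoC k / Csqrt w) * (Csqrt w * RtoC y + Ci * RtoC k / Csqrt w) =
  w * RtoC y * RtoC y + 2 * RtoC y * RtoC k * Ci - RtoC k * RtoC k / w)%C.
  have -> : (w * RtoC y * RtoC y + 2 * RtoC y * RtoC k * Ci - RtoC k * RtoC k / w =
    (Csqrt w * Csqrt w) * RtoC y * RtoC y + 2 * RtoC y * RtoC k * Ci + (- 1) * RtoC k * RtoC k / (Csqrt w * Csqrt w))%C.
    by rewrite ss; field.
  by rewrite -Ci_sqr; field.
rewrite !RtoC_mult !RtoC_opp !RtoC_mult; field; exact: w0.
Qed.

Lemma wave_primitive_remainder (w : C) (k : R) : 0 < Re w -> exists D K, 0 <= D /\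
  forall y h, Rabs h <= 1 ->
  Cmod (wave_primitive w k (y + h) - wave_primitive w k y - RtoC h * wave w k y)%C <=
    D * h ^ 2 * exp (- (PI * Re w) * (y * y) + K * Rabs y).
Proof.
move=> hw; have s0 := Csqrt_neq_0 hw.
set s := Csqrt w in s0 *; set et := (Ci * RtoC k / s)%C; set P := Cexp (RtoC (- PI * (k * k)) / w)%C.
have sp : 0 < Cmod s by apply/Cmod_gt_0.
have e0 := Cmod_ge_0 et; have pi0 := PI_RGT_0.
pose q0 := PI * (2 * Cmod et + Cmod s); pose q1 := PI * (2 * Cmod s).
have q00 : 0 <= q0 by apply: Rmult_le_pos; lra.
have q10 : 0 <= q1 by apply: Rmult_le_pos; lra.
exists (Cmod s * exp (q0 * (1 + Cmod s))), (q1 * (1 + Cmod s)); split.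
  by apply: Rmult_le_pos; [lra | apply/Rlt_le/exp_pos].
move=> y h hh; have y0 := Rabs_pos y; have h0 := Rabs_pos h.
pose z := (s * RtoC y + et)%C.
have wE := wave_Cgauss k y hw; rewrite -/s -/et -/P -/z in wE.
have -> : (wave_primitive w k (y + h) - wave_primitive w k y - RtoC h * wave w k y =
   P / s * (Cerf (z + s * RtoC h) - Cerf z - (s * RtoC h) * Cgauss z))%C.
  rewrite -wE /wave_primitive -/s -/et -/P -/z.
  have -> : (s * RtoC (y + h) + et = z + s * RtoC h)%C by rewrite /z RtoC_plus; ring.
  by field.
rewrite Cmod_mult.
have := @Cerf_remainder z (s * RtoC h)%C; cbv zeta.
have hm : Cmod (s * RtoC h)%C = Cmod s * Rabs h by rewrite Cmod_mult Cmod_R.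
rewrite hm; set Q := PI * _ => hr.
have hQ : Q <= q0 + q1 * Rabs y.
  have : Cmod z <= Cmod s * Rabs y + Cmod et.
    by apply: Rle_trans (Cmod_triangle _ _) _; rewrite Cmod_mult Cmod_R; lra.
  rewrite /Q /q0 /q1 => h1.
  have : 2 * Cmod z + Cmod s * Rabs h <= (2 * Cmod et + Cmod s) + 2 * Cmod s * Rabs y by nra.
  by move=> /(Rmult_le_compat_l PI _ _ (Rlt_le _ _ pi0)); lra.
have Q0 : 0 <= Q by apply: Rmult_le_pos; [lra | have := Cmod_ge_0 z; nra].
have eq : Cmod (P / s)%C * Cmod (Cgauss z) = exp (- (PI * Re w) * (y * y)) / Cmod s.
  rewrite Cmod_div // -(Cmod_gauss w y).
  have -> : Cmod (gauss w y) = Cmod (wave w k y) by rewrite /wave Cmod_mult Cmod_turn Rmult_1_r.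
  by rewrite -wE Cmod_mult; field; lra.
apply: Rle_trans (Rmult_le_compat_l _ _ _ (Cmod_ge_0 _) hr) _.
rewrite -Rmult_assoc eq exp_plus.
set E := exp (- _ * _); have E0 : 0 < E by apply: exp_pos.
have -> : Cmod s * exp (q0 * (1 + Cmod s)) * h ^ 2 * (E * exp (q1 * (1 + Cmod s) * Rabs y)) =
  E / Cmod s * ((Cmod s * Rabs h) ^ 2 * (exp (q0 * (1 + Cmod s)) * exp (q1 * (1 + Cmod s) * Rabs y))).
  by rewrite Rpow_mult_distr pow2_abs; field; lra.
rewrite -exp_plus.
have -> : Q * (Cmod s * Rabs h) ^ 2 * exp (Q * (Cmod s * Rabs h)) = (Cmod s * Rabs h) ^ 2 * (Q * exp (Q * (Cmod s * Rabs h))) by ring.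
apply: Rmult_le_compat_l; first by apply/Rlt_le/Rdiv_lt_0_compat.
apply: Rmult_le_compat_l; first exact: pow2_ge_0.
apply: (Rle_trans _ (exp Q * exp (Q * Cmod s))).
  apply: Rmult_le_compat => //; [apply/Rlt_le/exp_pos | have := exp_ineq1_le Q; lra |].
  apply: exp_le; apply: Rmult_le_compat_l => //; nra.
rewrite -exp_plus; apply: exp_le.
have -> : q0 * (1 + Cmod s) + q1 * (1 + Cmod s) * Rabs y = (q0 + q1 * Rabs y) * (1 + Cmod s) by ring.
have -> : Q + Q * Cmod s = Q * (1 + Cmod s) by ring.
by apply: Rmult_le_compat_r; lra.
Qed.

(* The integral of [wave w k] over the real line. *)
Definition fourier (w : C) (k : R) : C :=
  Zseries (fun n => wave_primitive w k (IZR (n + 1)) - wave_primitive w k (IZR n))%C.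

Lemma dominated_wave_primitive (w : C) (k : R) : 0 < Re w -> exists K,
  dominated K (fun n => wave_primitive w k (IZR (n + 1)) - wave_primitive w k (IZR n))%C.
Proof.
move=> hw; have [D [K [D0 hD]]] := wave_primitive_remainder k hw.
have r0 : 0 < PI * Re w by apply: Rmult_lt_0_compat => //; apply: PI_RGT_0.
exists (D * gauss_const (PI * Re w) K 0 + gauss_const (PI * Re w) 0 0) => n.
have -> : (wave_primitive w k (IZR (n + 1)) - wave_primitive w k (IZR n) =
  (wave_primitive w k (IZR n + 1) - wave_primitive w k (IZR n) - RtoC 1 * wave w k (IZR n)) + wave w k (IZR n))%C.
  by rewrite plus_IZR; ring.
apply: Rle_trans (Cmod_triangle _ _) _; rewrite Rmult_plus_distr_r; apply: Rplus_le_compat.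
  have h1 : Rabs 1 <= 1 by rewrite Rabs_R1; lra.
  apply: Rle_trans (hD (IZR n) 1 h1) _.
  have -> : D * 1 ^ 2 = D by ring.
  rewrite Rmult_assoc; apply: Rmult_le_compat_l => //.
  by have := @gauss_absorb _ K 0 0 n r0; rewrite Rabs_R0 Rplus_0_l; apply; lra.
rewrite /wave Cmod_mult Cmod_turn Rmult_1_r.
have := @dominated_gauss w 0 0 hw _ n; rewrite Rabs_R0 Rplus_0_l; apply; lra.
Qed.

Lemma fourier_lim (w : C) (k : R) : 0 < Re w ->
  Clim (fun N => wave_primitive w k (INR N) - wave_primitive w k (- INR N))%C (fourier w k).
Proof.
move=> hw; have [K hK] := dominated_wave_primitive k hw.
apply: Clim_ext (Zseries_telescope hK) => N.
by rewrite opp_IZR -INR_IZR_INZ.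
Qed.

Lemma Csqrt_1 : Csqrt (RtoC 1) = RtoC 1.
Proof. by rewrite Csqrt_RtoC ?sqrt_1 //; lra. Qed.

(** The integral runs along the line sqrt(w) y + i k/sqrt(w); [Cerf_rotation] brings both of its
    ends back to the real axis, leaving [fourier 1 0], an integral kept unevaluated. *)
Lemma fourier_value (w : C) (k : R) : 0 < Re w ->
  fourier w k = (Cexp (RtoC (- PI * (k * k)) / w) / Csqrt w * fourier 1 0)%C.
Proof.
move=> hw; have s0 := Csqrt_neq_0 hw.
have hs := Csqrt_cone hw.
set P := (Cexp _ / _)%C; pose et := (Ci * RtoC k / Csqrt w)%C.
apply: Clim_unique (fourier_lim k hw) _.
have h1 : Clim (fun N => Cerf (RtoC (INR N)) - Cerf (- RtoC (INR N)))%C (fourier 1 0).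
  apply: Clim_ext (fourier_lim 0 (w := RtoC 1) _); last by rewrite re_RtoC; lra.
  move=> N; rewrite /wave_primitive Csqrt_1 !Rmult_0_r.
  have -> : (Cexp (RtoC 0 / 1) = 1)%C by have -> : (RtoC 0 / 1 = 0)%C by [field]; apply: Cexp_0.
  rewrite RtoC_opp.
  have e (x : C) : (1 / 1 * Cerf (1 * x + Ci * 0 / 1) = Cerf x)%C.
    by have -> : (1 * x + Ci * 0 / 1 = x)%C by [field]; field.
  by rewrite !e.
have p1 : 1 * 1 = 1 by ring.
have m1 : (-1) * (-1) = 1 by ring.
have h2 := Cerf_rotation et p1 hs.
have h3 := Cerf_rotation (- et)%C m1 hs.
have h4 := Clim_scal P (Clim_plus h1 (Clim_minus h2 h3)).
have e : (P * (fourier 1 0 + (0 - 0)) = P * fourier 1 0)%C by ring.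
rewrite e in h4; apply: Clim_ext h4 => N.
have -> : (RtoC 1 * (Csqrt w * RtoC (INR N) + et) = Csqrt w * RtoC (INR N) + et)%C by ring.
have -> : (RtoC (-1) * (Csqrt w * RtoC (INR N) + - et) = Csqrt w * RtoC (- INR N) + et)%C by rewrite RtoC_opp; ring.
have -> : (RtoC 1 * RtoC (INR N) = RtoC (INR N))%C by ring.
have -> : (RtoC (-1) * RtoC (INR N) = - RtoC (INR N))%C by ring.
by rewrite /wave_primitive -/P -/et; ring.
Qed.

(* Discrete Fourier coefficients: [N]-point Riemann sums for the integral of [wave w k], whose finite
   inversion formula passes to the limit by dominated convergence. *)
Definition sampled (w : C) (N : nat) (k : R) : C :=
  (/ RtoC (INR N) * Csum (fun j => wrapped_gauss w (INR j / INR N) * turn (- (k * (INR j / INR N)))) N)%C.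

(** For an integer frequency the exponential has period 1 and can be moved inside the sum over
    translates. *)
Lemma wrapped_wave (w : C) (x X : R) (k : Z) : 0 < Re w -> Rabs x <= X ->
  dominated (gauss_const (PI * Re w) 0 X) (fun n => wave w (IZR k) (x + IZR n)) /\
  (wrapped_gauss w x * turn (- (IZR k * x)))%C = Zseries (fun n => wave w (IZR k) (x + IZR n)).
Proof.
move=> hw hx; have d := dominated_gauss hw hx; split.
  by move=> n; rewrite /wave Cmod_mult Cmod_turn Rmult_1_r.
rewrite Cmult_comm /wrapped_gauss -(Zseries_scal _ d); apply: Zseries_ext => n.
rewrite /wave Cmult_comm; congr Cmult.
have -> : - (IZR k * (x + IZR n)) = - (IZR k * x) + IZR (- (k * n)) by rewrite opp_IZR mult_IZR; ring.
by rewrite turn_add turn_Z Cmult_1_r.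
Qed.

Lemma sampled_lim (w : C) (k : Z) : 0 < Re w ->
  Clim (fun L => sampled w (2 * L)%coq_nat (IZR k)) (fourier w (IZR k)).
Proof.
move=> hw; have [D [K [D0 hD]]] := wave_primitive_remainder (IZR k) hw.
have r0 : 0 < PI * Re w by apply: Rmult_lt_0_compat => //; apply: PI_RGT_0.
have [B hB] := dominated_wave_primitive (IZR k) hw.
pose A := gauss_const (PI * Re w) K 1; pose A0 := gauss_const (PI * Re w) 0 1.
have A00 : 0 <= A0 by apply/Rlt_le/gauss_const_pos.
(* Riemann sum error: each of the N pieces of [n, n + 1] costs D A exp(-|n|)/N^2, so a unit interval
   costs O(1/N) with a factor summable in n. *)
suff est (N : nat) : (1 <= N)%coq_nat -> Cmod (fourier w (IZR k) - sampled w N (IZR k))%C <= 4 * (D * A) / INR N.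
  have h : Clim (fun L => fourier w (IZR k) - sampled w (2 * L)%coq_nat (IZR k))%C 0.
    apply: (@Clim_0_inv _ (4 * (D * A)) 0%nat) => L _ hL; apply: Rle_trans (est _ _) _; first by lia.
    apply: Rmult_le_compat_l.
      by apply: Rmult_le_pos; [lra | apply: Rmult_le_pos => //; apply/Rlt_le/gauss_const_pos].
    by apply: Rinv_le_contravar; [apply: lt_0_INR; lia | apply: le_INR; lia].
  have := Clim_minus (Clim_const (fourier w (IZR k))) h.
  have -> : (fourier w (IZR k) - 0 = fourier w (IZR k))%C by ring.
  by apply: Clim_ext => L; ring.
move=> hN; have N0 : 0 < INR N by apply: lt_0_INR; lia.
have Nn : RtoC (INR N) <> RtoC 0 by move=> /RtoC_inj; lra.
have hj (j : nat) : (j < N)%coq_nat -> Rabs (INR j / INR N) <= 1.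
  move=> h; rewrite Rabs_pos_eq; last by apply: Rdiv_le_0_compat => //; apply: pos_INR.
  apply: (Rmult_le_reg_r (INR N)) => //; rewrite /Rdiv Rmult_assoc Rinv_l ?Rmult_1_r ?Rmult_1_l; last by lra.
  by apply: le_INR; lia.
(* Indices past [N] are frozen so that the domination is uniform in [j]. *)
pose t (j : nat) := INR (Nat.min j N.-1) / INR N.
have ht j : Rabs (t j) <= 1 by apply: hj; lia.
have tE j : (j < N)%coq_nat -> t j = INR j / INR N by move=> h; rewrite /t; congr (INR _ / _); lia.
have [dw sw] := @Csum_Zseries A0 (fun j n => wave w (IZR k) (t j + IZR n)) N A00 (fun j => proj1 (wrapped_wave k hw (ht j))).
have -> : sampled w N (IZR k) = (/ RtoC (INR N) * Zseries (fun n => Csum (fun j => wave w (IZR k) (t j + IZR n)) N))%C.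
  rewrite /sampled sw; congr Cmult; apply: Csum_ext => j h.
  by rewrite -(proj2 (wrapped_wave k hw (ht j))) tE.
rewrite -(Zseries_scal _ dw) /fourier -(Zseries_minus hB (dominated_scal _ dw)).
have -> : 4 * (D * A) / INR N = 4 * (D * A / INR N) by field; lra.
apply: Zseries_bound => n.
pose F := wave_primitive w (IZR k).
pose G j := F (INR j / INR N + IZR n).
have tel M : Csum (fun j => G j.+1 - G j)%C M = (G M - G 0%nat)%C.
  by elim: M => [|M IH]; [rewrite /=; ring | rewrite CsumS IH; ring].
have -> : (wave_primitive w (IZR k) (IZR (n + 1)) - wave_primitive w (IZR k) (IZR n) -
    / RtoC (INR N) * Csum (fun j => wave w (IZR k) (t j + IZR n)) N)%C =
  Csum (fun j => G j.+1 - G j - / RtoC (INR N) * wave w (IZR k) (INR j / INR N + IZR n))%C N.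
  rewrite Csum_minus tel Csum_scal; congr (_ - _)%C; last first.
    by congr Cmult; apply: Csum_ext => j h; rewrite tE.
  have -> : G N = wave_primitive w (IZR k) (IZR (n + 1)) by rewrite /G /F plus_IZR; congr wave_primitive; field; lra.
  have -> // : G 0%nat = wave_primitive w (IZR k) (IZR n) by rewrite /G /F; congr wave_primitive; rewrite /=; field; lra.
have -> : D * A / INR N * exp (- Rabs (IZR n)) = INR N * (D * (/ INR N) ^ 2 * (A * exp (- Rabs (IZR n)))) by field; lra.
apply: Csum_bound => j h.
have -> : G j.+1 = F (INR j / INR N + IZR n + / INR N) by rewrite /G S_INR; congr F; field; lra.
rewrite -RtoC_inv; last by lra.
have h1 : Rabs (/ INR N) <= 1.
  rewrite Rabs_pos_eq; last by apply/Rlt_le/Rinv_0_lt_compat.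
  by rewrite -Rinv_1; apply: Rinv_le_contravar; [lra | apply: (le_INR 1); lia].
apply: Rle_trans (hD _ _ h1) _.
apply: Rmult_le_compat_l; first by apply: Rmult_le_pos => //; apply: pow2_ge_0.
by apply: gauss_absorb => //; apply: hj.
Qed.

End FourierCoefficients.

(** * Poisson summation from finite Fourier inversion *)

Section Poisson.
Local Open Scope R_scope.

Lemma turn_neq_1 (t : R) : 0 < t < 1 -> turn t <> RtoC 1.
Proof.
move=> ht; rewrite /turn Cexp_Ci => -[hc _].
have pi0 := PI_RGT_0.
have : 0 < sin (PI * t) by apply: sin_gt_0; nra.
have := cos_2a_sin (PI * t).
have -> : 2 * (PI * t) = 2 * PI * t by ring.
by rewrite hc; nra.
Qed.

(** A geometric sum over the frequencies -L, ..., L - 1, paired as in [Zpart]. Multiplied by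
    [turn th - 1] it telescopes, and the two end terms agree because 2 L th is the integer j. *)
Lemma turn_orthogonality (L j : nat) : (1 <= L)%coq_nat -> (0 < j)%coq_nat -> (j < (2 * L)%coq_nat)%coq_nat ->
  Csum (fun n => turn (- (INR n * (INR j / INR (2 * L)%coq_nat))) +
                 turn ((INR n + 1) * (INR j / INR (2 * L)%coq_nat)))%C L = RtoC 0.
Proof.
move=> hL hj hj2; set th := INR j / _.
have N0 : 0 < INR (2 * L)%coq_nat by apply: lt_0_INR; lia.
have hth : 0 < th < 1.
  have a1 : 0 < INR j by apply: lt_0_INR.
  have a2 : INR j < INR (2 * L)%coq_nat by apply: lt_INR.
  split; first exact: Rdiv_lt_0_compat.
  by apply: (Rmult_lt_reg_r (INR (2 * L)%coq_nat)) => //; rewrite /th /Rdiv Rmult_assoc Rinv_l; lra.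
have tel M : ((turn th - 1) * Csum (fun n => turn (- (INR n * th)) + turn ((INR n + 1) * th)) M =
    turn ((INR M + 1) * th) - turn (- ((INR M - 1) * th)))%C.
  elim: M => [|M IH].
    rewrite /= Cmult_0_r.
    have -> : (0 + 1) * th = th by ring.
    have -> : - ((0 - 1) * th) = th by ring.
    by ring.
  rewrite CsumS Cmult_plus_distr_l IH S_INR.
  have -> : (INR M + 1 + 1) * th = th + (INR M + 1) * th by ring.
  have -> : - ((INR M - 1) * th) = th + - (INR M * th) by ring.
  have -> : - ((INR M + 1 - 1) * th) = - (INR M * th) by ring.
  by rewrite !turn_add; ring.
have h1 : (turn th - 1 <> 0)%C by move=> h; apply: (turn_neq_1 hth); apply/Ceq_minus.
have e : ((turn th - 1) * Csum (fun n => turn (- (INR n * th)) + turn ((INR n + 1) * th)) L = 0)%C.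
  rewrite tel.
  have -> : (INR L + 1) * th = - ((INR L - 1) * th) + IZR (Z.of_nat j).
    rewrite -INR_IZR_INZ.
    have -> : INR j = INR (2 * L)%coq_nat * th by rewrite /th; field; lra.
    by rewrite mult_INR /=; ring.
  by rewrite turn_add turn_Z; ring.
case: (Ceq_dec (Csum (fun n => turn (- (INR n * th)) + turn ((INR n + 1) * th))%C L) 0) => // h2.
by case: (Cmult_neq_0 _ _ h1 h2).
Qed.

(** Summing over a full period of frequencies kills every node except j = 0. *)
Lemma sampled_inversion (w : C) (L : nat) : (1 <= L)%coq_nat ->
  Zpart (fun k => sampled w (2 * L)%coq_nat (IZR k)) L = wrapped_gauss w 0.
Proof.
move=> hL; set N := (2 * L)%coq_nat.
have N0 : 0 < INR N by apply: lt_0_INR; lia.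
have Nn : RtoC (INR N) <> RtoC 0 by move=> /RtoC_inj; lra.
pose T j := Csum (fun n => turn (- (INR n * (INR j / INR N))) + turn ((INR n + 1) * (INR j / INR N)))%C L.
have -> : Zpart (fun k => sampled w N (IZR k)) L =
   (/ RtoC (INR N) * Csum (fun j => wrapped_gauss w (INR j / INR N) * T j) N)%C.
  transitivity (/ RtoC (INR N) * Csum (fun n => Csum (fun j => wrapped_gauss w (INR j / INR N) *
     (turn (- (INR n * (INR j / INR N))) + turn ((INR n + 1) * (INR j / INR N)))) N) L)%C.
    rewrite -Csum_scal; apply: Csum_ext => n _; rewrite /sampled -Cmult_plus_distr_l -Csum_plus.
    congr Cmult; apply: Csum_ext => j _; rewrite -Cmult_plus_distr_l; congr Cmult; congr Cplus; congr turn.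
      by rewrite -INR_IZR_INZ.
    by rewrite opp_IZR -INR_IZR_INZ S_INR; ring.
  by congr Cmult; rewrite Csum_swap; apply: Csum_ext => j _; rewrite -Csum_scal.
have T0 : T 0%nat = RtoC (INR N).
  rewrite /T; transitivity (Csum (fun _ => RtoC 2) L).
    apply: Csum_ext => n _.
    have -> : INR 0 / INR N = 0 by rewrite /= /Rdiv Rmult_0_l.
    by rewrite !Rmult_0_r Ropp_0 turn_0 -RtoC_plus.
  by rewrite Csum_const -RtoC_mult /N mult_INR; congr RtoC; rewrite /=; ring.
have TS j : (j.+1 < N)%coq_nat -> T j.+1 = RtoC 0 by move=> h; apply: turn_orthogonality => //; lia.
have -> : Csum (fun j => wrapped_gauss w (INR j / INR N) * T j)%C N = (wrapped_gauss w 0 * RtoC (INR N))%C.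
  have -> : N = (N.-1).+1 by lia.
  have -> : (wrapped_gauss w 0 * RtoC (INR N.-1.+1) = wrapped_gauss w (INR 0 / INR N) * T 0%nat + 0)%C.
    rewrite T0 Cplus_0_r; congr (wrapped_gauss _ _ * RtoC (INR _))%C; last by lia.
    by rewrite /= /Rdiv Rmult_0_l.
  rewrite Csum_recl; congr (_ + _)%C; first by rewrite -(_ : N = N.-1.+1) //; lia.
  rewrite -[RHS](Cmult_0_r (RtoC (INR N.-1))) -Csum_const; apply: Csum_ext => j h.
  by rewrite TS ?Cmult_0_r //; lia.
by field.
Qed.

(** The slope 1/3 is chosen because pi > 3 turns it into sin(pi x) >= x on [0, 1/2]. The proof uses
    the Taylor polynomial of degree 7 as a lower bound. *)
Lemma sin_ge_third (a : R) : 0 <= a <= PI / 2 -> a / 3 <= sin a.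
Proof.
move=> ha; have p4 := PI_4.
have [h _] := SIN a ltac:(lra) ltac:(lra).
apply: Rle_trans h.
have -> : sin_lb a = a - a ^ 3 / 6 + a ^ 5 / 120 - a ^ 7 / 5040.
  have e3 : INR (fact 3) = 6 by rewrite INR_IZR_INZ; congr IZR.
  have e5 : INR (fact 5) = 120 by rewrite INR_IZR_INZ; congr IZR.
  have e7 : INR (fact 7) = 5040 by rewrite INR_IZR_INZ; congr IZR; vm_compute.
  rewrite /sin_lb /sin_approx /sin_term; rewrite [sum_f_R0 _ _]/sum_f_R0.
  rewrite -!/(fact _) /Nat.add /Nat.mul e3 e5 e7 /=; field.
have a2 : a ^ 2 <= 4 by nra.
have : 0 <= a ^ 5 / 120 - a ^ 7 / 5040.
  have -> : a ^ 5 / 120 - a ^ 7 / 5040 = a ^ 5 * ((42 - a ^ 2) / 5040) by field.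
  by apply: Rmult_le_pos; [apply: pow_le; lra | lra].
have : a ^ 3 / 6 <= a * (2 / 3).
  have -> : a ^ 3 / 6 = a * (a ^ 2 / 6) by field.
  by apply: Rmult_le_compat_l; lra.
lra.
Qed.

Lemma Csum_period (V : R -> C) (N : nat) : V (INR N) = V 0 ->
  Csum (fun j => V (Rplus (INR j) 1)) N = Csum (fun j => V (INR j)) N.
Proof.
move=> h; have := Csum_recl (fun j => V (INR j)) N; rewrite CsumS.
have -> : Csum (fun j => V (INR j.+1)) N = Csum (fun j => V (Rplus (INR j) 1)) N by apply: Csum_ext => j _; rewrite S_INR.
rewrite h Cplus_comm => e.
have -> : Csum (fun j => V (Rplus (INR j) 1)) N = (V (INR 0) + Csum (fun j => V (Rplus (INR j) 1)) N - V 0)%C by rewrite /=; ring.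
by rewrite -e; ring.
Qed.

Lemma turn_second_difference (x : R) : (turn x + turn (- x) - 2 = RtoC (- (4 * sin (PI * x) ^ 2)))%C.
Proof.
rewrite /turn !Cexp_Ci.
have -> : 2 * PI * - x = - (2 * PI * x) by ring.
rewrite cos_neg sin_neg; apply: Ceq; rewrite /=; last by ring.
have -> : 2 * PI * x = 2 * (PI * x) by ring.
by rewrite cos_2a_sin; ring.
Qed.

(* Two summations by parts bring in the second difference of [wrapped_gauss], divided by
   [4 sin (PI k / N) ^ 2 >= (2 k / N) ^ 2]. *)
Lemma sampled_bound (w : C) : 0 < Re w -> exists B, 0 <= B /\
  forall (L : nat) (k : Z), (1 <= L)%coq_nat -> (1 <= Z.abs k <= Z.of_nat L)%Z ->
  Cmod (sampled w (2 * L)%coq_nat (IZR k)) <= B / IZR k ^ 2.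
Proof.
move=> hw; have [D [D0 hD]] := wrapped_gauss_second_difference hw.
exists D; split => // L k hL hk; set N := (2 * L)%coq_nat.
have N0 : 0 < INR N by apply: lt_0_INR; lia.
have iN : 0 < / INR N by apply: Rinv_0_lt_compat.
have Nn : RtoC (INR N) <> RtoC 0 by move=> /RtoC_inj; lra.
pose V t := (wrapped_gauss w (t / INR N) * turn (- (IZR k * (t / INR N))))%C.
have Vper t : V (t + INR N) = V t.
  rewrite /V.
  have -> : (t + INR N) / INR N = t / INR N + 1 by field; lra.
  rewrite wrapped_gauss_period //; congr Cmult.
  have -> : - (IZR k * (t / INR N + 1)) = - (IZR k * (t / INR N)) + IZR (- k) by rewrite opp_IZR; ring.
  by rewrite turn_add turn_Z Cmult_1_r.
pose S := Csum (fun j => V (INR j)) N.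
have Sp : Csum (fun j => V (Rplus (INR j) 1)) N = S by apply: Csum_period; rewrite -(Vper 0) Rplus_0_l.
have Sm : Csum (fun j => V (Rminus (INR j) 1)) N = S.
  rewrite -(@Csum_period (fun t => V (Rminus t 1))); first by apply: Csum_ext => j _; congr V; ring.
  by rewrite -(Vper (0 - 1)); congr V; ring.
have eq : (RtoC (- (4 * sin (PI * (IZR k / INR N)) ^ 2)) * S)%C =
   Csum (fun j => (wrapped_gauss w (INR j / INR N + / INR N) + wrapped_gauss w (INR j / INR N - / INR N)
      - 2 * wrapped_gauss w (INR j / INR N)) * turn (- (IZR k * (INR j / INR N))))%C N.
  rewrite -turn_second_difference.
  have -> : ((turn (IZR k / INR N) + turn (- (IZR k / INR N)) - 2) * S =
    turn (IZR k / INR N) * Csum (fun j => V (Rplus (INR j) 1)) N + turn (- (IZR k / INR N)) * Csum (fun j => V (Rminus (INR j) 1)) N - 2 * S)%C.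
    by rewrite Sp Sm; ring.
  rewrite -!Csum_scal -Csum_plus -Csum_minus; apply: Csum_ext => j _; rewrite /V.
  have -> : (INR j + 1) / INR N = INR j / INR N + / INR N by field; lra.
  have -> : (INR j - 1) / INR N = INR j / INR N - / INR N by field; lra.
  have e1 : turn (- (IZR k * (INR j / INR N))) = (turn (IZR k / INR N) * turn (- (IZR k * (INR j / INR N + / INR N))))%C.
    by rewrite -turn_add; congr turn; field; lra.
  have e2 : turn (- (IZR k * (INR j / INR N))) = (turn (- (IZR k / INR N)) * turn (- (IZR k * (INR j / INR N - / INR N))))%C.
    by rewrite -turn_add; congr turn; field; lra.
  transitivity (wrapped_gauss w (INR j / INR N + / INR N) * turn (- (IZR k * (INR j / INR N))) +
    wrapped_gauss w (INR j / INR N - / INR N) * turn (- (IZR k * (INR j / INR N))) - 2 * (wrapped_gauss w (INR j / INR N) * turn (- (IZR k * (INR j / INR N)))))%C; last by ring.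
  by rewrite {2}e1 {2}e2; ring.
have N1 : 1 <= INR N by apply: (le_INR 1); lia.
have i1 : Rabs (/ INR N) <= 1.
  by rewrite Rabs_pos_eq; [rewrite -Rinv_1; apply: Rinv_le_contravar; lra | lra].
have b1 : Cmod (RtoC (- (4 * sin (PI * (IZR k / INR N)) ^ 2)) * S)%C <= INR N * (D * (/ INR N) ^ 2).
  rewrite eq; apply: Csum_bound => j hj; rewrite Cmod_mult Cmod_turn Rmult_1_r; apply: hD => //.
  rewrite Rabs_pos_eq; last by apply: Rdiv_le_0_compat => //; apply: pos_INR.
  apply: (Rmult_le_reg_r (INR N)) => //; rewrite /Rdiv Rmult_assoc Rinv_l ?Rmult_1_r ?Rmult_1_l; last by lra.
  by apply: le_INR; lia.
have k1 : 1 <= Rabs (IZR k) by rewrite -abs_IZR; apply: IZR_le; lia.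
have kN : 2 * Rabs (IZR k) <= INR N.
  by rewrite -abs_IZR /N mult_INR (INR_IZR_INZ L) /=; have := IZR_le _ _ (proj2 hk); lra.
have sn : (Rabs (IZR k) / INR N) ^ 2 <= sin (PI * (IZR k / INR N)) ^ 2.
  have p3 := PI2_3_2; have p0 := PI_RGT_0.
  have q0 : 0 <= Rabs (IZR k) / INR N by apply: Rdiv_le_0_compat; lra.
  have q1 : Rabs (IZR k) / INR N <= / 2.
    by apply: (Rmult_le_reg_r (INR N)) => //; rewrite /Rdiv Rmult_assoc Rinv_l ?Rmult_1_r; lra.
  have : Rabs (IZR k) / INR N <= sin (PI * (Rabs (IZR k) / INR N)).
    by apply: Rle_trans (@sin_ge_third (PI * (Rabs (IZR k) / INR N)) _); [nra | split; nra].
  move=> h; have -> : sin (PI * (IZR k / INR N)) ^ 2 = sin (PI * (Rabs (IZR k) / INR N)) ^ 2.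
    rewrite /Rabs; case: Rcase_abs => // _.
    have -> : PI * (- IZR k / INR N) = - (PI * (IZR k / INR N)) by field; lra.
    by rewrite sin_neg; ring.
  by apply: pow_incr.
have S0 := Cmod_ge_0 S.
rewrite /sampled -/S -RtoC_inv ?Cmod_scal; [|lra|lra].
move: b1; rewrite Cmod_mult Cmod_R Rabs_Ropp Rabs_pos_eq; last first.
  by have := pow2_ge_0 (sin (PI * (IZR k / INR N))); lra.
move=> b1.
have b2 : 4 * (Rabs (IZR k) / INR N) ^ 2 * Cmod S <= INR N * (D * (/ INR N) ^ 2).
  by apply: Rle_trans b1; apply: Rmult_le_compat_r => //; lra.
have kk : 0 < IZR k ^ 2 by rewrite -pow2_abs; nra.
apply: (Rmult_le_reg_r (IZR k ^ 2)) => //.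
have -> : D / IZR k ^ 2 * IZR k ^ 2 = D by field; move=> h; rewrite h in kk; lra.
have : 4 * (IZR k ^ 2 * (/ INR N * Cmod S)) <= D.
  apply: (Rmult_le_reg_r (/ INR N)) => //.
  have -> : D * / INR N = INR N * (D * (/ INR N) ^ 2) by field; lra.
  by apply: Rle_trans b2; right; rewrite -(pow2_abs (IZR k)); field; lra.
have : 0 <= IZR k ^ 2 * (/ INR N * Cmod S) by apply: Rmult_le_pos; [lra | apply: Rmult_le_pos; lra].
lra.
Qed.

Lemma Clim_Csum (u : nat -> nat -> C) (v : nat -> C) (K : nat) :
  (forall n, Clim (fun L => u L n) (v n)) -> Clim (fun L => Csum (u L) K) (Csum v K).
Proof.
by move=> h; elim: K => [|K IH]; [exact: Clim_const | exact: Clim_plus].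
Qed.

(** Tannery's argument: for fixed K the discrete partial sums of order K stay within 4B/K of the
    exact inversion, uniformly in L; let L tend to infinity first, then K. *)
Lemma wrapped_gauss_fourier_partial (w : C) : 0 < Re w ->
  Clim (Zpart (fun k => fourier w (IZR k))) (wrapped_gauss w 0).
Proof.
move=> hw; have [B [B0 hB]] := sampled_bound hw.
pose s L k := sampled w (2 * L)%coq_nat (IZR k).
(* Each step adds the frequencies n and -(n + 1), at most 2B/n^2 together, and 1/n^2 <= 2 (1/n -
   1/(n + 1)) makes the tail telescope. *)
have tail L K M : (1 <= K)%coq_nat -> ((K + M)%coq_nat <= L)%coq_nat ->
    Cmod (Zpart (s L) (K + M)%coq_nat - Zpart (s L) K)%C <= 4 * B * (/ INR K - / INR (K + M)%coq_nat).
  move=> hK; elim: M => [|M IH] hM.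
    by rewrite Nat.add_0_r /Cminus Cplus_opp_r Cmod_0; lra.
  rewrite Nat.add_succ_r; set n := (K + M)%coq_nat in IH *.
  rewrite {1}/Zpart CsumS -/(Zpart (s L) n).
  have -> (x y z : C) : (x + y - z = (x - z) + y)%C by ring.
  apply: Rle_trans (Cmod_triangle _ _) _.
  have h1 := IH ltac:(lia).
  have n0 : 0 < INR n by apply: lt_0_INR; lia.
  have B1 (k : Z) : (Z.of_nat n <= Z.abs k <= Z.of_nat L)%Z -> Cmod (s L k) <= B / INR n ^ 2.
    move=> hk; apply: Rle_trans (hB L k _ _) _; try lia.
    apply: Rmult_le_compat_l => //; apply: Rinv_le_contravar; first by apply: pow_lt.
    rewrite -(pow2_abs (IZR k)); apply: pow_incr; split; first by lra.
    by rewrite -abs_IZR INR_IZR_INZ; apply: IZR_le; lia.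
  have := Cmod_triangle (s L (Z.of_nat n)) (s L (- Z.of_nat n.+1)%Z).
  have := B1 (Z.of_nat n) ltac:(lia); have := B1 (- Z.of_nat n.+1)%Z ltac:(lia).
  have n1 : 1 <= INR n by apply: (le_INR 1); lia.
  have : 2 * (B / INR n ^ 2) <= 4 * B * (/ INR n - / INR n.+1).
    rewrite S_INR.
    have -> : 4 * B * (/ INR n - / (INR n + 1)) = 2 * B * (2 / (INR n * (INR n + 1))) by field; lra.
    have -> : 2 * (B / INR n ^ 2) = 2 * B * / (INR n ^ 2) by field; lra.
    apply: Rmult_le_compat_l; first by lra.
    have -> : 2 / (INR n * (INR n + 1)) = / (INR n * (INR n + 1) / 2) by field; lra.
    by apply: Rinv_le_contravar; nra.
  lra.
have est K : (1 <= K)%coq_nat -> Cmod (wrapped_gauss w 0 - Zpart (fun k => fourier w (IZR k)) K)%C <= 4 * B / INR K.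
  move=> hK.
  apply: (@Clim_le (fun L => wrapped_gauss w 0 - Zpart (s L) K)%C).
    apply: Clim_minus; first exact: Clim_const.
    apply: (@Clim_Csum (fun L n => s L (Z.of_nat n) + s L (- Z.of_nat n.+1)%Z)%C (fun n => fourier w (IZR (Z.of_nat n)) + fourier w (IZR (- Z.of_nat n.+1)))%C) => n.
    by apply: Clim_plus; apply: sampled_lim.
  exists K => L hL; rewrite -(@sampled_inversion w L) -/(s L); last by lia.
  have -> : L = (K + (L - K)%coq_nat)%coq_nat by lia.
  have K0 : 0 < INR K by apply: lt_0_INR; lia.
  set M := (L - K)%coq_nat.
  apply: Rle_trans (tail (K + M)%coq_nat K M hK _) _; first by lia.
  have : 0 < / INR (K + M)%coq_nat by apply: Rinv_0_lt_compat; apply: lt_0_INR; lia.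
  rewrite /Rdiv; nra.
have h : Clim (fun K => wrapped_gauss w 0 - Zpart (fun k => fourier w (IZR k)) K)%C 0.
  by apply: (@Clim_0_inv _ (4 * B) 0%nat) => K _ hK; apply: est.
have := Clim_minus (Clim_const (wrapped_gauss w 0)) h.
have -> : (wrapped_gauss w 0 - 0 = wrapped_gauss w 0)%C by ring.
by apply: Clim_ext => K; ring.
Qed.

End Poisson.

(** * Theta constants under translation and inversion *)

Section ThetaConstants.
Local Open Scope R_scope.

Definition qexp (x : R) (z : C) : C := Cexp (RtoC (PI * x) * Ci * z)%C.

Lemma Im_Ci_mult (z : C) : Re (Ci * z)%C = - Im z /\ Im (Ci * z)%C = Re z.
Proof. by case: z => a b; rewrite /Ci /Cmult /=; split; ring. Qed.

Lemma Re_mCi (z : C) : Re (- Ci * z)%C = Im z.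
Proof. by case: z => a b; rewrite /Ci /Cmult /=; ring. Qed.

Lemma Cmod_qexp (x : R) (z : C) : Cmod (qexp x z) = exp (- (PI * Im z) * x).
Proof.
rewrite /qexp Cmod_Cexp -Cmult_assoc re_scal_l (proj1 (Im_Ci_mult z)).
by congr exp; ring.
Qed.

Lemma qexp_addl (x y : R) (z : C) : qexp (x + y) z = (qexp x z * qexp y z)%C.
Proof. by rewrite /qexp -Cexp_add; congr Cexp; rewrite Rmult_plus_distr_l RtoC_plus; ring. Qed.

Lemma qexp_addr (x : R) (z w : C) : qexp x (z + w) = (qexp x z * qexp x w)%C.
Proof. by rewrite /qexp -Cexp_add; congr Cexp; ring. Qed.

Lemma qexp_scal (x r : R) (z : C) : qexp x (RtoC r * z) = qexp (x * r) z.
Proof. by rewrite /qexp; congr Cexp; rewrite !RtoC_mult; ring. Qed.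

Lemma qexp_RtoC (x r : R) : qexp x (RtoC r) = turn (x * r / 2).
Proof.
rewrite /qexp /turn; congr Cexp.
have -> : 2 * PI * (x * r / 2) = PI * x * r by field.
by rewrite (RtoC_mult (PI * x)); ring.
Qed.

Lemma qexp_0 (z : C) : qexp 0 z = 1.
Proof. by rewrite /qexp Rmult_0_r !Cmult_0_l Cexp_0. Qed.

Lemma qpow_qexp (t : C) (x : R) : qpow t x = qexp (2 * x) t.
Proof. by rewrite /qpow /qexp; congr (Cexp (RtoC _ * _ * _))%C; ring. Qed.

Lemma dominated_qexp (z : C) : 0 < Im z ->
  dominated (gauss_const (PI * Im z) 0 0) (fun n => qexp (IZR (n * n)) z).
Proof.
move=> hz n; rewrite Cmod_qexp mult_IZR.
have := @gauss_absorb (PI * Im z) 0 0 0 n (Rmult_lt_0_compat _ _ PI_RGT_0 hz).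
by rewrite Rabs_R0 Rplus_0_l Rmult_0_l Rplus_0_r; apply; lra.
Qed.

Definition theta3 (z : C) : C := Zseries (fun n => qexp (IZR (n * n)) z).

Lemma Zseries_delta : Zseries (fun n => if (n =? 0)%Z then RtoC 1 else RtoC 0) = RtoC 1.
Proof.
set f := fun n => _.
have d : dominated 1 f.
  move=> n; rewrite /f; case: Z.eqb_spec => [->|_].
    by rewrite Cmod_1 Rabs_R0 Ropp_0 exp_0; lra.
  by rewrite Cmod_0 Rmult_1_l; apply/Rlt_le/exp_pos.
apply: Clim_unique (Zseries_lim d) _ => eps he; exists 1%nat => -[|N] hN; first by lia.
have -> : Zpart f N.+1 = RtoC 1; last by rewrite /Cminus Cplus_opp_r Cmod_0.
elim: N {hN} => [|N IH]; rewrite /Zpart CsumS; first by rewrite /f /=; ring.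
by rewrite -/(Zpart f N.+1) IH /f /=; ring.
Qed.

Lemma theta3_near_1 (z : C) : 1 <= Im z -> Cmod (theta3 z - 1)%C <= 4 * exp (- (PI * Im z - 1)).
Proof.
move=> hz; have pi3 := PI2_3_2.
have hz0 : 0 < Im z by lra.
have d1 : dominated 1 (fun n => if (n =? 0)%Z then RtoC 1 else RtoC 0).
  move=> n; case: Z.eqb_spec => [->|_].
    by rewrite Cmod_1 Rabs_R0 Ropp_0 exp_0; lra.
  by rewrite Cmod_0 Rmult_1_l; apply/Rlt_le/exp_pos.
rewrite -Zseries_delta /theta3 -(Zseries_minus (dominated_qexp hz0) d1).
apply: Zseries_bound => n.
case: Z.eqb_spec => [->|hn].
  rewrite /= qexp_0 /Cminus Cplus_opp_r Cmod_0 -exp_plus; apply/Rlt_le/exp_pos.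
have -> : (qexp (IZR (n * n)) z - 0 = qexp (IZR (n * n)) z)%C by ring.
rewrite Cmod_qexp -exp_plus; apply: exp_le; rewrite mult_IZR.
have n1 : 1 <= Rabs (IZR n) by rewrite -abs_IZR; apply: IZR_le; lia.
have -> : IZR n * IZR n = Rabs (IZR n) * Rabs (IZR n) by rewrite -Rabs_mult Rabs_pos_eq //; apply: Rle_0_sqr.
have p1 : 3 <= PI * Im z by nra.
have : PI * Im z * Rabs (IZR n) <= PI * Im z * (Rabs (IZR n) * Rabs (IZR n)) by apply: Rmult_le_compat_l; nra.
nra.
Qed.

(** Multipliers are compared by dividing by a theta value; this provides safe points, such as n i
    with n >= 1. *)
Lemma theta3_neq_0 (z : C) : 1 <= Im z -> theta3 z <> RtoC 0.
Proof.
move=> hz h; have := theta3_near_1 hz; rewrite h.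
have -> : (0 - 1 = RtoC (-1))%C by ring.
rewrite Cmod_R Rabs_Ropp Rabs_R1.
have : exp (- (PI * Im z - 1)) < / 4.
  rewrite exp_Ropp; apply: Rinv_lt_contravar.
    by have := exp_pos (PI * Im z - 1); lra.
  have pi3 := PI2_3_2.
  have h2 : exp (1 + 1) <= exp (PI * Im z - 1) by apply: exp_le; nra.
  have h1 : 2 < exp 1 by have := @exp_ineq1 1; lra.
  by apply: Rlt_le_trans h2; rewrite exp_plus; nra.
lra.
Qed.

Lemma theta3_gauss (z : C) : theta3 z = Zseries (fun n => gauss (- Ci * z)%C (IZR n)).
Proof.
apply: Zseries_ext => n; rewrite /qexp /gauss mult_IZR; congr Cexp.
by rewrite -Ropp_mult_distr_l RtoC_opp; ring.
Qed.

Lemma upper_neq_0 (z : C) : 0 < Im z -> z <> RtoC 0.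
Proof. by move=> hz h; move: hz; rewrite h im_RtoC; lra. Qed.

(** With w = -iz one has 1/w = -i(-1/z), so the Fourier coefficients of the periodized Gaussian
    reassemble into [theta3 (- / z)]. *)
Lemma fourier_scaled_inversion (z : C) : 0 < Im z ->
  theta3 z = (fourier 1 0 / Csqrt (- Ci * z) * theta3 (- / z))%C.
Proof.
move=> hz; set w := (- Ci * z)%C.
have hw : 0 < Re w by rewrite Re_mCi.
have z0 := upper_neq_0 hz; have w0 := Re_neq_0 hw; have s0 := Csqrt_neq_0 hw.
have wi : (/ w = - Ci * - / z)%C.
  have : (w * (- Ci * - / z) = - (- 1))%C by rewrite -Ci_sqr /w; field.
  move=> h; rewrite -[LHS]Cmult_1_r.
  have -> : RtoC 1 = (w * (- Ci * - / z))%C by rewrite h; ring.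
  by field.
have hwi : 0 < Re (/ w)%C.
  have m : Re (/ w)%C = Re w / (Re w ^ 2 + Im w ^ 2) by [].
  by rewrite m; apply: Rdiv_lt_0_compat => //; have := pow2_ge_0 (Im w); nra.
rewrite !theta3_gauss -/w -wi.
have -> : Zseries (fun n => gauss w (IZR n)) = wrapped_gauss w 0.
  by apply: Zseries_ext => n; rewrite Rplus_0_l.
have d := @dominated_gauss (/ w)%C 0 0 hwi (Req_le _ _ Rabs_R0).
have d' : dominated (gauss_const (PI * Re (/ w)%C) 0 0) (fun n => gauss (/ w)%C (IZR n)).
  by apply: dominated_ext d => n; rewrite Rplus_0_l.
rewrite -(Zseries_scal _ d').
apply: Clim_unique (wrapped_gauss_fourier_partial hw) _.
apply: Clim_ext (Zseries_lim (dominated_scal _ d')) => N; apply: Csum_ext => n _.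
have fv k : (fourier 1 0 / Csqrt w * gauss (/ w) (IZR k))%C = fourier w (IZR k).
  by rewrite (fourier_value _ hw) /gauss /Cdiv; ring.
by rewrite !fv.
Qed.

(** At the fixed point z = i of the inversion both theta values agree and are nonzero, and the
    square root is 1, so the constant is 1. *)
Lemma fourier_1_0 : fourier 1 0 = RtoC 1.
Proof.
have hi : 1 <= Im Ci by rewrite /=; lra.
have := @fourier_scaled_inversion Ci ltac:(lra).
have -> : (- Ci * Ci = 1)%C by transitivity (- (Ci * Ci))%C; [ring | rewrite Ci_sqr; ring].
rewrite Csqrt_1 Ci_inv.
have -> : (- - Ci = Ci)%C by ring.
have h0 := theta3_neq_0 hi => h.
transitivity ((fourier 1 0 / 1 * theta3 Ci) / theta3 Ci)%C; first by field.
by rewrite -h; field.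
Qed.

Lemma theta3_S (z : C) : 0 < Im z -> theta3 (- / z) = (Csqrt (- Ci * z) * theta3 z)%C.
Proof.
move=> hz; have s0 : Csqrt (- Ci * z)%C <> RtoC 0 by apply: Csqrt_neq_0; rewrite Re_mCi.
by rewrite [in RHS](fourier_scaled_inversion hz) fourier_1_0; field.
Qed.

Definition theta2 (z : C) : C := (theta3 (RtoC (/ 4) * z) - theta3 z)%C.
Definition theta4 (z : C) : C := theta3 (z + 1)%C.

Lemma Im_scal (r : R) (z : C) : 0 < r -> 0 < Im z -> 0 < Im (RtoC r * z)%C.
Proof. by rewrite im_scal_l => h1 h2; apply: Rmult_lt_0_compat. Qed.

Lemma theta3_parity (z : C) : 0 < Im z ->
  theta3 z = (theta3 (RtoC 4 * z) + Zseries (fun n => qexp (IZR ((2 * n + 1) * (2 * n + 1))) z))%C.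
Proof.
move=> hz; rewrite {1}/theta3 (Zseries_parity (dominated_qexp hz)); congr Cplus.
by apply: Zseries_ext => n; rewrite qexp_scal; congr qexp; rewrite !mult_IZR; ring.
Qed.

Lemma theta2_series (z : C) : 0 < Im z ->
  theta2 z = Zseries (fun n => qexp (IZR ((2 * n + 1) * (2 * n + 1)) / 4) z).
Proof.
move=> hz; rewrite /theta2 theta3_parity; last by apply: Im_scal => //; lra.
have -> : (RtoC 4 * (RtoC (/ 4) * z) = z)%C by rewrite Cmult_assoc -RtoC_mult Rinv_r ?Cmult_1_l //; lra.
have -> (x y : C) : (x + y - x = y)%C by ring.
by apply: Zseries_ext => n; rewrite qexp_scal.
Qed.

Lemma turn_half : turn (1 / 2) = (- 1)%C.
Proof.
rewrite /turn Cexp_Ci; have -> : 2 * PI * (1 / 2) = PI by field.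
by rewrite cos_PI sin_PI; apply: Ceq; rewrite /=; ring.
Qed.

(** The shift by 1 multiplies the n-th term by (-1)^n, since n^2 and n have the same parity; the
    even terms sum to [theta3 (4 z)]. *)
Lemma theta4_alt (z : C) : 0 < Im z -> theta4 z = (2 * theta3 (RtoC 4 * z) - theta3 z)%C.
Proof.
move=> hz; have hz1 : 0 < Im (z + 1)%C by rewrite im_plus im_RtoC Rplus_0_r.
have d := dominated_double 1 (dominated_qexp hz).
rewrite (theta3_parity hz) /theta4 (theta3_parity hz1).
have -> : theta3 (RtoC 4 * (z + 1))%C = theta3 (RtoC 4 * z)%C.
  apply: Zseries_ext => n; rewrite Cmult_plus_distr_l qexp_addr Cmult_1_r qexp_RtoC.
  have -> : IZR (n * n) * 4 / 2 = IZR (2 * (n * n)) by rewrite !mult_IZR; field.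
  by rewrite turn_Z Cmult_1_r.
have -> : Zseries (fun n => qexp (IZR ((2 * n + 1) * (2 * n + 1))) (z + 1)) =
  (RtoC (-1) * Zseries (fun n => qexp (IZR ((2 * n + 1) * (2 * n + 1))) z))%C.
  rewrite -(Zseries_scal _ d); apply: Zseries_ext => n.
  rewrite qexp_addr qexp_RtoC Cmult_comm; congr Cmult.
  have -> : IZR ((2 * n + 1) * (2 * n + 1)) * 1 / 2 = IZR (2 * (n * n) + 2 * n) + 1 / 2.
    by rewrite !(mult_IZR, plus_IZR); field.
  by rewrite turn_add turn_Z turn_half; ring.
by ring.
Qed.

Lemma theta3_shift (z : C) (m : Z) : theta3 (z + RtoC (IZR (2 * m)))%C = theta3 z.
Proof.
apply: Zseries_ext => n; rewrite qexp_addr qexp_RtoC.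
have -> : IZR (n * n) * IZR (2 * m) / 2 = IZR (n * n * m) by rewrite !mult_IZR; field.
by rewrite turn_Z Cmult_1_r.
Qed.

Lemma theta4_T (z : C) : theta4 (z + 1)%C = theta3 z.
Proof.
rewrite /theta4 -[in RHS](theta3_shift z 1); congr theta3.
by rewrite -Cplus_assoc -RtoC_plus.
Qed.

(** Odd squares are 1 modulo 8, so every term acquires the same eighth root of unity. *)
Lemma theta2_T (z : C) : 0 < Im z -> theta2 (z + 1)%C = (turn (1 / 8) * theta2 z)%C.
Proof.
move=> hz; have hz1 : 0 < Im (z + 1)%C by rewrite im_plus im_RtoC Rplus_0_r.
rewrite !theta2_series //.
have h4 : 0 < Im (RtoC (/ 4) * z)%C by apply: Im_scal => //; lra.
have d := dominated_double 1 (dominated_qexp h4).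
have e n : qexp (IZR ((2 * n + 1) * (2 * n + 1))) (RtoC (/ 4) * z) = qexp (IZR ((2 * n + 1) * (2 * n + 1)) / 4) z.
  by rewrite qexp_scal.
rewrite -(Zseries_scal _ (dominated_ext e d)); apply: Zseries_ext => n.
rewrite qexp_addr qexp_RtoC Cmult_comm; congr Cmult.
have [m hm] : exists m, (n * n + n = 2 * m)%Z.
  by have [[m ->]|[m ->]] := Z.Even_or_Odd n; [exists (2 * m * m + m)%Z | exists (2 * m * m + 3 * m + 1)%Z]; ring.
have -> : IZR ((2 * n + 1) * (2 * n + 1)) / 4 * 1 / 2 = IZR m + 1 / 8.
  have -> : ((2 * n + 1) * (2 * n + 1) = 8 * m + 1)%Z by lia.
  by rewrite plus_IZR mult_IZR; field.
by rewrite turn_add turn_Z Cmult_1_l.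
Qed.

Lemma upper_S (z : C) : 0 < Im z -> 0 < Im (- / z)%C.
Proof.
move=> hz; have -> : Im (- / z)%C = Im z / (Re z ^ 2 + Im z ^ 2).
  by rewrite im_opp /Cinv /Im /Re /= /Rdiv; ring.
by apply: Rdiv_lt_0_compat => //; have := pow2_ge_0 (Re z); nra.
Qed.

Lemma cone_mult (u v : C) : Rabs (Im u) < Re u -> Rabs (Im v) < Re v -> 0 < Re (u * v)%C.
Proof.
rewrite re_mult => /Rabs_def2 [a b] /Rabs_def2 [c d]; nra.
Qed.

(** The product has square 1, and its factors lie in the sector |arg| < pi/4, which excludes -1. *)
Lemma Csqrt_S (z : C) : 0 < Im z -> (Csqrt (- Ci * - / z) * Csqrt (- Ci * z) = 1)%C.
Proof.
move=> hz; have z0 := upper_neq_0 hz.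
have h1 : 0 < Re (- Ci * z)%C by rewrite Re_mCi.
have h2 : 0 < Re (- Ci * - / z)%C by rewrite Re_mCi; apply: upper_S.
apply: sqr_eq_Re_pos; last by rewrite re_RtoC; lra.
  transitivity ((Csqrt (- Ci * - / z) * Csqrt (- Ci * - / z)) * (Csqrt (- Ci * z) * Csqrt (- Ci * z)))%C; first by ring.
  rewrite !Csqrt_sqr; try exact: slit_Re.
  have -> : (- Ci * - / z * (- Ci * z) = - (Ci * Ci))%C by field.
  by rewrite Ci_sqr; ring.
by apply: cone_mult; apply: Csqrt_cone.
Qed.

Lemma inv_S (z : C) : z <> RtoC 0 -> (- / - / z = z)%C.
Proof.
by move=> h; field.
Qed.

Lemma theta2_S (z : C) : 0 < Im z -> theta2 (- / z) = (Csqrt (- Ci * z) * theta4 z)%C.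
Proof.
move=> hz; have z0 := upper_neq_0 hz.
have hm : 0 < Re (- Ci * z)%C by rewrite Re_mCi.
rewrite theta4_alt // /theta2 (theta3_S hz).
have -> : (RtoC (/ 4) * - / z = - / (RtoC 4 * z))%C.
  by rewrite RtoC_inv; [field | lra].
rewrite theta3_S; last by apply: Im_scal => //; lra.
have -> : (- Ci * (RtoC 4 * z) = RtoC 4 * (- Ci * z))%C by ring.
rewrite Csqrt_scal; [|lra|exact: slit_Re].
have -> : sqrt 4 = 2 by rewrite (_ : 4 = 2 * 2); [rewrite sqrt_square; lra | ring].
by ring.
Qed.

Lemma theta4_S (z : C) : 0 < Im z -> theta4 (- / z) = (Csqrt (- Ci * z) * theta2 z)%C.
Proof.
move=> hz; have := theta2_S (upper_S hz); rewrite inv_S; last exact: upper_neq_0.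
move=> ->; rewrite Cmult_assoc (Cmult_comm (Csqrt (- Ci * z))) Csqrt_S //.
by rewrite Cmult_1_l.
Qed.

End ThetaConstants.

(** * Continuity of multipliers *)

Section Continuity.
Local Open Scope R_scope.

Definition Ccont (J : C -> C) (z : C) : Prop :=
  forall eps, 0 < eps -> exists del, 0 < del /\
    forall z', Cmod (z' - z)%C < del -> Cmod (J z' - J z)%C < eps.

Lemma Ccont_const (k z : C) : Ccont (fun _ => k) z.
Proof.
by move=> eps he; exists 1; split=> [|z' _]; [lra | rewrite /Cminus Cplus_opp_r Cmod_0].
Qed.

Lemma Ccont_comp (J f : C -> C) (z : C) : Ccont f z -> Ccont J (f z) -> Ccont (fun x => J (f x)) z.
Proof.
move=> hf hJ eps he; have [d1 [h1 H1]] := hJ _ he; have [d2 [h2 H2]] := hf _ h1.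
by exists d2; split => // z' hz'; apply: H1; apply: H2.
Qed.

Lemma Ccont_mult (f g : C -> C) (z : C) : Ccont f z -> Ccont g z -> Ccont (fun x => f x * g x)%C z.
Proof.
move=> hf hg eps he.
have f0 := Cmod_ge_0 (f z); have g0 := Cmod_ge_0 (g z).
pose B := Cmod (f z) + Cmod (g z) + 1.
pose e := Rmin 1 (eps / B).
have B0 : 0 < B by rewrite /B; lra.
have e0 : 0 < e by apply: Rmin_pos; [lra | apply: Rdiv_lt_0_compat].
have e1 : e <= 1 by apply: Rmin_l.
have eB : e * B <= eps.
  have : e <= eps / B by apply: Rmin_r.
  by move=> /(Rmult_le_compat_r B _ _ (Rlt_le _ _ B0)); rewrite /Rdiv Rmult_assoc Rinv_l; lra.
have [d1 [h1 H1]] := hf _ e0; have [d2 [h2 H2]] := hg _ e0.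
exists (Rmin d1 d2); split; first exact: Rmin_pos.
move=> z' hz'.
have a1 := H1 z' (Rlt_le_trans _ _ _ hz' (Rmin_l _ _)).
have a2 := H2 z' (Rlt_le_trans _ _ _ hz' (Rmin_r _ _)).
set x := (f z' - f z)%C in a1; set y := (g z' - g z)%C in a2.
have -> : (f z' * g z' - f z * g z = x * y + x * g z + f z * y)%C by rewrite /x /y; ring.
apply: Rle_lt_trans (Cmod_triangle _ _) _.
apply: Rle_lt_trans (Rplus_le_compat_r _ _ _ (Cmod_triangle _ _)) _.
rewrite !Cmod_mult; have x0 := Cmod_ge_0 x; have y0 := Cmod_ge_0 y.
have b1 : Cmod x * Cmod y < e * 1.
  by apply: Rle_lt_trans (_ : Cmod x * 1 < _); [apply: Rmult_le_compat_l; lra | lra].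
have b2 : Cmod x * Cmod (g z) <= e * Cmod (g z) by apply: Rmult_le_compat_r; lra.
have b3 : Cmod (f z) * Cmod y <= Cmod (f z) * e by apply: Rmult_le_compat_l; lra.
have : e * B = e * 1 + e * Cmod (g z) + Cmod (f z) * e by rewrite /B; ring.
lra.
Qed.

Lemma Ccont_id (z : C) : Ccont (fun x => x) z.
Proof. by move=> eps he; exists eps. Qed.

Lemma Ccont_shift (k z : C) : Ccont (fun x => x + k)%C z.
Proof.
move=> eps he; exists eps; split=> // z'.
by have -> : (z' + k - (z + k) = z' - z)%C by ring.
Qed.

Lemma Ccont_inv (z : C) : z <> RtoC 0 -> Ccont (fun x => - / x)%C z.
Proof.
move=> hz eps he.
have z0 : 0 < Cmod z by apply/Cmod_gt_0.
have m0 : 0 < Rmin (Cmod z / 2) (eps * (Cmod z * Cmod z) / 2).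
  by apply: Rmin_pos; first lra; apply: Rmult_lt_0_compat; [apply: Rmult_lt_0_compat => //; nra | lra].
exists (Rmin (Cmod z / 2) (eps * (Cmod z * Cmod z) / 2)); split=> // z' hz'.
have h1 := Rlt_le_trans _ _ _ hz' (Rmin_l _ _).
have h2 := Rlt_le_trans _ _ _ hz' (Rmin_r _ _).
have z1 : Cmod z / 2 < Cmod z'.
  by have := Cmod_triangle_inv z z'; rewrite Cmod_minus_sym; lra.
have hz1 : z' <> RtoC 0 by apply/Cmod_gt_0; lra.
have -> : (- / z' - - / z = (z' - z) / (z * z'))%C by field.
rewrite Cmod_div ?Cmod_mult; last exact: Cmult_neq_0.
have p : 0 < Cmod z * Cmod z' by nra.
apply: (Rmult_lt_reg_r (Cmod z * Cmod z')) => //.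
rewrite /Rdiv Rmult_assoc Rinv_l ?Rmult_1_r; last by lra.
apply: Rlt_trans h2 _.
have -> : eps * (Cmod z * Cmod z) / 2 = eps * (Cmod z * (Cmod z / 2)) by field.
by apply: Rmult_lt_compat_l => //; apply: Rmult_lt_compat_l.
Qed.

Lemma Ccont_Csqrt (z : C) : 0 < Im z -> Ccont (fun x => Csqrt (- Ci * x))%C z.
Proof.
move=> hz eps he.
have hs : slit_plane (- Ci * z)%C by apply: slit_Re; rewrite Re_mCi.
have hp := Csqrt_Re_pos hs; set p := Re _ in hp.
have e0 : 0 < eps * p by apply: Rmult_lt_0_compat.
exists (Rmin (Im z) (eps * p)); split; first exact: Rmin_pos.
move=> z' hz'.
have h1 := Rlt_le_trans _ _ _ hz' (Rmin_l _ _).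
have h2 := Rlt_le_trans _ _ _ hz' (Rmin_r _ _).
have hs' : slit_plane (- Ci * z')%C.
  apply: slit_Re; rewrite Re_mCi.
  have := im_le_Cmod (z' - z)%C; rewrite im_plus im_opp => h3.
  by have := Rle_lt_trans _ _ _ h3 h1 => /Rabs_def2; lra.
have := Csqrt_lipschitz hs' hs.
have -> : Cmod (- Ci * z' - - Ci * z)%C = Cmod (z' - z)%C.
  have -> : (- Ci * z' - - Ci * z = - Ci * (z' - z))%C by ring.
  by rewrite Cmod_mult Cmod_opp Cmod_Ci Rmult_1_l.
rewrite -/p => h3; apply: (Rmult_lt_reg_r p) => //; lra.
Qed.

End Continuity.

(** * Inversion of theta3 at a third of the argument; characters modulo 4, 8 and 3 *)

Section ThetaGroup.
Local Open Scope R_scope.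

Lemma Im_minus (x y : C) : Im (x - y)%C = Im x - Im y.
Proof. by rewrite /Cminus im_plus im_opp. Qed.

Lemma Im_minus_R (x : C) (r : R) : Im (x - RtoC r)%C = Im x.
Proof. by rewrite Im_minus im_RtoC Rminus_0_r. Qed.

Lemma Im_plus_R (x : C) (r : R) : Im (x + RtoC r)%C = Im x.
Proof. by rewrite im_plus im_RtoC Rplus_0_r. Qed.

(* The left-hand side reduces to the right-hand one by three uses of [theta3_S]; the arguments of the
   square roots that appear decide the sign of their product. *)
Lemma theta3_third_S (z : C) : 0 < Im z ->
  theta3 (RtoC (/ 3) * (- / z + 2)) = (Ci * Csqrt (- Ci * z) * theta3 (RtoC (/ 3) * (z - 2)))%C.
Proof.
move=> hz; have z0 := upper_neq_0 hz.
set s := (RtoC (/ 3) * (z - 2))%C.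
have hs : 0 < Im s by apply: Im_scal; [lra | rewrite Im_minus_R].
have s0 := upper_neq_0 hs.
(* From s to r and from r to x one applies an inversion and an even translation, which leaves
   [theta3] unchanged; the argument on the left turns out to be -1/x. *)
pose r := (- / s - 2)%C.
have hr : 0 < Im r by rewrite Im_minus_R; apply: upper_S.
have r0 := upper_neq_0 hr.
pose x := (- / r - 2)%C.
have hx : 0 < Im x by rewrite Im_minus_R; apply: upper_S.
have x0 := upper_neq_0 hx.
have three : RtoC 3 <> RtoC 0 by move=> /RtoC_inj; lra.
have zs : z = (3 * s + 2)%C by rewrite /s RtoC_inv; [field | lra].
have d0 : (2 * s + 1 <> 0)%C.
  by move=> h; have := f_equal Im h; rewrite Im_plus_R im_scal_l im_RtoC; lra.
have rs : (r * s = - (2 * s + 1))%C by rewrite /r; field.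
have xr : (x * r = - (1 + 2 * r))%C by rewrite /x; field.
have eqx : (RtoC (/ 3) * (- / z + 2) = - / x)%C.
  have xz : (x * (2 * s + 1) = - z)%C.
    have : (x * r * s = - (s + 2 * (r * s)))%C by rewrite xr; ring.
    have -> : (x * r * s = x * (r * s))%C by ring.
    by rewrite rs zs => h; transitivity (- (x * - (2 * s + 1)))%C; [ring | rewrite h; ring].
  have -> : x = (- z / (2 * s + 1))%C by rewrite -xz; field.
  have -> : (2 * s + 1 = RtoC (/ 3) * (2 * z - 1))%C by rewrite zs RtoC_inv; [field | lra].
  have d1 : (2 * z - 1 <> 0)%C.
    by move=> h; have := f_equal Im h; rewrite Im_minus_R im_scal_l im_RtoC; lra.
  by rewrite RtoC_inv; [field | lra].
have p_cone : Rabs (Im (Csqrt (- Ci * x)%C)) < Re (Csqrt (- Ci * x)%C) by apply: Csqrt_cone; rewrite Re_mCi.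
have qr_cone : Rabs (Im (Csqrt (- Ci * r)%C)) < Re (Csqrt (- Ci * r)%C) by apply: Csqrt_cone; rewrite Re_mCi.
have qs_cone : Rabs (Im (Csqrt (- Ci * s)%C)) < Re (Csqrt (- Ci * s)%C) by apply: Csqrt_cone; rewrite Re_mCi.
have v_cone : Rabs (Im (Csqrt (- Ci * z)%C)) < Re (Csqrt (- Ci * z)%C) by apply: Csqrt_cone; rewrite Re_mCi.
have th_x : theta3 x = theta3 (- / r).
  by rewrite /x -(theta3_shift (- / r)%C (-1)); congr theta3; rewrite /Cminus; congr Cplus; rewrite -RtoC_opp.
have th_r : theta3 r = theta3 (- / s).
  by rewrite /r -(theta3_shift (- / s)%C (-1)); congr theta3; rewrite /Cminus; congr Cplus; rewrite -RtoC_opp.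
rewrite eqx (theta3_S hx) th_x (theta3_S hr) th_r (theta3_S hs).
set p := Csqrt (- Ci * x)%C in p_cone *; set v := Csqrt (- Ci * z)%C in v_cone *.
set q1 := Csqrt (- Ci * r)%C in qr_cone *; set q2 := Csqrt (- Ci * s)%C in qs_cone *.
have sq (y : C) : 0 < Im y -> (Csqrt (- Ci * y) * Csqrt (- Ci * y) = - Ci * y)%C.
  by move=> h; apply: Csqrt_sqr; apply: slit_Re; rewrite Re_mCi.
have pq := cone_mult qr_cone qs_cone; set q := (q1 * q2)%C in pq.
have qq : (q * q = 2 * s + 1)%C.
  transitivity ((q1 * q1) * (q2 * q2))%C; first by rewrite /q; ring.
  rewrite /q1 /q2 !sq //.
  transitivity ((Ci * Ci) * (r * s))%C; first by ring.
  by rewrite Ci_sqr rs; ring.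
have iq : 0 < Im q.
  have := f_equal Im qq; rewrite im_mult Im_plus_R im_scal_l => h; nra.
suff e : (p * q = Ci * v)%C.
  by rewrite -e /q; ring.
have vz : (v * v = - Ci * z)%C by apply: sq.
case: (@sqr_eq_C (p * q)%C (Ci * v)%C) => //.
  transitivity ((p * p) * (q * q))%C; first by ring.
  transitivity ((Ci * Ci) * (v * v))%C; last by ring.
  rewrite vz Ci_sqr qq /p sq //.
  have -> : z = (- (x * (2 * s + 1)))%C; last by ring.
  have : (x * r * s = - (s + 2 * (r * s)))%C by rewrite xr; ring.
  have -> : (x * r * s = x * (r * s))%C by ring.
  by rewrite rs zs => h; transitivity (x * - (2 * s + 1))%C; [rewrite h; ring | ring].
(* The product q lies in the open first quadrant, and p and v in the sector |arg| < pi/4. So p q has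
   argument in (-pi/4, 3pi/4), and -iv has argument in (-3pi/4, -pi/4). *)
move=> h; exfalso.
have h1 := f_equal Re h; have h2 := f_equal Im h; move: h1 h2.
rewrite re_opp im_opp (proj1 (Im_Ci_mult v)) (proj2 (Im_Ci_mult v)) re_mult im_mult => h1 h2.
move: p_cone v_cone => /Rabs_def2 [a1 a2] /Rabs_def2 [b1 b2].
have c1 : 0 < Re q * (Re p + Im p) by apply: Rmult_lt_0_compat; lra.
have c2 : 0 < Im q * (Re p - Im p) by apply: Rmult_lt_0_compat; lra.
nra.
Qed.

(* The characters (-4/.), (8/.) and (./3), with junk values where these vanish. *)
Definition chi4 (d : Z) : Z := if (d mod 4 =? 1)%Z then 1%Z else (-1)%Z.
Definition chi8 (d : Z) : Z := if ((d mod 8 =? 1) || (d mod 8 =? 7))%Z then 1%Z else (-1)%Z.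
Definition chi3 (d : Z) : Z := if (d mod 3 =? 1)%Z then 1%Z else (-1)%Z.

Ltac chi_cases :=
  rewrite /chi4 /chi8 /chi3; repeat case: Z.eqb_spec; cbv beta iota delta [orb]; intros;
  Z.to_euclidean_division_equations; lia.

Lemma chi4_opp (d : Z) : Z.odd d = true -> chi4 (- d) = (- chi4 d)%Z.
Proof. by rewrite Zodd_mod => /Z.eqb_eq; chi_cases. Qed.

Lemma chi8_opp (d : Z) : Z.odd d = true -> chi8 (- d) = chi8 d.
Proof. by rewrite Zodd_mod => /Z.eqb_eq; chi_cases. Qed.

Lemma chi3_opp (d : Z) : (d mod 3 <> 0)%Z -> chi3 (- d) = (- chi3 d)%Z.
Proof. chi_cases. Qed.

Lemma chi4_period (d c : Z) : Z.odd c = false -> chi4 (d + 2 * c) = chi4 d.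
Proof. by rewrite Zodd_mod => /Z.eqb_neq; chi_cases. Qed.

Lemma chi8_period (d c : Z) : (c mod 4 = 0)%Z -> chi8 (d + 2 * c) = chi8 d.
Proof. chi_cases. Qed.

Lemma chi8_flip (d c : Z) : Z.odd d = true -> (c mod 4 = 2)%Z -> chi8 (d + 2 * c) = (- chi8 d)%Z.
Proof. by rewrite Zodd_mod => /Z.eqb_eq; chi_cases. Qed.

Lemma chi3_period (d c : Z) : (c mod 3 = 0)%Z -> chi3 (d + 2 * c) = chi3 d.
Proof. chi_cases. Qed.

End ThetaGroup.

(** * Cocycle relations for the companion formulas *)

Section ThetaGroupLaw.
Local Open Scope R_scope.

Definition ZtoC (n : Z) : C := RtoC (IZR n).

Lemma ZtoC_opp (n : Z) : ZtoC (- n) = (- ZtoC n)%C.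
Proof. by rewrite /ZtoC opp_IZR RtoC_opp. Qed.

Lemma ZtoC_mult (n m : Z) : ZtoC (n * m) = (ZtoC n * ZtoC m)%C.
Proof. by rewrite /ZtoC mult_IZR RtoC_mult. Qed.

Lemma ZtoC_plus (n m : Z) : ZtoC (n + m) = (ZtoC n + ZtoC m)%C.
Proof. by rewrite /ZtoC plus_IZR RtoC_plus. Qed.

Lemma scal_S (r : R) (z : C) : 0 < r -> z <> RtoC 0 -> (RtoC r * - / z = - / (RtoC (/ r) * z))%C.
Proof.
move=> hr hz; have hr' : RtoC r <> RtoC 0 by move=> /RtoC_inj; lra.
rewrite RtoC_inv; last by lra.
by field.
Qed.

Lemma Csqrt_scal_S (r : R) (z : C) : 0 < r -> 0 < Im z ->
  Csqrt (- Ci * (RtoC (/ r) * z))%C = (RtoC (/ sqrt r) * Csqrt (- Ci * z))%C.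
Proof.
move=> hr hz; have hi := Rinv_0_lt_compat _ hr.
have -> : (- Ci * (RtoC (/ r) * z) = RtoC (/ r) * (- Ci * z))%C by ring.
by rewrite Csqrt_scal // ?sqrt_inv //; apply: slit_Re; rewrite Re_mCi.
Qed.

Lemma theta3_scal_S (r : R) (z : C) : 0 < r -> 0 < Im z ->
  theta3 (RtoC r * - / z) = (RtoC (/ sqrt r) * Csqrt (- Ci * z) * theta3 (RtoC (/ r) * z))%C.
Proof.
move=> hr hz; rewrite scal_S //; last exact: upper_neq_0.
by rewrite theta3_S ?Csqrt_scal_S //; apply: Im_scal => //; apply: Rinv_0_lt_compat.
Qed.

Lemma theta2_scal_S (r : R) (z : C) : 0 < r -> 0 < Im z ->
  theta2 (RtoC r * - / z) = (RtoC (/ sqrt r) * Csqrt (- Ci * z) * theta4 (RtoC (/ r) * z))%C.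
Proof.
move=> hr hz; rewrite scal_S //; last exact: upper_neq_0.
by rewrite theta2_S ?Csqrt_scal_S //; apply: Im_scal => //; apply: Rinv_0_lt_compat.
Qed.

Lemma theta4_scal_S (r : R) (z : C) : 0 < r -> 0 < Im z ->
  theta4 (RtoC r * - / z) = (RtoC (/ sqrt r) * Csqrt (- Ci * z) * theta2 (RtoC (/ r) * z))%C.
Proof.
move=> hr hz; rewrite scal_S //; last exact: upper_neq_0.
by rewrite theta4_S ?Csqrt_scal_S //; apply: Im_scal => //; apply: Rinv_0_lt_compat.
Qed.

Lemma theta2_T4 (z : C) : 0 < Im z -> theta2 (z + 4)%C = (- theta2 z)%C.
Proof.
move=> hz.
have -> : (z + 4 = z + 1 + 1 + 1 + 1)%C by rewrite -!Cplus_assoc -!RtoC_plus; congr (_ + RtoC _)%C; ring.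
rewrite !theta2_T ?Im_plus_R // !Cmult_assoc -!turn_add.
have -> : 1 / 8 + 1 / 8 + 1 / 8 + 1 / 8 = 1 / 2 by field.
by rewrite turn_half; ring.
Qed.

(* For (a, b; c, d) in the theta group, [theta3 (2 z)] and [theta3 (3 z)] are carried to [G2 c d] and
   [delta c d * H3 c d] by the same multiplier [J] that carries [theta3] to itself, and [J ^ 2] is
   [delta c d * (c z + d)]; the formulas are forced by the cocycle relations for [z + 2] and [- 1 / z]. *)
Definition delta (c d : Z) : C := if Z.odd d then ZtoC (chi4 d) else (- Ci * ZtoC (chi4 c))%C.

Definition G2 (c d : Z) (z : C) : C :=
  if Z.odd d then
    (ZtoC (chi8 d) * (if (c mod 4 =? 0)%Z then theta3 (RtoC 2 * z) else theta2 (RtoC 2 * z)))%C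
  else
    (ZtoC (chi8 c) * RtoC (/ sqrt 2) *
     (if (d mod 4 =? 0)%Z then theta3 (RtoC (/ 2) * z) else theta4 (RtoC (/ 2) * z)))%C.

Definition H3 (c d : Z) (z : C) : C :=
  if (c mod 3 =? 0)%Z then (ZtoC (chi3 d) * theta3 (RtoC 3 * z))%C
  else (ZtoC (chi3 c) * (Ci * RtoC (/ sqrt 3)) * theta3 (RtoC (/ 3) * (z + ZtoC (4 * c * d))))%C.

(** For the bottom row of a matrix of determinant 1 this says that c d is even, the condition
    imposed by the theta group. *)
Definition opposite_parity (c d : Z) : Prop := Z.odd c = negb (Z.odd d).

Lemma odd_mod4 (d : Z) : Z.odd d = false -> (d mod 4 <> 0)%Z -> (d mod 4 = 2)%Z.
Proof. by rewrite Zodd_mod => /Z.eqb_neq; intros; Z.to_euclidean_division_equations; lia. Qed.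

Lemma delta_T (c d : Z) : opposite_parity c d -> delta c (d + 2 * c) = delta c d.
Proof.
rewrite /delta /opposite_parity Z.odd_add_mul_2; case: (Z.odd d) => //= h.
by rewrite chi4_period.
Qed.

Lemma delta_S (c d : Z) : opposite_parity c d -> delta d (- c) = (- Ci * delta c d)%C.
Proof.
rewrite /delta /opposite_parity Z.odd_opp; case: (Z.odd d) => //= h; rewrite h // chi4_opp //.
rewrite ZtoC_opp; transitivity ((Ci * Ci) * ZtoC (chi4 c))%C; last by ring.
by rewrite Ci_sqr; ring.
Qed.

Lemma G2_T (c d : Z) (z : C) : 0 < Im z -> opposite_parity c d -> G2 c d (z + 2) = G2 c (d + 2 * c) z.
Proof.
rewrite /G2 /opposite_parity Z.odd_add_mul_2 => hz; case ed: (Z.odd d) => h.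
  have {}h : Z.odd c = false := h.
  have h2 : 0 < Im (RtoC 2 * z)%C by apply: Im_scal => //; lra.
  have e : (RtoC 2 * (z + 2) = RtoC 2 * z + 4)%C by rewrite Cmult_plus_distr_l -RtoC_mult; congr (_ + RtoC _)%C; ring.
  rewrite e; case: Z.eqb_spec => hc.
    rewrite chi8_period //; congr Cmult.
    exact: (theta3_shift (RtoC 2 * z)%C 2).
  rewrite chi8_flip //; last exact: odd_mod4.
  by rewrite theta2_T4 // ZtoC_opp; ring.
have {}h : Z.odd c = true := h.
congr Cmult.
have e : (RtoC (/ 2) * (z + 2) = RtoC (/ 2) * z + 1)%C by rewrite Cmult_plus_distr_l -RtoC_mult; congr (_ + RtoC _)%C; field.
rewrite e.
case: Z.eqb_spec => hd; case: Z.eqb_spec => hd'.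
- by exfalso; move: h hd hd'; rewrite Zodd_mod => /Z.eqb_eq; clear; intros; Z.to_euclidean_division_equations; lia.
- by [].
- exact: theta4_T.
- exfalso; have := odd_mod4 ed hd => hd2.
  by move: h hd2 hd'; rewrite Zodd_mod => /Z.eqb_eq; clear; intros; Z.to_euclidean_division_equations; lia.
Qed.

Lemma opp_mod4 (c : Z) : ((- c) mod 4 =? 0)%Z = (c mod 4 =? 0)%Z.
Proof. by do 2 case: Z.eqb_spec => //; intros; Z.to_euclidean_division_equations; lia. Qed.

Lemma G2_S (c d : Z) (z : C) : 0 < Im z -> opposite_parity c d ->
  G2 c d (- / z) = (Csqrt (- Ci * z) * G2 d (- c) z)%C.
Proof.
rewrite /G2 /opposite_parity Z.odd_opp => hz; case ed: (Z.odd d) => /= h; rewrite h ?opp_mod4.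
  by case: Z.eqb_spec => hc; rewrite ?theta3_scal_S ?theta2_scal_S //; try lra; ring.
have q2 : sqrt 2 <> 0 by apply/Rgt_not_eq/sqrt_lt_R0; lra.
have s2 : (RtoC (/ sqrt 2) * RtoC (/ sqrt (/ 2)) = 1)%C.
  by rewrite -RtoC_mult sqrt_inv Rinv_inv Rinv_l.
rewrite chi8_opp; last by rewrite h.
have hi : 0 < / 2 by lra.
case: Z.eqb_spec => hd; rewrite ?(theta3_scal_S hi) ?(theta4_scal_S hi) // Rinv_inv.
  transitivity ((RtoC (/ sqrt 2) * RtoC (/ sqrt (/ 2))) * (ZtoC (chi8 c) * Csqrt (- Ci * z) * theta3 (RtoC 2 * z)))%C; first by ring.
  by rewrite s2; ring.
transitivity ((RtoC (/ sqrt 2) * RtoC (/ sqrt (/ 2))) * (ZtoC (chi8 c) * Csqrt (- Ci * z) * theta2 (RtoC 2 * z)))%C; first by ring.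
by rewrite s2; ring.
Qed.

(** The period 2 of [theta3] becomes period 6 after division of the argument by 3. *)
Lemma theta3_third_shift (z : C) (m n : Z) : ((m - n) mod 6 = 0)%Z ->
  theta3 (RtoC (/ 3) * (z + ZtoC m)) = theta3 (RtoC (/ 3) * (z + ZtoC n)).
Proof.
move=> h; have [k hk] : exists k, (m = n + 6 * k)%Z.
  by exists ((m - n) / 6)%Z; move: h; intros; Z.to_euclidean_division_equations; lia.
rewrite -[RHS](theta3_shift _ k); congr theta3.
rewrite hk /ZtoC plus_IZR (mult_IZR 6) (mult_IZR 2) RtoC_plus (RtoC_mult 6) (RtoC_mult 2).
have three : RtoC 3 <> RtoC 0 by move=> /RtoC_inj; lra.
rewrite RtoC_inv; last by lra.
by field.
Qed.

Lemma mod3_sqr (c : Z) : (c mod 3 <> 0)%Z -> ((c * c) mod 3 = 1)%Z.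
Proof.
move=> h; have [q [->|->]] : exists q, (c = 3 * q + 1 \/ c = 3 * q + 2)%Z.
  by exists (c / 3)%Z; intros; Z.to_euclidean_division_equations; lia.
- have -> : ((3 * q + 1) * (3 * q + 1) = 1 + (3 * q * q + 2 * q) * 3)%Z by ring.
  by rewrite Z_mod_plus_full.
- have -> : ((3 * q + 2) * (3 * q + 2) = 1 + (3 * q * q + 4 * q + 1) * 3)%Z by ring.
  by rewrite Z_mod_plus_full.
Qed.

Lemma H3_T (c d : Z) (z : C) : H3 c d (z + 2) = H3 c (d + 2 * c) z.
Proof.
rewrite /H3; case: Z.eqb_spec => hc.
  rewrite chi3_period //; congr Cmult.
  have -> : (RtoC 3 * (z + 2) = RtoC 3 * z + RtoC (IZR (2 * 3)))%C.
    by rewrite Cmult_plus_distr_l -RtoC_mult mult_IZR; congr (_ + RtoC _)%C; ring.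
  exact: theta3_shift.
congr Cmult; have -> : (z + 2 + ZtoC (4 * c * d) = z + ZtoC (2 + 4 * c * d))%C by rewrite ZtoC_plus /ZtoC; ring.
apply: theta3_third_shift.
(* As c^2 = 1 modulo 3, 8 c^2 = 2 modulo 6: the term 4cd in [H3] is made to compensate the
   translation by 2. *)
have -> : (2 + 4 * c * d - 4 * c * (d + 2 * c) = 2 - 8 * (c * c))%Z by ring.
by have := mod3_sqr hc; intros; Z.to_euclidean_division_equations; lia.
Qed.

Lemma theta3_third_S_minus (z : C) : 0 < Im z ->
  theta3 (RtoC (/ 3) * (- / z - 2)) = (- Ci * Csqrt (- Ci * z) * theta3 (RtoC (/ 3) * (z + 2)))%C.
Proof.
move=> hz; have := theta3_third_S (upper_S hz); rewrite inv_S => [->|]; last exact: upper_neq_0.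
set X := theta3 _.
transitivity ((- (Ci * Ci)) * (Csqrt (- Ci * - / z) * Csqrt (- Ci * z)) * X)%C; last by ring.
by rewrite Csqrt_S // Ci_sqr; ring.
Qed.

(** If 3 divides c or d, the inversion exchanges the scales 3 and 1/3. Otherwise 4cd is -2 or 2
    modulo 6 according as cd is 1 or 2 modulo 3, and one of the two identities at a third of the
    argument applies. *)
Lemma H3_S (c d : Z) (z : C) : 0 < Im z -> ~ ((c mod 3 = 0)%Z /\ (d mod 3 = 0)%Z) ->
  H3 c d (- / z) = (- Ci * Csqrt (- Ci * z) * H3 d (- c) z)%C.
Proof.
move=> hz hcd; rewrite /H3; set s := Csqrt _.
have q3 : sqrt 3 <> 0 by apply/Rgt_not_eq/sqrt_lt_R0; lra.
have h3 : 0 < 3 by lra.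
have hi : 0 < / 3 by lra.
case: Z.eqb_spec => hc; case: Z.eqb_spec => hd.
- by case: hcd.
- rewrite (theta3_scal_S h3) // -/s.
  have -> : theta3 (RtoC (/ 3) * z)%C = theta3 (RtoC (/ 3) * (z + ZtoC (4 * d * - c)))%C.
    have -> : (RtoC (/ 3) * z = RtoC (/ 3) * (z + ZtoC 0))%C by rewrite /ZtoC; ring.
    apply: theta3_third_shift.
    have -> : (c = 3 * (c / 3))%Z by intros; Z.to_euclidean_division_equations; lia.
    have -> : (0 - 4 * d * - (3 * (c / 3)) = (2 * d * (c / 3)) * 6)%Z by ring.
    exact: Z_mod_mult.
  set X := theta3 _.
  transitivity (- (Ci * Ci) * (ZtoC (chi3 d) * RtoC (/ sqrt 3) * s * X))%C; last by ring.
  by rewrite Ci_sqr; ring.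
- have -> : theta3 (RtoC (/ 3) * (- / z + ZtoC (4 * c * d)))%C = theta3 (RtoC (/ 3) * - / z)%C.
    have -> : (RtoC (/ 3) * - / z = RtoC (/ 3) * (- / z + ZtoC 0))%C by rewrite /ZtoC; ring.
    apply: theta3_third_shift.
    have -> : (d = 3 * (d / 3))%Z by intros; Z.to_euclidean_division_equations; lia.
    have -> : (4 * c * (3 * (d / 3)) - 0 = (2 * c * (d / 3)) * 6)%Z by ring.
    exact: Z_mod_mult.
  rewrite (theta3_scal_S hi) // Rinv_inv -/s chi3_opp // ZtoC_opp; set X := theta3 _.
  have e : (RtoC (/ sqrt 3) * RtoC (/ sqrt (/ 3)) = 1)%C.
    by rewrite -RtoC_mult sqrt_inv Rinv_inv Rinv_l.
  transitivity ((RtoC (/ sqrt 3) * RtoC (/ sqrt (/ 3))) * (ZtoC (chi3 c) * Ci * s * X))%C; first by ring.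
  by rewrite e; ring.
- have [h|h] : ((c * d) mod 3 = 1 /\ chi3 d = chi3 c \/ (c * d) mod 3 = 2 /\ chi3 d = - chi3 c)%Z.
    have [p hp] : exists p, (c = 3 * p + 1 \/ c = 3 * p + 2)%Z.
      by exists (c / 3)%Z; intros; Z.to_euclidean_division_equations; lia.
    have [q hq] : exists q, (d = 3 * q + 1 \/ d = 3 * q + 2)%Z.
      by exists (d / 3)%Z; intros; Z.to_euclidean_division_equations; lia.
    have c1 x : chi3 (3 * x + 1) = 1%Z.
      by rewrite /chi3; case: Z.eqb_spec => //; intros; Z.to_euclidean_division_equations; lia.
    have c2 x : chi3 (3 * x + 2) = (-1)%Z.
      by rewrite /chi3; case: Z.eqb_spec => //; intros; Z.to_euclidean_division_equations; lia.
    case: hp => ->; case: hq => ->; rewrite ?c1 ?c2; [left|right|right|left]; split=> //.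
    + have -> : ((3 * p + 1) * (3 * q + 1) = 1 + (3 * p * q + p + q) * 3)%Z by ring.
      by rewrite Z_mod_plus_full.
    + have -> : ((3 * p + 1) * (3 * q + 2) = 2 + (3 * p * q + 2 * p + q) * 3)%Z by ring.
      by rewrite Z_mod_plus_full.
    + have -> : ((3 * p + 2) * (3 * q + 1) = 2 + (3 * p * q + p + 2 * q) * 3)%Z by ring.
      by rewrite Z_mod_plus_full.
    + have -> : ((3 * p + 2) * (3 * q + 2) = 1 + (3 * p * q + 2 * p + 2 * q + 1) * 3)%Z by ring.
      by rewrite Z_mod_plus_full.
  + case: h => h ->.
    have -> : theta3 (RtoC (/ 3) * (- / z + ZtoC (4 * c * d)))%C = theta3 (RtoC (/ 3) * (- / z - 2))%C.
      rewrite (@theta3_third_shift _ _ (-2)); last by move: h; intros; Z.to_euclidean_division_equations; lia.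
      by rewrite /ZtoC RtoC_opp.
    have -> : theta3 (RtoC (/ 3) * (z + ZtoC (4 * d * - c)))%C = theta3 (RtoC (/ 3) * (z + 2))%C.
      rewrite (@theta3_third_shift _ _ 2) //.
      have -> : (4 * d * - c - 2 = - (4 * (c * d) + 2))%Z by ring.
      by move: h; intros; Z.to_euclidean_division_equations; lia.
    by rewrite theta3_third_S_minus // -/s; ring.
  + case: h => h ->.
    have -> : theta3 (RtoC (/ 3) * (- / z + ZtoC (4 * c * d)))%C = theta3 (RtoC (/ 3) * (- / z + 2))%C.
      by rewrite (@theta3_third_shift _ _ 2) //; move: h; intros; Z.to_euclidean_division_equations; lia.
    have -> : theta3 (RtoC (/ 3) * (z + ZtoC (4 * d * - c)))%C = theta3 (RtoC (/ 3) * (z - 2))%C.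
      rewrite (@theta3_third_shift _ _ (-2)); first by rewrite /ZtoC RtoC_opp.
      have -> : (4 * d * - c - -2 = - (4 * (c * d) - 2))%Z by ring.
      by move: h; intros; Z.to_euclidean_division_equations; lia.
    by rewrite theta3_third_S // -/s ZtoC_opp; ring.
Qed.

End ThetaGroupLaw.

(** * Multipliers on the theta group *)

Section ThetaLaw.
Local Open Scope R_scope.

Lemma automorphy_im (c d : Z) (z : C) : Im (automorphy c d z) = IZR c * Im z.
Proof. by rewrite /automorphy Im_plus_R im_scal_l. Qed.

Lemma automorphy_neq_0_det (a b c d : Z) (z : C) : (0 < a * d - b * c)%Z -> 0 < Im z ->
  automorphy c d z <> RtoC 0.
Proof.
move=> hdet hz h; have := f_equal Im h; rewrite automorphy_im im_RtoC => hi.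
have c0 : c = 0%Z by apply: eq_IZR; case: (Rmult_integral _ _ hi) => //; lra.
move: h; rewrite /automorphy c0 Cmult_0_l Cplus_0_l => /RtoC_inj /eq_IZR d0.
by move: hdet; rewrite c0 d0; lia.
Qed.

Lemma automorphy_neq_0 (a b c d : Z) (z : C) : (a * d - b * c = 1)%Z -> 0 < Im z ->
  automorphy c d z <> RtoC 0.
Proof. by move=> hdet; apply: (@automorphy_neq_0_det a b); rewrite hdet. Qed.

Lemma mobius_T (a b c d k : Z) (z : C) :
  mobius a (b + k * a) c (d + k * c) z = mobius a b c d (z + ZtoC k)%C.
Proof.
by rewrite /mobius /automorphy !plus_IZR !mult_IZR /ZtoC !RtoC_plus !RtoC_mult; congr Cdiv; ring.
Qed.

Lemma automorphy_T (c d k : Z) (z : C) : automorphy c (d + k * c) z = automorphy c d (z + ZtoC k)%C.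
Proof. by rewrite /automorphy plus_IZR mult_IZR /ZtoC RtoC_plus RtoC_mult; ring. Qed.

Lemma automorphy_S (c d : Z) (z : C) : z <> RtoC 0 -> automorphy d (- c) z = (z * automorphy c d (- / z))%C.
Proof. by move=> hz; rewrite /automorphy opp_IZR RtoC_opp; field. Qed.

Lemma mobius_S (a b c d : Z) (z : C) : (a * d - b * c = 1)%Z -> 0 < Im z ->
  mobius b (- a) d (- c) z = mobius a b c d (- / z)%C.
Proof.
move=> hdet hz; have z0 := upper_neq_0 hz.
have h := automorphy_neq_0 hdet (upper_S hz).
by rewrite /mobius !automorphy_S //; field.
Qed.

(** Continuity and the value of the square determine J up to a global sign; nothing more explicit
    about it is recorded. *)
Definition theta_law (a b c d : Z) : Prop := exists J : C -> C, forall z, 0 < Im z ->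
  [/\ Ccont J z, (J z * J z = delta c d * automorphy c d z)%C,
      theta3 (mobius a b c d z) = (J z * theta3 z)%C,
      theta3 (RtoC 2 * mobius a b c d z) = (J z * G2 c d z)%C &
      theta3 (RtoC 3 * mobius a b c d z) = (J z * (delta c d * H3 c d z))%C].

Lemma opposite_parity_T (c d k : Z) : opposite_parity c d -> opposite_parity c (d + 2 * k * c).
Proof.
by rewrite /opposite_parity; have -> : (d + 2 * k * c = d + 2 * (k * c))%Z by [ring]; rewrite Z.odd_add_mul_2.
Qed.

Lemma theta_law_T (a b c d : Z) (k : Z) : opposite_parity c d ->
  theta_law a b c d -> theta_law a (b + 2 * k * a) c (d + 2 * k * c).
Proof.
move=> hp [J hJ].
have per m z : 0 < Im z -> [/\ delta c (d + 2 * m * c) = delta c d, G2 c d (z + ZtoC (2 * m)) = G2 c (d + 2 * m * c) z &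
    H3 c d (z + ZtoC (2 * m)) = H3 c (d + 2 * m * c) z].
  have step n x : 0 < Im x -> [/\ delta c (d + 2 * (n + 1) * c) = delta c (d + 2 * n * c),
      G2 c (d + 2 * n * c) (x + 2) = G2 c (d + 2 * (n + 1) * c) x &
      H3 c (d + 2 * n * c) (x + 2) = H3 c (d + 2 * (n + 1) * c) x].
    move=> hx; have hpn := opposite_parity_T n hp.
    have -> : (d + 2 * (n + 1) * c = (d + 2 * n * c) + 2 * c)%Z by ring.
    by split; [exact: delta_T | exact: G2_T | exact: H3_T].
  have shift2 n x : (x + ZtoC (2 * (n + 1)) = (x + 2) + ZtoC (2 * n))%C.
    by rewrite /ZtoC; have -> : (2 * (n + 1) = 2 + 2 * n)%Z by [ring]; rewrite plus_IZR RtoC_plus; ring.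
  move: m z; apply: (Z.peano_ind (fun m => forall z, 0 < Im z -> _)).
  - move=> z hz; rewrite !Z.mul_0_r !Z.mul_0_l !Z.add_0_r.
    by have -> : (z + ZtoC 0 = z)%C by rewrite /ZtoC; ring.
  - move=> m IH z hz; have hz2 : 0 < Im (z + 2)%C by rewrite Im_plus_R.
    have [d1 g1 h1] := IH (z + 2)%C hz2; have [d2 g2 h2] := step m z hz.
    by rewrite -Z.add_1_r shift2 d2 g1 g2 h1 h2.
  - move=> m IH z hz; have hz2 : 0 < Im (z - 2)%C by rewrite Im_minus_R.
    have [d1 g1 h1] := IH (z - 2)%C hz2; have [d2 g2 h2] := step (m - 1)%Z (z - 2)%C hz2.
    rewrite -Z.sub_1_r.
    have e : (m - 1 + 1 = m)%Z by ring.
    have e2 : (z - 2 + 2 = z)%C by ring.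
    rewrite e e2 in d2 g2 h2; have := shift2 (m - 1)%Z (z - 2)%C; rewrite e e2 => s2.
    by rewrite -d2 d1 -s2 g1 h1 g2 h2.
exists (fun z => J (z + ZtoC (2 * k))%C) => z hz.
have hz2 : 0 < Im (z + ZtoC (2 * k))%C by rewrite Im_plus_R.
have [h1 h2 h3 h4 h5] := hJ _ hz2; have [e1 e2 e3] := per k z hz.
rewrite mobius_T automorphy_T e1 -e2 -e3; split=> //.
  by apply: (@Ccont_comp J (fun z => z + ZtoC (2 * k))%C) => //; apply: Ccont_shift.
by rewrite h3 theta3_shift.
Qed.

(** The new multiplier is J(-1/z) sqrt(-iz). Its square gains the factor -iz: -i turns [delta c d]
    into [delta d (- c)], and z turns the old automorphy factor into the new one. *)
Lemma theta_law_S (a b c d : Z) : (a * d - b * c = 1)%Z -> opposite_parity c d ->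
  theta_law a b c d -> theta_law b (- a) d (- c).
Proof.
move=> hdet hp [J hJ].
have h3 : ~ ((c mod 3 = 0)%Z /\ (d mod 3 = 0)%Z).
  case=> hc hd; have ec : (c = 3 * (c / 3))%Z by intros; Z.to_euclidean_division_equations; lia.
  have ed : (d = 3 * (d / 3))%Z by intros; Z.to_euclidean_division_equations; lia.
  have : (3 * (a * (d / 3) - b * (c / 3)) = 1)%Z by rewrite -[RHS]hdet {2}ec {2}ed; ring.
  by lia.
exists (fun z => J (- / z) * Csqrt (- Ci * z))%C => z hz.
have z0 := upper_neq_0 hz.
have [h1 h2 h4 h5 h6] := hJ _ (upper_S hz).
rewrite mobius_S //; split.
- apply: Ccont_mult; last exact: Ccont_Csqrt.
  by apply: (@Ccont_comp J (fun z => - / z)%C) => //; apply: Ccont_inv.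
- transitivity ((J (- / z) * J (- / z)) * (Csqrt (- Ci * z) * Csqrt (- Ci * z)))%C; first by ring.
  rewrite h2 Csqrt_sqr; last by apply: slit_Re; rewrite Re_mCi.
  by rewrite delta_S // automorphy_S //; ring.
- by rewrite h4 theta3_S //; ring.
- by rewrite h5 G2_S //; ring.
- by rewrite h6 H3_S // delta_S //; ring.
Qed.

Lemma chi_unit : (chi4 1 = 1 )%Z * (chi4 (-1) = -1)%Z * ((chi8 1 = 1)%Z * (chi8 (-1) = 1)%Z) *
  ((chi3 1 = 1)%Z * (chi3 (-1) = -1)%Z).
Proof. by []. Qed.

Lemma theta_law_upper (a b : Z) : (a * a = 1)%Z -> Z.even b = true -> theta_law a b 0 a.
Proof.
move=> haa hb; have [m hm] : exists m, b = (2 * m)%Z by apply/Z.even_spec.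
have hm1 z : mobius a b 0 a z = (z + RtoC (IZR (2 * (a * m))))%C.
  rewrite /mobius /automorphy Cmult_0_l Cplus_0_l.
  have a0 : RtoC (IZR a) <> RtoC 0.
    by move=> /RtoC_inj /eq_IZR h; rewrite h in haa.
  have e : b = (a * (2 * (a * m)))%Z by rewrite hm; transitivity (2 * m * (a * a))%Z; [rewrite haa; ring | ring].
  by rewrite {1}e mult_IZR RtoC_mult; field.
have cases : a = 1%Z \/ a = (-1)%Z by nia.
exists (fun _ => RtoC 1) => z hz; rewrite hm1; split.
- exact: Ccont_const.
- by case: cases => ->; rewrite /delta /automorphy /ZtoC /= chi_unit; ring.
- by rewrite theta3_shift Cmult_1_l.
- have -> : (RtoC 2 * (z + RtoC (IZR (2 * (a * m)))) = RtoC 2 * z + RtoC (IZR (2 * (2 * (a * m)))))%C.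
    by rewrite (mult_IZR 2 (2 * _)) RtoC_mult; ring.
  by rewrite theta3_shift /G2; case: cases => ->; rewrite /ZtoC /= chi_unit; ring.
- have -> : (RtoC 3 * (z + RtoC (IZR (2 * (a * m)))) = RtoC 3 * z + RtoC (IZR (2 * (3 * (a * m)))))%C.
    by rewrite !(mult_IZR 2) (mult_IZR 3) !RtoC_mult; ring.
  by rewrite theta3_shift /H3 /delta; case: cases => ->; rewrite /ZtoC /= !chi_unit; ring.
Qed.

(** The theta group contains only even translations, so the remainder may be as large as |c|.
    Opposite parity excludes equality, which keeps the descent strict. *)
Lemma even_reduction (c d : Z) : (c <> 0)%Z -> exists k, (Z.abs (d - 2 * k * c) <= Z.abs c)%Z.
Proof.
move=> hc; pose q := ((d + Z.abs c) / (2 * Z.abs c))%Z.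
exists (Z.sgn c * q)%Z.
have e : (Z.sgn c * c = Z.abs c)%Z by case: (c) => [|p|p].
have -> : (2 * (Z.sgn c * q) * c = 2 * q * Z.abs c)%Z by rewrite -e; ring.
have := Z.div_mod (d + Z.abs c) (2 * Z.abs c) ltac:(lia).
have := Z.mod_pos_bound (d + Z.abs c) (2 * Z.abs c) ltac:(lia).
rewrite -/q; nia.
Qed.

Lemma opposite_parity_neq (c d : Z) : opposite_parity c d -> Z.abs c <> Z.abs d.
Proof.
move=> h e; have : Z.odd c = Z.odd d.
  have [-> //|->] : c = d \/ c = (- d)%Z by lia.
  exact: Z.odd_opp.
by rewrite h; case: (Z.odd d).
Qed.

Lemma theta_law_theta_group (a b c d : Z) : (a * d - b * c = 1)%Z -> Z.even (a * b) = true -> Z.even (c * d) = true ->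
  theta_law a b c d.
Proof.
move: {2}(Z.abs_nat c) (leqnn (Z.abs_nat c)) => n.
elim/ltn_ind: n a b c d => n IH a b c d hn hdet hab hcd.
have hp : opposite_parity c d.
  move: (f_equal Z.odd hdet); rewrite Z.odd_sub !Z.odd_mul /opposite_parity.
  move: hcd; rewrite -Z.negb_odd Z.odd_mul.
  by case: (Z.odd a) (Z.odd b) (Z.odd c) (Z.odd d) => -[] [] [].
case: (Z.eq_dec c 0) => hc.
  rewrite hc in hdet hab *.
  have had : (a * d = 1)%Z by rewrite -hdet; ring.
  have ha1 := Z.eq_mul_1 _ _ had.
  have ha : a = d by case: ha1 had => ->; lia.
  rewrite -ha; apply: theta_law_upper; first by rewrite {2}ha.
  by move: hab; rewrite Z.even_mul => /orP [h|//]; exfalso; move: h; case: ha1 => ->.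
have [k hk] := even_reduction d hc.
have hp' := opposite_parity_T (- k) hp.
have ed : (d + 2 * - k * c = d - 2 * k * c)%Z by ring.
rewrite ed in hp'.
have neq := opposite_parity_neq hp'.
pose d' := (d - 2 * k * c)%Z; pose b' := (b - 2 * k * a)%Z.
have hdet' : (a * d' - b' * c = 1)%Z by rewrite -hdet /d' /b'; ring.
(* The reduced matrix arises by one inversion step from the matrix with bottom row (-d', c), whose
   lower left entry is smaller. *)
have hlaw : theta_law (- b') a (- d') c.
  apply: (IH (Z.abs_nat d')).
  - by apply: leq_trans hn; apply/ltP; rewrite -/d' in hk neq; lia.
  - by apply/leP; lia.
  - by rewrite -hdet'; ring.
  - have -> : (- b' * a = - (a * b) + 2 * (k * a * a))%Z by rewrite /b'; ring.
    by rewrite Z.even_add_mul_2 Z.even_opp.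
  - have -> : (- d' * c = - (c * d) + 2 * (k * c * c))%Z by rewrite /d'; ring.
    by rewrite Z.even_add_mul_2 Z.even_opp.
have hp2 : opposite_parity (- d') c.
  by move: hp'; rewrite /opposite_parity -/d' Z.odd_opp => ->; rewrite negbK.
have := theta_law_S _ hp2 hlaw.
have -> : (- - b' = b')%Z by ring.
have -> : (- - d' = d')%Z by ring.
move=> h; have {}h := h ltac:(rewrite -hdet'; ring).
have := theta_law_T k hp' h.
have -> : (b' + 2 * k * a = b)%Z by rewrite /b'; ring.
by have -> : (d' + 2 * k * c = d)%Z by rewrite /d'; ring.
Qed.

End ThetaLaw.

(** * One multiplier for all multiples 2^i 3^j of the argument *)

Section MultipleLaw.
Local Open Scope R_scope.

Lemma Ccont_path (f : C -> C) (z h : C) (t : R) : Ccont f (z + RtoC t * h)%C ->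
  continuity_pt (fun t => Re (f (z + RtoC t * h)%C)) t.
Proof.
move=> hf eps he; have [del [d0 H]] := hf eps he.
have h0 := Cmod_ge_0 h.
exists (del / (Cmod h + 1)); split; first by apply: Rdiv_lt_0_compat; lra.
move=> x [_]; rewrite /= /Rdist => hx.
rewrite -[Rminus _ _]/(Re (f (z + RtoC x * h)%C) + - Re (f (z + RtoC t * h)%C)) -re_opp -re_plus.
apply: Rle_lt_trans (re_le_Cmod _) _; apply: H.
have -> : (z + RtoC x * h - (z + RtoC t * h) = RtoC (x - t) * h)%C by rewrite RtoC_minus; ring.
rewrite Cmod_mult Cmod_R.
have : Rabs (x - t) * (Cmod h + 1) < del.
  by apply: (Rmult_lt_reg_r (/ (Cmod h + 1))); [apply: Rinv_0_lt_compat; lra | field_simplify; lra].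
have := Rabs_pos (x - t); nra.
Qed.

(* [Re (f * Cconj g)] is [+-|g|^2], hence never 0 on the segment from [z1] to [z]. *)
Lemma square_root_rigidity (f g : C -> C) (z1 : C) :
  (forall z, 0 < Im z -> Ccont f z) -> (forall z, 0 < Im z -> Ccont g z) ->
  (forall z, 0 < Im z -> (f z * f z = g z * g z)%C) -> (forall z, 0 < Im z -> g z <> RtoC 0) ->
  0 < Im z1 -> f z1 = g z1 -> forall z, 0 < Im z -> f z = g z.
Proof.
move=> cf cg hsq hg hz1 e1 z hz.
case: (sqr_eq_C (hsq z hz)) => // e.
pose q x := (f x * Cconj (g x))%C.
pose phi t := - Re (q (z1 + RtoC t * (z - z1))%C).
have up t : 0 <= t <= 1 -> 0 < Im (z1 + RtoC t * (z - z1))%C.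
  by rewrite im_plus im_scal_l Im_minus; nra.
have gg x : 0 < Im x -> 0 < Cmod (g x) ^ 2.
  by move=> hx; apply: pow_lt; apply/Cmod_gt_0; apply: hg.
have cq x : 0 < Im x -> Ccont q x.
  move=> hx; apply: Ccont_mult; first exact: cf.
  move=> eps he; have [del [d0 H]] := cg x hx eps he; exists del; split=> // x' /H.
  by rewrite -Cminus_conj Cmod_conj.
have re_gg x : Re (g x * Cconj (g x))%C = Cmod (g x) ^ 2 by rewrite -Cmod2_conj re_RtoC.
have p0 : (z1 + RtoC 0 * (z - z1) = z1)%C by ring.
have p1 : (z1 + RtoC 1 * (z - z1) = z)%C by ring.
have [||||t [ht]] := IVT_interv phi 0 1.
- move=> t ht; apply: (continuity_pt_opp (fun t => Re (q (z1 + RtoC t * (z - z1))%C))).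
  by apply: Ccont_path; apply: cq; apply: up.
- lra.
- by rewrite /phi p0 /q e1 re_gg; have := gg z1 hz1; lra.
- rewrite /phi p1 /q e.
  have -> : (- g z * Cconj (g z) = - (g z * Cconj (g z)))%C by ring.
  by rewrite re_opp re_gg; have := gg z hz; lra.
rewrite /phi /q => h; exfalso.
have hu := up t ht; set x := (z1 + _)%C in hu h.
have := gg x hu; have := re_gg x.
case: (sqr_eq_C (hsq x hu)) => e2; rewrite e2 in h; first by lra.
move: h; have -> : (- g x * Cconj (g x) = - (g x * Cconj (g x)))%C by ring.
by rewrite re_opp; lra.
Qed.

(** On integers prime to 6 this is the symbol (12/.), the quadratic character of 3. It arises from
    [theta3 (3 z)], whose companion formula contributes [delta] = [chi4] and [H3], which carries
    [chi3]. *)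
Definition chi12 (d : Z) : Z := (chi4 d * chi3 d)%Z.

Lemma chi_sqr (d : Z) : (chi4 d * chi4 d = 1)%Z /\ (chi8 d * chi8 d = 1)%Z /\ (chi3 d * chi3 d = 1)%Z.
Proof. by rewrite /chi4 /chi8 /chi3; do !case: ifP. Qed.

Lemma chi12_sqr (d : Z) : (chi12 d * chi12 d = 1)%Z.
Proof. by have [h4 [_ h3]] := chi_sqr d; rewrite /chi12; nia. Qed.

Lemma mobius_scal (a b c d n : Z) (z : C) : (n <> 0)%Z -> (n | c)%Z ->
  mobius a (n * b) (c / n) d (ZtoC n * z)%C = (ZtoC n * mobius a b c d z)%C /\
  automorphy (c / n) d (ZtoC n * z)%C = automorphy c d z.
Proof.
move=> hn [q hq].
have e : (c / n = q)%Z by rewrite hq Z.div_mul.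
have h : automorphy (c / n) d (ZtoC n * z)%C = automorphy c d z.
  by rewrite e hq /automorphy /ZtoC mult_IZR RtoC_mult; ring.
split=> //; rewrite /mobius h /automorphy /ZtoC mult_IZR RtoC_mult /Cdiv; ring.
Qed.

(* [n = 2^i 3^j] is reached one prime at a time: applying [theta_law] to (a, n b; c / n, d) at [n z] gives
   a second multiplier with the same square, which [square_root_rigidity] compares with [J]. *)
Lemma theta3_multiple (a b c d : Z) : (a * d - b * c = 1)%Z -> Z.even b = true -> Z.even c = true ->
  exists J : C -> C, forall z, 0 < Im z ->
    (J z * J z = ZtoC (chi4 d) * automorphy c d z)%C /\
    forall i j : nat, let n := (2 ^ Z.of_nat i * 3 ^ Z.of_nat j)%Z in (2 * n | c)%Z ->
    theta3 (ZtoC n * mobius a b c d z) =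
      (J z * ZtoC (chi8 d ^ Z.of_nat i * chi12 d ^ Z.of_nat j) * theta3 (ZtoC n * z))%C.
Proof.
move=> hdet hb hc.
have hd : Z.odd d = true.
  move: (f_equal Z.odd hdet); rewrite Z.odd_sub !Z.odd_mul -(Z.negb_even b) hb.
  by case: (Z.odd a) (Z.odd c) (Z.odd d) => -[] [].
have law n : (n <> 0)%Z -> (2 * n | c)%Z -> theta_law a (n * b) (c / n) d.
  move=> hn [q hq]; have e : (c / n = 2 * q)%Z by rewrite hq Z.mul_assoc Z.div_mul //; ring.
  apply: theta_law_theta_group.
  - by rewrite -hdet e hq; ring.
  - by rewrite !Z.even_mul hb !orbT.
  - by rewrite e !Z.even_mul.
have dE x : delta x d = ZtoC (chi4 d) by rewrite /delta hd.
have [J hJ] : theta_law a b c d.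
  by apply: theta_law_theta_group => //; rewrite Z.even_mul ?hb ?hc // orbT.
exists J => z hz; split; first by have [_ h _ _ _] := hJ z hz; rewrite h dE.
have Jn0 x : 0 < Im x -> J x <> RtoC 0.
  move=> hx h0; have [_ h _ _ _] := hJ x hx; move: h; rewrite h0 Cmult_0_l dE => h.
  have [h4 _] := chi_sqr d.
  have c4 : ZtoC (chi4 d) <> RtoC 0 by move=> /RtoC_inj /eq_IZR h5; rewrite h5 in h4.
  by apply: (Cmult_neq_0 _ _ c4 (automorphy_neq_0 hdet hx)).
pose Q n x := forall y, 0 < Im y -> theta3 (ZtoC n * mobius a b c d y) = (J y * ZtoC x * theta3 (ZtoC n * y))%C.
have step n x : (1 <= n)%Z -> (x * x = 1)%Z -> (2 * n | c)%Z -> Q n x ->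
    ((4 * n | c)%Z -> Q (2 * n)%Z (chi8 d * x)%Z) /\ ((6 * n | c)%Z -> Q (3 * n)%Z (chi12 d * x)%Z).
  move=> hn hx hnc hQ.
  have hn0 : (n <> 0)%Z by lia.
  have hnc1 : (n | c)%Z by case: hnc => q ->; exists (2 * q)%Z; ring.
  have n1 : 1 <= IZR n by apply: IZR_le.
  have [J' hJ'] := law n hn0 hnc.
  have up y : 0 < Im y -> 0 < Im (ZtoC n * y)%C by apply: Im_scal; lra.
  have rig : forall y, 0 < Im y -> J' (ZtoC n * y)%C = (J y * ZtoC x)%C.
    apply: (@square_root_rigidity (fun y => J' (ZtoC n * y)%C) (fun y => J y * ZtoC x)%C Ci).
    - move=> y hy; have [h _ _ _ _] := hJ' _ (up y hy).
      apply: (@Ccont_comp J' (fun y => ZtoC n * y)%C) => //.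
      by apply: Ccont_mult; [exact: Ccont_const | exact: Ccont_id].
    - move=> y hy; have [h _ _ _ _] := hJ y hy.
      by apply: Ccont_mult => //; exact: Ccont_const.
    - move=> y hy; have [_ h _ _ _] := hJ' _ (up y hy); have [_ h' _ _ _] := hJ y hy.
      rewrite h (proj2 (mobius_scal _ _ _ _ hn0 hnc1)) // dE.
      transitivity ((J y * J y) * ZtoC (x * x))%C; last by rewrite ZtoC_mult; ring.
      by rewrite h' hx dE /ZtoC; ring.
    - move=> y hy; apply: Cmult_neq_0; first exact: Jn0.
      by move=> /RtoC_inj /eq_IZR h0; rewrite h0 in hx.
    - by rewrite /=; lra.
    (* At i both candidates carry [theta3 (n i)], nonzero as n >= 1, to the same value: J' by its
       own law, J by the induction hypothesis [hQ]. *)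
    have hi : 0 < Im Ci by rewrite /=; lra.
    have t0 : theta3 (ZtoC n * Ci) <> RtoC 0.
      by apply: theta3_neq_0; rewrite im_scal_l /=; lra.
    have [_ _ h _ _] := hJ' _ (up _ hi); move: h.
    rewrite (proj1 (mobius_scal _ _ _ _ hn0 hnc1)) (hQ _ hi) => h.
    transitivity ((J' (ZtoC n * Ci) * theta3 (ZtoC n * Ci)) / theta3 (ZtoC n * Ci))%C; first by field.
    by rewrite -h; field.
  have cn m : (m * n | c)%Z -> (m <> 0)%Z -> ((c / n) mod m = 0)%Z.
    by case=> q -> hm; rewrite Z.mul_assoc Z.div_mul // Z_mod_mult.
  split=> h4 y hy; have [_ _ _ h2 h3] := hJ' _ (up y hy); move: h2 h3;
    rewrite (proj1 (mobius_scal _ _ _ _ hn0 hnc1)) rig //.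
  - move=> + _; rewrite /G2 hd (cn 4%Z) // /= !Cmult_assoc -!(ZtoC_mult 2) => ->.
    by rewrite !ZtoC_mult; ring.
  - have c3 : ((c / n) mod 3 = 0)%Z.
      by apply: cn => //; case: h4 => q ->; exists (2 * q)%Z; ring.
    move=> _; rewrite /H3 dE c3 /= !Cmult_assoc -!(ZtoC_mult 3) => ->.
    by rewrite !ZtoC_mult; ring.
have chi12_sqr := chi12_sqr d.
have [_ [chi8_sqr _]] := chi_sqr d.
have pow_sqr x (i : nat) : (x * x = 1 -> x ^ Z.of_nat i * x ^ Z.of_nat i = 1)%Z.
  by move=> h; rewrite -Z.pow_mul_l h Z.pow_1_l; lia.
suff main (i j : nat) : (2 * (2 ^ Z.of_nat i * 3 ^ Z.of_nat j) | c)%Z ->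
    Q (2 ^ Z.of_nat i * 3 ^ Z.of_nat j)%Z (chi8 d ^ Z.of_nat i * chi12 d ^ Z.of_nat j)%Z.
  by move=> i j n hn; apply: main.
have pos (i' j' : nat) : (1 <= 2 ^ Z.of_nat i' * 3 ^ Z.of_nat j')%Z.
  by have := Z.pow_pos_nonneg 2 (Z.of_nat i'); have := Z.pow_pos_nonneg 3 (Z.of_nat j'); nia.
have sqr (i' j' : nat) : (chi8 d ^ Z.of_nat i' * chi12 d ^ Z.of_nat j' * (chi8 d ^ Z.of_nat i' * chi12 d ^ Z.of_nat j') = 1)%Z.
  transitivity ((chi8 d ^ Z.of_nat i' * chi8 d ^ Z.of_nat i') * (chi12 d ^ Z.of_nat j' * chi12 d ^ Z.of_nat j'))%Z; first by ring.
  by rewrite !pow_sqr.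
elim: i => [|i IHi].
  elim: j => [|j IHj] hn.
    move=> y hy; rewrite /= /ZtoC !Cmult_1_l Cmult_1_r.
    by have [_ _ -> _ _] := hJ y hy.
  rewrite Nat2Z.inj_succ !Z.pow_succ_r; try lia.
  rewrite Nat2Z.inj_succ Z.pow_succ_r in hn; last by lia.
  have hn' : (2 * (2 ^ Z.of_nat 0 * 3 ^ Z.of_nat j) | c)%Z.
    by case: hn => q ->; exists (3 * q)%Z; ring.
  have [_ h] := step _ _ (pos 0%nat j) (sqr 0%nat j) hn' (IHj hn').
  have -> : (2 ^ Z.of_nat 0 * (3 * 3 ^ Z.of_nat j) = 3 * (2 ^ Z.of_nat 0 * 3 ^ Z.of_nat j))%Z by ring.
  have -> : (chi8 d ^ Z.of_nat 0 * (chi12 d * chi12 d ^ Z.of_nat j) = chi12 d * (chi8 d ^ Z.of_nat 0 * chi12 d ^ Z.of_nat j))%Z by ring.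
  by apply: h; case: hn => q ->; exists q; ring.
move=> hn; rewrite Nat2Z.inj_succ !Z.pow_succ_r; try lia.
rewrite Nat2Z.inj_succ Z.pow_succ_r in hn; last by lia.
have hn' : (2 * (2 ^ Z.of_nat i * 3 ^ Z.of_nat j) | c)%Z.
  by case: hn => q ->; exists (2 * q)%Z; ring.
have [h _] := step _ _ (pos i j) (sqr i j) hn' (IHi hn').
have -> : (2 * 2 ^ Z.of_nat i * 3 ^ Z.of_nat j = 2 * (2 ^ Z.of_nat i * 3 ^ Z.of_nat j))%Z by ring.
have -> : (chi8 d * chi8 d ^ Z.of_nat i * chi12 d ^ Z.of_nat j = chi8 d * (chi8 d ^ Z.of_nat i * chi12 d ^ Z.of_nat j))%Z by ring.
by apply: h; case: hn => q ->; exists q; ring.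
Qed.

End MultipleLaw.

(** * Theta expressions for the generating functions; the action of Gamma_0(3) on [calF] *)

Section GeneratingFunctions.
Local Open Scope R_scope.

Lemma theta_theta3 (t : C) : theta t = theta3 (RtoC 2 * t).
Proof. by apply: Zseries_ext => n; rewrite qpow_qexp qexp_scal Rmult_comm. Qed.

Lemma dominated_theta2 (z : C) : 0 < Im z -> exists K,
  dominated K (fun n => qexp (IZR ((2 * n + 1) * (2 * n + 1)) / 4) z).
Proof.
move=> hz; have h4 : 0 < Im (RtoC (/ 4) * z)%C by apply: Im_scal => //; lra.
have d := dominated_double 1 (dominated_qexp h4); eexists.
by apply: dominated_ext d => n; rewrite qexp_scal.
Qed.

(** n(n + 1)/2 + 1/8 = (2n + 1)^2/8, and n and -n - 1 give the same odd square, hence the factor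
    1/2. *)
Lemma Psi_theta2 (t : C) : 0 < Im t -> (qpow t (1 / 8) * Psi t)%C = (RtoC (/ 2) * theta2 t)%C.
Proof.
move=> ht; rewrite (theta2_series ht) /Zseries.
have [K d] := dominated_theta2 ht.
have [d1 _] := dominated_nat d.
set f := fun n : Z => qexp (IZR ((2 * n + 1) * (2 * n + 1)) / 4) t.
have -> : Cseries (fun n => f (- Z.of_nat n.+1)%Z) = Cseries (fun n => f (Z.of_nat n)).
  have e n : f (- Z.of_nat n.+1)%Z = f (Z.of_nat n) by rewrite /f; congr (qexp (IZR _ / 4) t); lia.
  by rewrite /Cseries; congr pair; apply: Series_ext => n; rewrite e.
have c0 (x : C) : (RtoC (/ 2) * (x + x) = x)%C.
  by transitivity (RtoC (/ 2) * RtoC 2 * x)%C; [ring | rewrite -RtoC_mult Rinv_l; [ring | lra]].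
rewrite c0.
have q0 : qpow t (1 / 8) <> RtoC 0 by apply: Cexp_neq_0.
have fE (n : nat) : f (Z.of_nat n) = (qpow t (1 / 8) * qpow t (INR n * (INR n + 1) / 2))%C.
  rewrite !qpow_qexp -qexp_addl /f; congr qexp.
  by rewrite !(plus_IZR, mult_IZR) -INR_IZR_INZ; field.
apply: Clim_unique (Cseries_lim d1).
have hP : Clim (Csum (fun n => qpow t (INR n * (INR n + 1) / 2))) (Psi t).
  apply: (@Cseries_lim _ (Cmod (/ qpow t (1 / 8)) * K)) => n.
  have -> : qpow t (INR n * (INR n + 1) / 2) = (/ qpow t (1 / 8) * f (Z.of_nat n))%C by rewrite fE; field.
  by rewrite Cmod_mult Rmult_assoc; apply: Rmult_le_compat_l (d1 n); apply: Cmod_ge_0.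
apply: Clim_ext (Clim_scal (qpow t (1 / 8)) hP) => N.
by rewrite -Csum_scal; apply: Csum_ext => n _; rewrite -fE.
Qed.

(** m^2 + mn + n^2 = (n + m/2)^2 + 3m^2/4: the parity of m decides whether n + m/2 runs over
    integers or half-integers. *)
Lemma calF_inner (t : C) (m : Z) : 0 < Im t ->
  Zseries (fun n => qpow t (IZR (m * m + m * n + n * n))) =
  (qexp (IZR (m * m)) (RtoC (3 / 2) * t) * (if Z.even m then theta3 (RtoC 2 * t) else theta2 (RtoC 2 * t)))%C.
Proof.
move=> ht; have h2 : 0 < Im (RtoC 2 * t)%C by apply: Im_scal => //; lra.
case: (Z.Even_or_Odd m) => [[k ->]|[k ->]].
  have -> : Z.even (2 * k) = true by rewrite Z.even_mul.
  have d := dominated_qexp h2.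
  rewrite /theta3 -(Zseries_shift k d) -(Zseries_scal _ (dominated_shift k d)).
  apply: Zseries_ext => n; rewrite !qexp_scal qpow_qexp -qexp_addl; congr qexp.
  by rewrite !(plus_IZR, mult_IZR); field.
have -> : Z.even (2 * k + 1) = false by rewrite Z.add_1_r Z.even_succ Z.odd_mul.
have [K d] := dominated_theta2 h2.
rewrite (theta2_series h2) -(Zseries_shift k d) -(Zseries_scal _ (dominated_shift k d)).
apply: Zseries_ext => n; rewrite !qexp_scal qpow_qexp -qexp_addl; congr qexp.
by rewrite !(plus_IZR, mult_IZR); field.
Qed.

Lemma calF_theta (t : C) : 0 < Im t ->
  calF t = (theta3 (RtoC 2 * t) * theta3 (RtoC 6 * t) + theta2 (RtoC 2 * t) * theta2 (RtoC 6 * t))%C.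
Proof.
move=> ht.
have h32 : 0 < Im (RtoC (3 / 2) * t)%C by apply: Im_scal => //; lra.
have h6 : 0 < Im (RtoC 6 * t)%C by apply: Im_scal => //; lra.
set A := theta3 (RtoC 2 * t); set B := theta2 (RtoC 2 * t).
have a0 := Cmod_ge_0 A; have b0 := Cmod_ge_0 B.
have d : dominated ((Cmod A + Cmod B) * gauss_const (PI * Im (RtoC (3 / 2) * t)%C) 0 0)
    (fun m => (if Z.even m then A else B) * qexp (IZR (m * m)) (RtoC (3 / 2) * t))%C.
  move=> m; rewrite Cmod_mult Rmult_assoc; apply: Rmult_le_compat; try exact: Cmod_ge_0.
    by case: Z.even; lra.
  exact: dominated_qexp.
have -> : calF t = Zseries (fun m => (if Z.even m then A else B) * qexp (IZR (m * m)) (RtoC (3 / 2) * t))%C.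
  by apply: Zseries_ext => m; rewrite calF_inner // Cmult_comm.
rewrite (Zseries_parity d); congr Cplus.
  rewrite /theta3 -(Zseries_scal A (dominated_qexp h6)); apply: Zseries_ext => m.
  have -> : Z.even (2 * m) = true by rewrite Z.even_mul.
  rewrite !qexp_scal; congr (_ * qexp _ _)%C.
  by rewrite !mult_IZR; field.
have [K d'] := dominated_theta2 h6.
rewrite (theta2_series h6) -(Zseries_scal B d'); apply: Zseries_ext => m.
have -> : Z.even (2 * m + 1) = false by rewrite Z.add_1_r Z.even_succ Z.odd_mul.
by rewrite !qexp_scal; congr (_ * qexp _ _)%C; field.
Qed.

Lemma calF_T (t : C) (k : Z) : calF (t + ZtoC k) = calF t.
Proof.
apply: Zseries_ext => m; apply: Zseries_ext => n; rewrite !qpow_qexp qexp_addr qexp_RtoC.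
set q := (m * m + m * n + n * n)%Z.
have -> : 2 * IZR q * IZR k / 2 = IZR (q * k) by rewrite mult_IZR; field.
by rewrite turn_Z Cmult_1_r.
Qed.

Lemma theta3_quarter (z : C) : theta3 (RtoC (/ 4) * z) = (theta3 z + theta2 z)%C.
Proof. by rewrite /theta2; ring. Qed.

Lemma theta4_quarter (z : C) : 0 < Im z -> theta4 (RtoC (/ 4) * z) = (theta3 z - theta2 z)%C.
Proof.
move=> hz; rewrite theta4_alt; last by apply: Im_scal => //; lra.
have -> : (RtoC 4 * (RtoC (/ 4) * z) = z)%C by rewrite Cmult_assoc -RtoC_mult Rinv_r ?Cmult_1_l //; lra.
by rewrite /theta2; ring.
Qed.

(** The inversion lands on quarter arguments, where [theta3] and [theta4] are A + B and A - B. In (A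
    + B)(D + E) + (A - B)(D - E) the cross terms cancel, and the two square roots combine to -i
    sqrt(3) t/2. *)
Lemma calF_W (t : C) : 0 < Im t -> calF (RtoC (/ 3) * - / t) = (- Ci * RtoC (sqrt 3) * t * calF t)%C.
Proof.
move=> ht.
have h2 : 0 < Im (RtoC 2 * t)%C by apply: Im_scal => //; lra.
have h6 : 0 < Im (RtoC 6 * t)%C by apply: Im_scal => //; lra.
rewrite calF_theta; last by apply: Im_scal; [lra | exact: upper_S].
rewrite (calF_theta ht) !Cmult_assoc -!RtoC_mult.
have r1 : 0 < 2 * / 3 by lra.
have r2 : 0 < 6 * / 3 by lra.
rewrite (theta3_scal_S r1) // (theta3_scal_S r2) // (theta2_scal_S r1) // (theta2_scal_S r2) //.
have -> : (RtoC (/ (2 * / 3)) * t = RtoC (/ 4) * (RtoC 6 * t))%C by rewrite Cmult_assoc -RtoC_mult; congr (RtoC _ * _)%C; field.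
have -> : (RtoC (/ (6 * / 3)) * t = RtoC (/ 4) * (RtoC 2 * t))%C by rewrite Cmult_assoc -RtoC_mult; congr (RtoC _ * _)%C; field.
rewrite !theta3_quarter !theta4_quarter //.
set s := Csqrt _; set A := theta3 _; set B := theta2 _; set D := theta3 _; set E := theta2 _.
have ss : (s * s = - Ci * t)%C by apply: Csqrt_sqr; apply: slit_Re; rewrite Re_mCi.
have k : / sqrt (2 * / 3) * / sqrt (6 * / 3) = sqrt 3 / 2.
  rewrite -Rinv_mult -sqrt_mult; try lra.
  have -> : 2 * / 3 * (6 * / 3) = (2 * 2) / 3 by field.
  rewrite sqrt_div; try lra.
  rewrite sqrt_square; try lra.
  by field; apply/Rgt_not_eq/sqrt_lt_R0; lra.
transitivity (RtoC (/ sqrt (2 * / 3) * / sqrt (6 * / 3)) * (s * s) * ((A + B) * (D + E) + (A - B) * (D - E)))%C.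
  by rewrite RtoC_mult; ring.
rewrite k ss /Rdiv RtoC_mult.
transitivity ((RtoC (/ 2) * RtoC 2) * (- Ci * RtoC (sqrt 3) * t * (D * A + E * B)))%C; first by ring.
by rewrite -RtoC_mult Rinv_l; [ring | lra].
Qed.

Lemma automorphy_1_neq_0 (c : Z) (t : C) : 0 < Im t -> automorphy c 1 t <> RtoC 0.
Proof. by move=> ht; apply: (@automorphy_neq_0 1 0 c 1 t) => //; ring. Qed.

(** The lower unipotent matrix (1, 0; 3k, 1) is the translation by -k conjugated by t -> -1/(3t). *)
Lemma calF_U (t : C) (k : Z) : 0 < Im t ->
  calF (t / automorphy (3 * k) 1 t) = (automorphy (3 * k) 1 t * calF t)%C.
Proof.
move=> ht; have t0 := upper_neq_0 ht; have a0 := @automorphy_1_neq_0 (3 * k)%Z t ht.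
have three : RtoC 3 <> RtoC 0 by move=> /RtoC_inj; lra.
pose r := (RtoC (/ 3) * - / t + ZtoC (- k))%C.
have hr : 0 < Im r by rewrite Im_plus_R; apply: Im_scal; [lra | exact: upper_S].
have r0 := upper_neq_0 hr.
have rt : (RtoC 3 * r * t = - automorphy (3 * k) 1 t)%C.
  by rewrite /r /automorphy ZtoC_opp /ZtoC mult_IZR RtoC_mult RtoC_inv; [field | lra].
have -> : (t / automorphy (3 * k) 1 t = RtoC (/ 3) * - / r)%C.
  have -> : automorphy (3 * k) 1 t = (- (RtoC 3 * r * t))%C by rewrite rt; ring.
  by rewrite RtoC_inv; [field | lra].
rewrite calF_W // /r calF_T calF_W // -/r.
have s3 : (RtoC (sqrt 3) * RtoC (sqrt 3) = 3)%C by rewrite -RtoC_mult sqrt_sqrt //; lra.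
transitivity ((Ci * Ci) * (RtoC (sqrt 3) * RtoC (sqrt 3)) * r * t * calF t)%C; first by ring.
rewrite s3 Ci_sqr; have -> : (- 1 * 3 * r * t = - (RtoC 3 * r * t))%C by ring.
by rewrite rt; ring.
Qed.

Definition calF_law (a b c d : Z) : Prop := forall t, 0 < Im t ->
  calF (mobius a b c d t) = (ZtoC (chi3 d) * automorphy c d t * calF t)%C.

Lemma calF_law_T (a b c d k : Z) : (3 | c)%Z ->
  calF_law a b c d -> calF_law a (b + k * a) c (d + k * c).
Proof.
move=> [q hq] h t ht; have ht2 : 0 < Im (t + ZtoC k)%C by rewrite Im_plus_R.
rewrite mobius_T automorphy_T h // calF_T.
have -> // : chi3 (d + k * c) = chi3 d.
by rewrite /chi3 hq; have -> : (d + k * (q * 3) = d + (k * q) * 3)%Z by [ring]; rewrite Z_mod_plus_full.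
Qed.

Lemma Im_mobius_det (a b c d : Z) (z : C) : (0 < a * d - b * c)%Z -> 0 < Im z ->
  Im (mobius a b c d z) = IZR (a * d - b * c) * Im z / Cmod (automorphy c d z) ^ 2.
Proof.
move=> hdet hz; have a0 := automorphy_neq_0_det hdet hz.
have m0 : Cmod (automorphy c d z) ^ 2 <> 0.
  by apply: pow_nonzero; have := proj1 (Cmod_gt_0 _) a0; lra.
have -> : mobius a b c d z = (automorphy a b z * Cconj (automorphy c d z) * RtoC (/ Cmod (automorphy c d z) ^ 2))%C.
  rewrite RtoC_inv // Cmod2_conj /mobius.
  by field; split=> // h; apply: a0; rewrite -(Cconj_conj (automorphy c d z)) h /Cconj /=; congr pair; ring.
rewrite im_scal_r im_mult re_conj im_conj !automorphy_im /automorphy !re_plus !re_scal_l !re_RtoC /Rdiv; congr Rmult.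
by rewrite minus_IZR !mult_IZR; ring.
Qed.

Lemma upper_mobius_det (a b c d : Z) (z : C) : (0 < a * d - b * c)%Z -> 0 < Im z ->
  0 < Im (mobius a b c d z).
Proof.
move=> hdet hz; rewrite Im_mobius_det //; apply: Rdiv_lt_0_compat.
  by apply: Rmult_lt_0_compat => //; apply: IZR_lt.
by apply: pow_lt; apply/Cmod_gt_0; apply: automorphy_neq_0_det hdet hz.
Qed.

Lemma upper_mobius (a b c d : Z) (z : C) : (a * d - b * c = 1)%Z -> 0 < Im z ->
  0 < Im (mobius a b c d z).
Proof. by move=> hdet; apply: upper_mobius_det; rewrite hdet. Qed.

Lemma calF_law_U (a b c d k : Z) : (a * d - b * c = 1)%Z ->
  calF_law a b c d -> calF_law (a + 3 * k * b) b (c + 3 * k * d) d.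
Proof.
move=> hdet h t ht; have a0 := @automorphy_1_neq_0 (3 * k)%Z t ht.
set u := (t / automorphy (3 * k) 1 t)%C.
have mul x y : automorphy (x + 3 * k * y) y t = (automorphy x y u * automorphy (3 * k) 1 t)%C.
  rewrite /u; move: a0; rewrite {2 4}/automorphy => a0; rewrite /automorphy.
  rewrite plus_IZR (mult_IZR _ y) RtoC_plus (RtoC_mult _ (IZR y)).
  by field.
have hu : 0 < Im u.
  have -> : u = mobius 1 0 (3 * k) 1 t by rewrite /u /mobius {2}/automorphy Cmult_1_l Cplus_0_r.
  by apply: upper_mobius => //; ring.
have m0 := automorphy_neq_0 hdet hu.
rewrite /mobius !mul.
have -> : (automorphy a b u * automorphy (3 * k) 1 t / (automorphy c d u * automorphy (3 * k) 1 t) = mobius a b c d u)%C.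
  by rewrite /mobius; field.
by rewrite h // calF_U //; ring.
Qed.

Lemma nearest_multiple (c d : Z) : (c <> 0)%Z -> exists k, (2 * Z.abs (d + k * c) <= Z.abs c)%Z.
Proof.
move=> hc; pose q := ((2 * d + Z.abs c) / (2 * Z.abs c))%Z.
exists (- (Z.sgn c * q))%Z.
have e : (Z.sgn c * c = Z.abs c)%Z by case: (c) => [|p|p].
have -> : (d + - (Z.sgn c * q) * c = d - q * Z.abs c)%Z by rewrite -e; ring.
have := Z.div_mod (2 * d + Z.abs c) (2 * Z.abs c) ltac:(lia).
have := Z.mod_pos_bound (2 * d + Z.abs c) (2 * Z.abs c) ltac:(lia).
rewrite -/q; nia.
Qed.

(** Reducing d modulo c and then c modulo 3d' by nearest remainders gives |c'| <= 3|d'|/2 <= 3|c|/4.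
    Nonnegative remainders would not guarantee a descent, the second modulus being 3d'. Since 3
    divides c, d' cannot be 0. *)
Lemma calF_law_Gamma0_3 (a b c d : Z) : (a * d - b * c = 1)%Z -> (3 | c)%Z -> calF_law a b c d.
Proof.
move: {2}(Z.abs_nat c) (leqnn (Z.abs_nat c)) => n.
elim/ltn_ind: n a b c d => n IH a b c d hn hdet h3.
case: (Z.eq_dec c 0) => hc.
  rewrite hc in hdet *; have had : (a * d = 1)%Z by rewrite -hdet; ring.
  have [ha1|ha1] := Z.eq_mul_1 _ _ had; rewrite ha1 in had *; move=> t ht.
    have -> : d = 1%Z by lia.
    have -> : mobius 1 b 0 1 t = (t + ZtoC b)%C by rewrite /mobius /automorphy /ZtoC; field.
    by rewrite calF_T /automorphy /ZtoC /= chi_unit; ring.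
  have -> : d = (-1)%Z by lia.
  have -> : mobius (-1) b 0 (-1) t = (t + ZtoC (- b))%C.
    by rewrite /mobius /automorphy /ZtoC (opp_IZR b) RtoC_opp; field.
  by rewrite calF_T /automorphy /ZtoC /= chi_unit; ring.
have [k hk] := nearest_multiple d hc.
set d' := (d + k * c)%Z in hk; pose b' := (b + k * a)%Z.
have hdet' : (a * d' - b' * c = 1)%Z by rewrite -hdet /d' /b'; ring.
have d0 : (d' <> 0)%Z.
  by move=> h; case: h3 => q hq; move: hdet'; rewrite h hq; lia.
have d0' : (3 * d' <> 0)%Z by lia.
have [l hl] := nearest_multiple c d0'.
set c' := (c + l * (3 * d'))%Z in hl; pose a' := (a + 3 * l * b')%Z.
have c'E : (c' = c + 3 * l * d')%Z by rewrite /c'; ring.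
have hdet2 : (a' * d' - b' * c' = 1)%Z by rewrite -hdet' /a' c'E; ring.
have law : calF_law a' b' c' d'.
  apply: (IH (Z.abs_nat c')) => //.
    by apply: leq_trans hn; apply/ltP; lia.
  by rewrite c'E; apply: Z.divide_add_r => //; exists (l * d')%Z; ring.
have := calF_law_U (- l) hdet2 law.
have -> : (a' + 3 * - l * b' = a)%Z by rewrite /a'; ring.
have -> : (c' + 3 * - l * d' = c)%Z by rewrite c'E; ring.
move=> law2; have := calF_law_T (- k) h3 law2.
have -> : (b' + - k * a = b)%Z by rewrite /b'; ring.
by have -> : (d' + - k * c = d)%Z by rewrite /d'; ring.
Qed.

End GeneratingFunctions.

(** * Quadratic characters of -1, 2 and 3 in finite fields *)

Module QuadraticResidues.
Import all_algebra all_field GRing.Theory ring.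
Local Open Scope ring_scope.

(** These three predicates mark the primes p > 3 for which -1, 2 and 3 respectively are
    nonresidues. *)
Definition neg4 (p : nat) : bool := (p %% 4 == 3)%N.
Definition neg8 (p : nat) : bool := (p %% 8 == 3)%N || (p %% 8 == 5)%N.
Definition neg12 (p : nat) : bool := (p %% 12 == 5)%N || (p %% 12 == 7)%N.

Section Root24.
Variables (F : finFieldType) (z : F).
Hypothesis prim : 24.-primitive_root z.

Lemma root24_12 : z ^+ 12 = -1.
Proof.
have h24 : z ^+ 24 = 1 := prim_expr_order prim.
have h12 : z ^+ 12 != 1 by rewrite -(prim_order_dvd prim).
have : (z ^+ 12 - 1) * (z ^+ 12 + 1) = 0 by rewrite -subr_sqr expr1n -exprM h24 subrr.
move/eqP; rewrite mulf_eq0 subr_eq0 (negPf h12) /= addr_eq0 => /eqP.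
by [].
Qed.

(** z^4 has order 6, so it is a root of the cyclotomic polynomial x^2 - x + 1. *)
Lemma root24_8 : z ^+ 8 = z ^+ 4 - 1.
Proof.
have h4 : z ^+ 4 != -1.
  apply/eqP => h; have : z ^+ 8 != 1 by rewrite -(prim_order_dvd prim).
  by rewrite (_ : 8 = 4 * 2)%N // exprM h sqrrN expr1n eqxx.
have : (z ^+ 4 + 1) * (z ^+ 8 - (z ^+ 4 - 1)) = 0.
  rewrite (_ : z ^+ 8 = z ^+ 4 ^+ 2); last by rewrite -exprM.
  have : z ^+ 4 ^+ 3 = -1 by rewrite -exprM root24_12.
  set x := z ^+ 4 => hx.
  by transitivity (x ^+ 3 + 1); [ring | rewrite hx addNr].
move/eqP; rewrite mulf_eq0 addr_eq0 (negPf h4) /= subr_eq0 => /eqP.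
by [].
Qed.

(* Square roots of -1, 2 and 3, as in the complex numbers. *)
Definition root_m1 : F := z ^+ 6.
Definition root_2 : F := z ^+ 3 + z ^+ 21.
Definition root_3 : F := z ^+ 2 + z ^+ 22.

Lemma root24_shift (k t : nat) : z ^+ (k + 12 * t) = (-1) ^+ t * z ^+ k.
Proof. by rewrite exprD exprM root24_12 mulrC. Qed.

Lemma root_m1_sqr : root_m1 ^+ 2 = -1.
Proof. by rewrite /root_m1 -exprM root24_12. Qed.

Lemma root_2_sqr : root_2 ^+ 2 = 2%:R.
Proof.
rewrite /root_2 (root24_shift 9 1) (_ : z ^+ 9 = z ^+ 3 ^+ 3); last by rewrite -exprM.
have : z ^+ 3 ^+ 4 = -1 by rewrite -exprM root24_12.
set x := z ^+ 3 => hx.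
transitivity (x ^+ 2 + x ^+ 4 * (-2%:R) + x ^+ 4 * x ^+ 2); first by ring.
by rewrite hx; ring.
Qed.

Lemma root_3_sqr : root_3 ^+ 2 = 3%:R.
Proof.
rewrite /root_3 (root24_shift 10 1) (_ : z ^+ 10 = z ^+ 2 ^+ 5); last by rewrite -exprM.
have : z ^+ 2 ^+ 6 = -1 by rewrite -exprM root24_12.
have : z ^+ 2 ^+ 4 = z ^+ 2 ^+ 2 - 1 by rewrite -!exprM root24_8.
set x := z ^+ 2 => h4 hx.
transitivity (x ^+ 2 - 2%:R * x ^+ 6 + x ^+ 6 * x ^+ 4); first by ring.
by rewrite hx h4; ring.
Qed.

Variable p : nat.
Hypothesis charFp : p \in [pchar F].
Hypothesis p_coprime : coprime p 6.

Lemma frobenius_add (x y : F) : (x + y) ^+ p = x ^+ p + y ^+ p.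
Proof. by rewrite -!(pFrobenius_autE charFp) pFrobenius_autD_comm //; apply: mulrC. Qed.

Lemma frobenius_pow (k : nat) : (z ^+ k) ^+ p = z ^+ ((k * (p %% 24)) %% 24).
Proof. by rewrite -exprM -(prim_expr_mod prim (k * p)) -(modnMmr k p 24). Qed.

Lemma coprime6_mod24 : (p %% 24)%N \in [:: 1; 5; 7; 11; 13; 17; 19; 23]%N.
Proof.
have : coprime (p %% 24) 6.
  by rewrite -coprime_modl modn_dvdm // coprime_modl.
have := ltn_pmod p (isT : 0 < 24)%N.
by move: (p %% 24)%N; do 24 (case=> [//|] || case=> //).
Qed.

(** Frobenius multiplies the exponents of z by p, so only p modulo 24 matters; the eight unit
    classes are checked. The same holds for the roots of 2 and 3. *)
Lemma frobenius_root_m1 : root_m1 ^+ p = (-1) ^+ neg4 p * root_m1.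
Proof.
have e18 : z ^+ 18 = - z ^+ 6 by rewrite (root24_shift 6 1) expr1 mulN1r.
rewrite /root_m1 frobenius_pow /neg4 -(modn_dvdm p (isT : 4 %| 24)%N).
move: coprime6_mod24; rewrite !inE; repeat case/orP; move/eqP => -> /=;
  rewrite ?expr0 ?expr1 ?mul1r ?mulN1r //.
Qed.

Lemma frobenius_root_2 : root_2 ^+ p = (-1) ^+ neg8 p * root_2.
Proof.
have e15 : z ^+ 15 = - z ^+ 3 by rewrite (root24_shift 3 1) expr1 mulN1r.
have e21 : z ^+ 21 = - z ^+ 9 by rewrite (root24_shift 9 1) expr1 mulN1r.
rewrite /root_2 frobenius_add !frobenius_pow /neg8 -(modn_dvdm p (isT : 8 %| 24)%N).
move: coprime6_mod24; rewrite !inE; repeat case/orP; move/eqP => -> /=;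
  rewrite ?expr0 ?expr1 ?mul1r ?mulN1r ?opprD ?e15 ?e21 ?opprK // addrC //.
Qed.

Lemma frobenius_root_3 : root_3 ^+ p = (-1) ^+ neg12 p * root_3.
Proof.
have e14 : z ^+ 14 = - z ^+ 2 by rewrite (root24_shift 2 1) expr1 mulN1r.
have e22 : z ^+ 22 = - z ^+ 10 by rewrite (root24_shift 10 1) expr1 mulN1r.
rewrite /root_3 frobenius_add !frobenius_pow /neg12 -(modn_dvdm p (isT : 12 %| 24)%N).
move: coprime6_mod24; rewrite !inE; repeat case/orP; move/eqP => -> /=;
  rewrite ?expr0 ?expr1 ?mul1r ?mulN1r ?opprD ?e14 ?e22 ?opprK // addrC //.
Qed.

Variables e i j : nat.

Definition root_23 : F := root_m1 ^+ e * root_2 ^+ i * root_3 ^+ j.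

Lemma root_23_sqr : root_23 ^+ 2 = (-1) ^+ e * (2 ^ i * 3 ^ j)%:R.
Proof.
rewrite /root_23; move: root_m1_sqr root_2_sqr root_3_sqr.
move: root_m1 root_2 root_3 => x y t hx hy ht.
by rewrite !exprMn -!exprM ![(_ * 2)%N]mulnC !exprM hx hy ht natrM !natrX mulrA.
Qed.

Definition sign_23 (p : nat) : bool := odd (neg4 p * e + neg8 p * i + neg12 p * j).

Lemma frobenius_root_23 : root_23 ^+ p = (-1) ^+ sign_23 p * root_23.
Proof.
rewrite /root_23; move: frobenius_root_m1 frobenius_root_2 frobenius_root_3.
move: root_m1 root_2 root_3 => x y t hx hy ht.
rewrite !exprMn -!exprM ![(_ * p)%N]mulnC !exprM hx hy ht !exprMn -!exprM /sign_23 signr_odd !exprD.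
by ring.
Qed.

Lemma char_neq (n : nat) : (0 < n)%N -> (n <= 3)%N -> n%:R != 0 :> F.
Proof.
move=> n0 n3; rewrite -(dvdn_pcharf charFp).
have p1 : prime p := pcharf_prime charFp.
apply/negP => /dvdn_leq h; have := h n0; move: p_coprime p1.
by move: {h} (leq_trans (h n0) n3) => _; case: p n n0 n3 => [|[|[|[|q]]]] [|[|[|[|m]]]].
Qed.

Lemma root_23_neq0 : root_23 != 0.
Proof.
rewrite -sqrf_eq0 root_23_sqr natrM !natrX mulf_neq0 ?signr_eq0 //.
by rewrite mulf_neq0 // expf_neq0 // char_neq.
Qed.

(* [root_23] is a square root of [(-1)^e 2^i 3^j], and it lies in the prime field if and only if
   Frobenius fixes it. *)
Lemma square_23 : reflect (exists2 x, (x < p)%N & (x ^ 2)%:R = (-1) ^+ e * (2 ^ i * 3 ^ j)%:R :> F) (~~ sign_23 p).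
Proof.
have p1 : prime p := pcharf_prime charFp.
have natp (n : nat) : (n%:R : F) ^+ p = n%:R by rewrite -(pFrobenius_autE charFp) pFrobenius_aut_nat.
rewrite -root_23_sqr; apply: (iffP idP) => [sg | [x _ hx]].
  have hs : root_23 ^+ p = root_23 by rewrite frobenius_root_23 (negPf sg) expr0 mul1r.
  case: (boolP (has (fun k => k%:R == root_23) (iota 0 p))) => [/hasP [x]|].
    rewrite mem_iota add0n => /andP [_ xp] /eqP <-.
    by exists x => //; rewrite natrX.
  (* Otherwise X^p - X would have p + 1 distinct roots: the images of 0, ..., p - 1 and
     [root_23]. *)
  move=> /hasPn no; exfalso.
  pose rs := root_23 :: [seq k%:R | k <- iota 0 p].
  have szX : size ('X^p - 'X : {poly F}) = p.+1.
    by rewrite size_polyDl size_polyXn // size_polyN size_polyX ltnS prime_gt1.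
  suff : (size rs < size ('X^p - 'X : {poly F})%R)%N by rewrite szX /= size_map size_iota ltnn.
  apply: max_poly_roots.
  - by rewrite -size_poly_eq0 szX.
  - rewrite /rs /= /root !hornerE hs subrr eqxx /=.
    by apply/allP => y /mapP [k _ ->]; rewrite !hornerE natp subrr.
  rewrite /rs /=; apply/andP; split.
    by apply/mapP => -[k hk e1]; have := no k hk; rewrite -e1 eqxx.
  rewrite map_inj_in_uniq ?iota_uniq // => k l; rewrite !mem_iota !add0n => /andP [_ kp] /andP [_ lp].
  wlog kl : k l kp lp / (k <= l)%N.
    by move=> H; case/orP: (leq_total k l) => h e1; [exact (H k l kp lp h e1) | exact (esym (H l k lp kp h (esym e1)))].
  move=> /eqP; rewrite eq_sym -subr_eq0 -natrB // -(dvdn_pcharf charFp) => dv.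
  apply/eqP; rewrite eqn_leq kl /= leqNgt; apply/negP => lk.
  have lk0 : (0 < l - k)%N by rewrite subn_gt0.
  by have := dvdn_leq lk0 dv; rewrite leqNgt (leq_ltn_trans (leq_subr _ _) lp).
move: hx; rewrite natrX => /eqP; rewrite eqf_sqr => hx.
have hp : root_23 ^+ p = root_23.
  case/orP: hx => /eqP hx; first by rewrite -hx natp.
  have -> : root_23 = - x%:R by rewrite hx opprK.
  have op : odd p by case: (even_prime p1) => // e2; move: p_coprime; rewrite e2.
  by rewrite exprNn -signr_odd op expr1 natp mulN1r.
apply/negP => sg; move: frobenius_root_23; rewrite hp sg expr1 mulN1r => /eqP.
rewrite -addr_eq0 -mulr2n -mulr_natl mulf_eq0 (negPf root_23_neq0) orbF.
by rewrite (negPf (@char_neq 2 _ _)).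
Qed.

End Root24.

(** p^2 = 1 modulo 24, so the cyclic multiplicative group of the field with p^2 elements contains an
    element of order 24. *)
Lemma root24_exists (p : nat) : prime p -> coprime p 6 ->
  exists F : finFieldType, p \in [pchar F] /\ exists z : F, 24.-primitive_root z.
Proof.
move=> p1 p6; have [F charF cF] := PrimePowerField p1 (isT : 0 < 2)%N.
exists F; split=> //.
pose N := (p ^ 2).-1.
have N24 : (24 %| N)%N.
  have := coprime6_mod24 p6.
  rewrite /N -subn1 -eqn_mod_dvd ?expn_gt0 ?prime_gt0 // -modnXm.
  by rewrite !inE; repeat case/orP; move/eqP => ->.
have N0 : (0 < N)%N.
  by rewrite /N -ltnS prednK ?expn_gt0 ?prime_gt0 // (ltn_exp2l 0 2) // prime_gt1.
pose rs := [seq x <- enum F | x != 0].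
have hrs : has N.-primitive_root rs.
  apply: cyclic.has_prim_root => //.
  - apply/allP => x; rewrite mem_filter => /andP [x0 _]; rewrite unity_rootE.
    have := expf_card x; rewrite cF -(prednK (n := (p ^ 2)%N)) ?expn_gt0 ?prime_gt0 // -/N exprS.
    by move=> h; apply/eqP/(mulfI x0); rewrite h mulr1.
  - by rewrite filter_uniq // enum_uniq.
  have -> // : size rs = N.
  by rewrite /N -cF -(cardC1 (0 : F)) cardE /rs enumT.
case/hasP: hrs => w _ hw; exists (w ^+ (N %/ 24)).
have := exp_prim_root hw (N %/ 24).
have -> : (gcdn (N %/ 24) N = N %/ 24)%N by apply/gcdn_idPl; exact: dvdn_div.
by rewrite divnA // ?mulKn // .
Qed.

Lemma eqr_nat_mod (F : finFieldType) (p m n : nat) : p \in [pchar F] ->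
  (m%:R == n%:R :> F) = (m == n %[mod p])%N.
Proof.
move=> charF.
wlog mn : m n / (m <= n)%N.
  by move=> H; case/orP: (leq_total m n) => h; [|rewrite eq_sym [RHS]eq_sym]; exact: H.
by rewrite eq_sym [RHS]eq_sym eqn_mod_dvd // -subr_eq0 -natrB // (dvdn_pcharf charF).
Qed.

(** Back from the field to natural numbers; a negative radicand is expressed by divisibility of a
    sum, which avoids truncated subtraction. *)
Lemma square_mod_23 (p e i j : nat) : prime p -> coprime p 6 ->
  ~~ sign_23 e i j p <->
  exists2 x, (x < p)%N & if odd e then (p %| x ^ 2 + 2 ^ i * 3 ^ j)%N else (x ^ 2 == 2 ^ i * 3 ^ j %[mod p])%N.
Proof.
move=> p1 p6; have [F [charF [z hz]]] := root24_exists p1 p6.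
have eq x : ((x ^ 2)%:R == (-1) ^+ e * (2 ^ i * 3 ^ j)%:R :> F) =
    if odd e then (p %| x ^ 2 + 2 ^ i * 3 ^ j)%N else (x ^ 2 == 2 ^ i * 3 ^ j %[mod p])%N.
  rewrite -signr_odd; case: (odd e).
    by rewrite expr1 mulN1r -addr_eq0 -natrD (dvdn_pcharf charF).
  by rewrite expr0 mul1r (eqr_nat_mod _ _ charF).
split=> [/(square_23 hz charF p6 e i j) | ] [x xp h].
  by exists x => //; rewrite -eq; apply/eqP.
by apply/(square_23 hz charF p6 e i j); exists x => //; apply/eqP; rewrite eq.
Qed.

End QuadraticResidues.

(** * Kronecker symbols with upper entry plus or minus 2^i 3^j *)

Section KroneckerSymbol.
Import QuadraticResidues.
Local Open Scope nat_scope.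

Lemma pow_involution (x : Z) (n : nat) : (x * x = 1)%Z -> (x ^ Z.of_nat n)%Z = if odd n then x else 1%Z.
Proof.
move=> hx; elim: n => [//|n IH]; rewrite Nat2Z.inj_succ Z.pow_succ_r; last by lia.
by rewrite IH /=; case: (odd n); rewrite ?hx ?Z.mul_1_r.
Qed.

Definition num_23 (e i j : nat) : Z :=
  ((-1) ^ Z.of_nat e * (2 ^ Z.of_nat i * 3 ^ Z.of_nat j))%Z.

Lemma num_23_nat (e i j : nat) :
  num_23 e i j = (if odd e then - Z.of_nat (2 ^ i * 3 ^ j)%N else Z.of_nat (2 ^ i * 3 ^ j)%N)%Z.
Proof.
have pw (m n : nat) : Z.of_nat (m ^ n)%N = (Z.of_nat m ^ Z.of_nat n)%Z.
  elim: n => [//|n IH]; rewrite expnS mulnE Nat2Z.inj_mul IH Nat2Z.inj_succ Z.pow_succ_r //; lia.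
rewrite /num_23 mulnE Nat2Z.inj_mul !pw.
rewrite pow_involution //.
by case: (odd e); rewrite ?Z.mul_1_l // -Z.opp_eq_mul_m1 Z.mul_comm.
Qed.

Lemma Zmod_dvdn (p n : nat) : (p > 0)%N -> (Z.of_nat n mod Z.of_nat p = 0)%Z <-> p %| n.
Proof.
move=> p0; have pz : Z.of_nat p <> 0%Z by move/ltP: p0; lia.
split=> [h | /dvdnP [k ->]]; last by rewrite mulnE Nat2Z.inj_mul; exact: Z_mod_mult.
apply/dvdnP; exists (Z.to_nat (Z.of_nat n / Z.of_nat p)).
apply/Nat2Z.inj; rewrite mulnE Nat2Z.inj_mul Z2Nat.id; last by apply: Z.div_pos; move/ltP: p0; lia.
by have := Z.div_mod (Z.of_nat n) _ pz; lia.
Qed.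

Lemma Zmod_opp_0 (a b : Z) : b <> 0%Z -> ((- a) mod b = 0)%Z <-> (a mod b = 0)%Z.
Proof. by move=> hb; rewrite !Z.mod_divide // Z.divide_opp_r. Qed.

Lemma Zmod_eqn (p m n : nat) : (p > 0)%N ->
  ((Z.of_nat m - Z.of_nat n) mod Z.of_nat p = 0)%Z <-> (m == n %[mod p]).
Proof.
move=> p0; have pz : Z.of_nat p <> 0%Z by move/ltP: p0; lia.
case/orP: (leq_total n m) => h.
  rewrite eqn_mod_dvd // -Zmod_dvdn //.
  by rewrite -Nat2Z.inj_sub //; apply/leP.
rewrite eq_sym eqn_mod_dvd // -Zmod_dvdn //.
have -> : (Z.of_nat m - Z.of_nat n = - Z.of_nat (n - m))%Z.
  by rewrite -minusE Nat2Z.inj_sub; [ring | apply/leP].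
by rewrite Zmod_opp_0.
Qed.

Lemma kronecker_prime_23 (p e i j : nat) : prime p -> coprime p 6 ->
  kronecker_prime (num_23 e i j) p = if sign_23 e i j p then (-1)%Z else 1%Z.
Proof.
move=> p1 p6; have p0 := prime_gt0 p1.
rewrite /kronecker_prime.
have -> : (p == 2) = false by apply/eqP => h; rewrite h in p6.
have nz : Z.eqb (num_23 e i j mod Z.of_nat p) 0 = false.
  apply/Z.eqb_neq => h.
  have : (Z.of_nat (2 ^ i * 3 ^ j)%N mod Z.of_nat p = 0)%Z.
    move: h; rewrite num_23_nat; case: (odd e) => //.
    by rewrite Zmod_opp_0 //; move/ltP: p0; lia.
  rewrite Zmod_dvdn // Euclid_dvdM //.
  have n2 : ~~ (p %| 2) by rewrite dvdn_prime2 //; apply/eqP => h2; rewrite h2 in p6.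
  have n3 : ~~ (p %| 3) by rewrite dvdn_prime2 //; apply/eqP => h2; rewrite h2 in p6.
  by rewrite !Euclid_dvdX // (negPf n2) (negPf n3).
rewrite nz.
have -> : has (fun x => Z.eqb ((Z.of_nat x * Z.of_nat x - num_23 e i j) mod Z.of_nat p) 0) (iota 0 p) = ~~ sign_23 e i j p.
  have key (x : nat) : ((Z.of_nat x * Z.of_nat x - num_23 e i j) mod Z.of_nat p = 0)%Z <->
     (if odd e then (p %| x ^ 2 + 2 ^ i * 3 ^ j)%N else (x ^ 2 == 2 ^ i * 3 ^ j %[mod p])%N).
    rewrite num_23_nat -Nat2Z.inj_mul -[(x * x)%coq_nat]/(x ^ 2).
    case: (odd e); last exact: Zmod_eqn.
    by rewrite -Zmod_dvdn // -plusE Nat2Z.inj_add Z.sub_opp_r.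
  apply/hasP/idP => [[x hx /Z.eqb_eq /key h]|/(square_mod_23 _ _ _ p1 p6) [x xp h]].
    apply/(square_mod_23 _ _ _ p1 p6); exists x => //.
    by move: hx; rewrite mem_iota add0n.
  by exists x; [rewrite mem_iota add0n | apply/Z.eqb_eq/key].
by case: sign_23.
Qed.

(** The character attached to [num_23 e i j]: -1, 2 and 3 contribute [chi4], [chi8] and [chi12]. *)
Definition chi_23 (e i j : nat) (d : Z) : Z :=
  (chi4 d ^ Z.of_nat e * chi8 d ^ Z.of_nat i * chi12 d ^ Z.of_nat j)%Z.

Definition coprime6 (d : Z) : Prop := Z.odd d = true /\ (d mod 3 <> 0)%Z.

Lemma chi4_mul (x y : Z) : Z.odd x = true -> Z.odd y = true -> chi4 (x * y) = (chi4 x * chi4 y)%Z.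
Proof.
rewrite !Zodd_mod => /Z.eqb_eq hx /Z.eqb_eq hy; rewrite /chi4 Z.mul_mod //.
have [->|->] : (x mod 4 = 1 \/ x mod 4 = 3)%Z by intros; Z.to_euclidean_division_equations; lia.
  by have [->|->] : (y mod 4 = 1 \/ y mod 4 = 3)%Z by intros; Z.to_euclidean_division_equations; lia.
by have [->|->] : (y mod 4 = 1 \/ y mod 4 = 3)%Z by intros; Z.to_euclidean_division_equations; lia.
Qed.

Lemma odd_mod8 (x : Z) : Z.odd x = true ->
  (x mod 8 = 1 \/ x mod 8 = 3 \/ x mod 8 = 5 \/ x mod 8 = 7)%Z.
Proof. by rewrite !Zodd_mod => /Z.eqb_eq hx; intros; Z.to_euclidean_division_equations; lia. Qed.

Lemma chi8_mul (x y : Z) : Z.odd x = true -> Z.odd y = true -> chi8 (x * y) = (chi8 x * chi8 y)%Z.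
Proof.
move=> /odd_mod8 hx /odd_mod8 hy; rewrite /chi8 Z.mul_mod //.
by case: hx => [->|[->|[->|->]]]; case: hy => [->|[->|[->|->]]].
Qed.

Lemma mod3_cases (x : Z) : (x mod 3 <> 0)%Z -> (x mod 3 = 1 \/ x mod 3 = 2)%Z.
Proof. by intros; Z.to_euclidean_division_equations; lia. Qed.

Lemma chi3_mul (x y : Z) : (x mod 3 <> 0)%Z -> (y mod 3 <> 0)%Z -> chi3 (x * y) = (chi3 x * chi3 y)%Z.
Proof.
move=> /mod3_cases hx /mod3_cases hy; rewrite /chi3 Z.mul_mod //.
by case: hx => ->; case: hy => ->.
Qed.

Lemma chi_23_mul (e i j : nat) (x y : Z) : coprime6 x -> coprime6 y ->
  chi_23 e i j (x * y) = (chi_23 e i j x * chi_23 e i j y)%Z.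
Proof.
move=> [ox x3] [oy y3]; rewrite /chi_23 /chi12 chi4_mul // chi8_mul // chi3_mul //.
by rewrite !Z.pow_mul_l; ring.
Qed.

Lemma chi_23_1 (e i j : nat) : chi_23 e i j 1 = 1%Z.
Proof. by rewrite /chi_23 /= !Z.pow_1_l //; lia. Qed.

Lemma coprime6_nat (n : nat) : coprime n 6 -> coprime6 (Z.of_nat n).
Proof.
rewrite (coprimeMr n 2 3) => /andP [h2 h3]; split.
  rewrite Zodd_mod; apply/Z.eqb_eq.
  have : ~ (2 %| n) by move=> h; move: h2; rewrite coprime_sym prime_coprime // h.
  by rewrite -Zmod_dvdn // => h; move: h => /=; intros; Z.to_euclidean_division_equations; lia.
have : ~ (3 %| n) by move=> h; move: h3; rewrite coprime_sym prime_coprime // h.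
by rewrite -Zmod_dvdn.
Qed.

Lemma chi_23_prime (e i j p : nat) : coprime p 6 ->
  chi_23 e i j (Z.of_nat p) = if sign_23 e i j p then (-1)%Z else 1%Z.
Proof.
move=> p6.
have red (m : nat) : (0 < m) -> (Z.of_nat p mod Z.of_nat m = Z.of_nat (p %% m))%Z.
  move=> m0; rewrite {1}(divn_eq p m) -plusE mulnE Nat2Z.inj_add Nat2Z.inj_mul Z.add_comm Z_mod_plus_full.
  by apply: Z.mod_small; have := ltn_pmod p m0 => /ltP; lia.
have c4 : chi4 (Z.of_nat p) = if neg4 p then (-1)%Z else 1%Z.
  rewrite /chi4 (red 4) // /neg4 -(modn_dvdm p (isT : 4 %| 24)).
  by have := coprime6_mod24 p6; rewrite !inE; repeat case/orP; move/eqP => ->.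
have c8 : chi8 (Z.of_nat p) = if neg8 p then (-1)%Z else 1%Z.
  rewrite /chi8 (red 8) // /neg8 -(modn_dvdm p (isT : 8 %| 24)).
  by have := coprime6_mod24 p6; rewrite !inE; repeat case/orP; move/eqP => ->.
have c12 : chi12 (Z.of_nat p) = if neg12 p then (-1)%Z else 1%Z.
  rewrite /chi12 /chi4 /chi3 (red 4) // (red 3) // /neg12.
  rewrite -(modn_dvdm p (isT : 4 %| 24)) -(modn_dvdm p (isT : 3 %| 24)) -(modn_dvdm p (isT : 12 %| 24)).
  by have := coprime6_mod24 p6; rewrite !inE; repeat case/orP; move/eqP => ->.
have pw (b : bool) (n : nat) : ((if b then -1 else 1) ^ Z.of_nat n = if odd (b * n) then -1 else 1)%Z.
  case: b; last by rewrite mul0n Z.pow_1_l //; lia.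
  by rewrite mul1n pow_involution.
by rewrite /chi_23 c4 c8 c12 !pw /sign_23 !oddD; do 3 case: odd.
Qed.

(** The right-hand side is completely multiplicative on integers prime to 6, so the comparison
    reduces to primes. *)
Lemma kronecker_product (e i j n : nat) : 0 < n -> coprime n 6 ->
  \big[Z.mul/1%Z]_(p <- primes n) (kronecker_prime (num_23 e i j) p ^ Z.of_nat (logn p n))%Z =
  chi_23 e i j (Z.of_nat n).
Proof.
move=> n0 n6.
have cop p : p \in primes n -> prime p /\ coprime p 6.
  rewrite mem_primes => /and3P [p1 _ pn]; split=> //.
  exact: coprime_dvdl pn n6.
have : n = \prod_(p <- primes n) p ^ logn p n.
  rewrite {1}(prod_prime_decomp n0) prime_decompE big_map.
  by apply: eq_bigr.
move=> {3}->.
(* The exponents [logn p n] keep n fixed while the list shrinks, so the induction runs over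
   arbitrary lists of prime divisors of n. *)
suff : forall s : seq nat, {subset s <= primes n} ->
   coprime (\prod_(p <- s) p ^ logn p n) 6 /\
   \big[Z.mul/1%Z]_(p <- s) (kronecker_prime (num_23 e i j) p ^ Z.of_nat (logn p n))%Z =
   chi_23 e i j (Z.of_nat (\prod_(p <- s) p ^ logn p n)).
  by move=> H; exact: (H (primes n) (fun x hx => hx)).2.
elim=> [|p s IH] hs; first by rewrite !big_nil chi_23_1.
rewrite !big_cons.
have [p1 p6] := cop p (hs p (mem_head p s)).
have [c6 IHe] := IH (fun x hx => hs x (mem_behead (s := p :: s) hx)).
have cp6 : coprime (p ^ logn p n) 6 by apply: coprimeXl.
split; first by rewrite coprimeMl cp6 c6.
rewrite IHe mulnE Nat2Z.inj_mul chi_23_mul; try exact: coprime6_nat.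
congr Z.mul; rewrite kronecker_prime_23 // -chi_23_prime //.
elim: (logn p n) => [|m IHm]; first by rewrite chi_23_1.
rewrite Nat2Z.inj_succ Z.pow_succ_r; last by lia.
rewrite IHm expnS mulnE Nat2Z.inj_mul chi_23_mul //; apply: coprime6_nat => //.
exact: coprimeXl.
Qed.

Lemma coprime6_abs (d : Z) : coprime6 d -> 0 < Z.abs_nat d /\ coprime (Z.abs_nat d) 6.
Proof.
move=> [od d3].
have e : Z.of_nat (Z.abs_nat d) = Z.abs d by rewrite Zabs2Nat.id_abs.
have n0 : 0 < Z.abs_nat d.
  by apply/ltP; case: (Z.eq_dec d 0) => [h|]; [rewrite h in od | lia].
split=> //; rewrite (coprimeMr _ 2 3); apply/andP.
have c2 := prime_coprime (Z.abs_nat d) (isT : prime 2).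
have c3 := prime_coprime (Z.abs_nat d) (isT : prime 3).
split; rewrite coprime_sym ?c2 ?c3; apply/negP; rewrite -Zmod_dvdn // e.
  move: od; rewrite Zodd_mod => /Z.eqb_eq.
  by intros; Z.to_euclidean_division_equations; lia.
by move: d3; intros; Z.to_euclidean_division_equations; lia.
Qed.

Lemma chi_23_opp (e i j : nat) (d : Z) : coprime6 d ->
  chi_23 e i j (- d) = ((-1) ^ Z.of_nat e * chi_23 e i j d)%Z.
Proof.
move=> [od d3]; rewrite /chi_23 /chi12 chi4_opp // chi8_opp // chi3_opp //.
have -> : (- chi4 d * - chi3 d = chi4 d * chi3 d)%Z by ring.
have -> : (- chi4 d = -1 * chi4 d)%Z by ring.
by rewrite (Z.pow_mul_l (-1)); ring.
Qed.

(** For d < 0 the sign convention of the symbol contributes -1 exactly when the upper entry is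
    negative, that is for odd e; this matches [chi4 (-1) = -1]. *)
Lemma kronecker_23 (e i j : nat) (d : Z) : coprime6 d -> kronecker (num_23 e i j) d = chi_23 e i j d.
Proof.
move=> hd; have [n0 n6] := coprime6_abs hd.
rewrite /kronecker kronecker_product // Zabs2Nat.id_abs.
have -> : Z.eqb d 0 = false by apply/Z.eqb_neq => h; case: hd; rewrite h.
have neg : Z.ltb (num_23 e i j) 0 = odd e.
  rewrite num_23_nat; have : 0 < 2 ^ i * 3 ^ j by rewrite muln_gt0 !expn_gt0.
  by move/ltP => h; case: (odd e); [apply/Z.ltb_lt | apply/Z.ltb_ge]; lia.
rewrite neg; case: Z.ltb_spec => h; last by rewrite andFb Z.mul_1_l Z.abs_eq.
rewrite andTb.
have -> : Z.abs d = (- d)%Z by lia.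
rewrite chi_23_opp //.
rewrite pow_involution //.
by case: (odd e); ring.
Qed.

Lemma kronecker_3 (d : Z) : (d mod 3 <> 0)%Z -> kronecker d 3 = chi3 d.
Proof.
move=> d3; rewrite /kronecker.
have -> : Z.abs_nat 3 = 3 by [].
have -> : primes 3 = [:: 3] by [].
rewrite big_cons big_nil.
have -> : logn 3 3 = 1 by [].
rewrite Z.pow_1_r Z.mul_1_r /kronecker_prime.
have -> : (3 == 2) = false by [].
rewrite -[Z.of_nat 3]/(3%Z).
have -> : Z.eqb (d mod 3) 0 = false by apply/Z.eqb_neq.
have -> : Z.eqb 3 0 = false by [].
have -> : Z.ltb 3 0 = false by [].
rewrite Z.mul_1_l; have -> : iota 0 3 = [:: 0; 1; 2] by [].
have sq (x : Z) : Z.eqb ((x - d) mod 3) 0 = Z.eqb ((x - d mod 3) mod 3) 0 by rewrite Zminus_mod_idemp_r.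
rewrite /has !sq /chi3.
by case: (mod3_cases d3) => ->.
Qed.

End KroneckerSymbol.

(** * Holomorphy of theta constants *)

Section Holomorphy.
Local Open Scope R_scope.

(** A local version of [Cquad_deriv]: the radius is free, so that it can shrink near the real axis,
    and at most 1, so that higher powers of |h| are dominated by |h|^2 in products. *)
Definition holomorphic_at (f : C -> C) (z : C) : Prop :=
  exists D M rho, [/\ 0 < rho, rho <= 1, 0 <= M & forall h, Cmod h <= rho ->
    Cmod (f (z + h) - f z - h * D)%C <= M * Cmod h ^ 2].

Lemma holomorphic_const (k z : C) : holomorphic_at (fun _ => k) z.
Proof.
exists (RtoC 0), 0, 1; split; try lra; move=> h _.
by have -> : (k - k - h * 0 = 0)%C by [ring]; rewrite Cmod_0; lra.
Qed.

Lemma holomorphic_plus (f g : C -> C) (z : C) :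
  holomorphic_at f z -> holomorphic_at g z -> holomorphic_at (fun z => f z + g z)%C z.
Proof.
move=> [D1 [M1 [r1 [r10 r11 m1 H1]]]] [D2 [M2 [r2 [r20 r21 m2 H2]]]].
exists (D1 + D2)%C, (M1 + M2), (Rmin r1 r2); split; try lra.
- exact: Rmin_pos.
- by apply: Rle_trans (Rmin_l _ _) r11.
move=> h hh.
have -> : (f (z + h) + g (z + h) - (f z + g z) - h * (D1 + D2) =
   (f (z + h) - f z - h * D1) + (g (z + h) - g z - h * D2))%C by ring.
apply: Rle_trans (Cmod_triangle _ _) _.
have := H1 h (Rle_trans _ _ _ hh (Rmin_l _ _)); have := H2 h (Rle_trans _ _ _ hh (Rmin_r _ _)).
lra.
Qed.

Lemma holomorphic_mult (f g : C -> C) (z : C) :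
  holomorphic_at f z -> holomorphic_at g z -> holomorphic_at (fun z => f z * g z)%C z.
Proof.
move=> [D1 [M1 [r1 [r10 r11 m1 H1]]]] [D2 [M2 [r2 [r20 r21 m2 H2]]]].
have f0 := Cmod_ge_0 (f z); have g0 := Cmod_ge_0 (g z).
have d10 := Cmod_ge_0 D1; have d20 := Cmod_ge_0 D2.
exists (D1 * g z + f z * D2)%C.
exists (Cmod D1 * Cmod D2 + M1 * (Cmod (g z) + Cmod D2 + M2) + M2 * (Cmod (f z) + Cmod D1)).
exists (Rmin r1 r2); split.
- exact: Rmin_pos.
- by apply: Rle_trans (Rmin_l _ _) r11.
- by repeat (apply: Rplus_le_le_0_compat || apply: Rmult_le_pos); lra.
move=> h hh; have h0 := Cmod_ge_0 h.
have h1 : Cmod h <= 1 by apply: Rle_trans hh _; apply: Rle_trans (Rmin_l _ _) r11.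
have hsq : 0 <= Cmod h ^ 2 by apply: pow2_ge_0.
have hsq1 : Cmod h ^ 2 <= 1 by nra.
have a1 := H1 h (Rle_trans _ _ _ hh (Rmin_l _ _)); have a2 := H2 h (Rle_trans _ _ _ hh (Rmin_r _ _)).
set a := (f (z + h) - f z - h * D1)%C in a1; set b := (g (z + h) - g z - h * D2)%C in a2.
have -> : (f (z + h) * g (z + h) - f z * g z - h * (D1 * g z + f z * D2) =
  h * h * (D1 * D2) + a * (g z + h * D2 + b) + b * (f z + h * D1))%C by rewrite /a /b; ring.
have b0 := Cmod_ge_0 b; have aa0 := Cmod_ge_0 a.
have e1 : Cmod (g z + h * D2 + b)%C <= Cmod (g z) + Cmod D2 + M2.
  apply: Rle_trans (Cmod_triangle _ _) _.
  have := Cmod_triangle (g z) (h * D2)%C; rewrite Cmod_mult.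
  have : Cmod h * Cmod D2 <= 1 * Cmod D2 by apply: Rmult_le_compat_r.
  have : M2 * Cmod h ^ 2 <= M2 * 1 by apply: Rmult_le_compat_l.
  lra.
have e2 : Cmod (f z + h * D1)%C <= Cmod (f z) + Cmod D1.
  apply: Rle_trans (Cmod_triangle _ _) _; rewrite Cmod_mult.
  have : Cmod h * Cmod D1 <= 1 * Cmod D1 by apply: Rmult_le_compat_r.
  lra.
apply: Rle_trans (Cmod_triangle _ _) _; rewrite (Cmod_mult b).
apply: Rle_trans (Rplus_le_compat_r _ _ _ (Cmod_triangle _ _)) _; rewrite (Cmod_mult a) (Cmod_mult (h * h)%C) (Cmod_mult h h) (Cmod_mult D1).
have e3 : Cmod a * Cmod (g z + h * D2 + b)%C <= M1 * Cmod h ^ 2 * (Cmod (g z) + Cmod D2 + M2).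
  by apply: Rmult_le_compat => //; apply: Cmod_ge_0.
have e4 : Cmod b * Cmod (f z + h * D1)%C <= M2 * Cmod h ^ 2 * (Cmod (f z) + Cmod D1).
  by apply: Rmult_le_compat => //; apply: Cmod_ge_0.
lra.
Qed.

Lemma holomorphic_opp (f : C -> C) (z : C) : holomorphic_at f z -> holomorphic_at (fun z => - f z)%C z.
Proof.
move=> h; have := holomorphic_mult (holomorphic_const (RtoC (-1)) z) h.
move=> [D [M [r [r0 r1 m0 H]]]]; exists D, M, r; split=> // x hx.
have := H x hx.
by have -> : (RtoC (-1) * f (z + x) - RtoC (-1) * f z = - f (z + x) - - f z)%C by ring.
Qed.

Lemma holomorphic_scal (f : C -> C) (r : R) (z : C) : 0 < r ->
  holomorphic_at f (RtoC r * z)%C -> holomorphic_at (fun z => f (RtoC r * z)%C) z.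
Proof.
move=> r0 [D [M [rho [rho0 rho1 m0 H]]]].
exists (RtoC r * D)%C, (M * r ^ 2), (Rmin 1 (rho / r)); split.
- by apply: Rmin_pos; [lra | apply: Rdiv_lt_0_compat].
- exact: Rmin_l.
- by apply: Rmult_le_pos => //; apply: pow2_ge_0.
move=> h hh.
have hr : Cmod (RtoC r * h)%C <= rho.
  rewrite Cmod_scal; last by lra.
  have := Rle_trans _ _ _ hh (Rmin_r _ _) => /(Rmult_le_compat_l r _ _ (Rlt_le _ _ r0)).
  by have -> : r * (rho / r) = rho by field; lra.
have := H _ hr; rewrite Cmod_scal; last by lra.
have -> : (RtoC r * (z + h) = RtoC r * z + RtoC r * h)%C by ring.
have -> : (RtoC r * h * D = h * (RtoC r * D))%C by ring.
by have -> : M * (r * Cmod h) ^ 2 = M * r ^ 2 * Cmod h ^ 2 by ring.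
Qed.

Lemma holomorphic_ext_upper (f g : C -> C) (z : C) : 0 < Im z ->
  (forall x, 0 < Im x -> f x = g x) -> holomorphic_at f z -> holomorphic_at g z.
Proof.
move=> hz e [D [M [r [r0 r1 m0 H]]]]; exists D, M, (Rmin r (Im z / 2)); split=> //.
- by apply: Rmin_pos => //; lra.
- by apply: Rle_trans (Rmin_l _ _) r1.
move=> h hh; have hzh : 0 < Im (z + h)%C.
  rewrite im_plus; have := im_le_Cmod h; have := Rle_trans _ _ _ hh (Rmin_r _ _) => h1 h3.
  have := Rle_trans _ _ _ h3 h1 => /Rabs_le_between; lra.
rewrite -(e _ hzh) -(e _ hz); apply: H; exact: Rle_trans hh (Rmin_l _ _).
Qed.

Lemma holomorphic_ex_derive (f : C -> C) (z : C) : holomorphic_at f z ->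
  @ex_derive C_AbsRing C_NormedModule f z.
Proof.
move=> [D [M [r [r0 r1 m0 H]]]]; exists D; split; first exact: is_linear_scal_l.
move=> x hx eps; have <- := is_filter_lim_locally_unique _ _ hx.
have e0 := cond_pos eps.
have d0 : 0 < Rmin r (eps / (M + 1)).
  by apply: Rmin_pos => //; apply: Rdiv_lt_0_compat => //; lra.
exists (mkposreal _ d0) => y hy.
have {}hy : Cmod (y - z)%C < Rmin r (eps / (M + 1)) by exact: hy.
have h1 := Rlt_le_trans _ _ _ hy (Rmin_l _ _); have h2 := Rlt_le_trans _ _ _ hy (Rmin_r _ _).
have := H (y - z)%C (Rlt_le _ _ h1); have -> : (z + (y - z) = y)%C by ring.
move=> h3; apply: (Rle_trans _ (M * Cmod (y - z)%C ^ 2)); first exact: h3.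
change (M * Cmod (y - z)%C ^ 2 <= eps * Cmod (y - z)%C).
have q0 := Cmod_ge_0 (y - z)%C.
have : Cmod (y - z)%C * (M + 1) <= eps.
  move: (Rmult_le_compat_r (M + 1) _ _ ltac:(lra) (Rlt_le _ _ h2)).
  by have -> : eps / (M + 1) * (M + 1) = eps by field; lra.
by nra.
Qed.

(** Termwise differentiation. A radius of at most Im z/2 leaves half of the Gaussian decay, and the
    factor n^4 in the second-order remainders is bounded by exp(4|n|), hence the constant 4 in
    [gauss_const]. *)
Lemma theta3_holomorphic (z : C) : 0 < Im z -> holomorphic_at theta3 z.
Proof.
move=> hz; have pi0 := PI_RGT_0.
have r0 : 0 < PI * Im z / 2 by apply: Rdiv_lt_0_compat; [apply: Rmult_lt_0_compat | lra].
pose A := gauss_const (PI * Im z / 2) 4 0.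
have A0 : 0 < A by apply: exp_pos.
have abs n : exp (- (PI * Im z / 2) * IZR (n * n) + 4 * Rabs (IZR n)) <= A * exp (- Rabs (IZR n)).
  by have := @gauss_absorb _ 4 0 0 n r0; rewrite Rabs_R0 !Rplus_0_l mult_IZR; apply; lra.
have n4 n : (IZR (n * n)) ^ 2 <= exp (4 * Rabs (IZR n)) /\ IZR (n * n) <= exp (4 * Rabs (IZR n)) /\ 0 <= IZR (n * n).
  have n0 := Rabs_pos (IZR n).
  have e : IZR (n * n) = Rabs (IZR n) ^ 2 by rewrite pow2_abs mult_IZR; ring.
  have s := sqr_le_exp n0.
  have b1 : IZR (n * n) <= exp (2 * Rabs (IZR n)).
    by rewrite e; apply: Rle_trans s; apply: pow_incr; lra.
  have p0 : 0 <= IZR (n * n) by rewrite e; apply: pow2_ge_0.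
  have -> : 4 * Rabs (IZR n) = 2 * Rabs (IZR n) + 2 * Rabs (IZR n) by ring.
  have g1 : 1 <= exp (2 * Rabs (IZR n)) by rewrite -exp_0; apply: exp_le; lra.
  by rewrite exp_plus; split; [nra | split; [nra|]].
pose Dn n := (RtoC (PI * IZR (n * n)) * Ci * qexp (IZR (n * n)) z)%C.
have dD : dominated (PI * A) Dn.
  move=> n; have [_ [n1 n0]] := n4 n.
  rewrite /Dn !Cmod_mult Cmod_Ci Rmult_1_r Cmod_R Rabs_pos_eq; last by apply: Rmult_le_pos; lra.
  rewrite Cmod_qexp Rmult_assoc Rmult_assoc; apply: Rmult_le_compat_l; first by lra.
  apply: Rle_trans (abs n); rewrite exp_plus Rmult_comm.
  apply: Rmult_le_compat => //; first by apply/Rlt_le/exp_pos.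
  by apply: exp_le; have : 0 <= PI * Im z * IZR (n * n) by [apply: Rmult_le_pos; [nra | lra]]; lra.
exists (Zseries Dn), (4 * (PI ^ 2 * A)), (Rmin 1 (Im z / 2)); split.
- by apply: Rmin_pos; lra.
- exact: Rmin_l.
- by have := pow2_ge_0 PI; nra.
move=> h hh; have h0 := Cmod_ge_0 h.
have hz2 : Cmod h <= Im z / 2 by apply: Rle_trans hh (Rmin_r _ _).
have hzh : 0 < Im (z + h)%C.
  by rewrite im_plus; have := im_le_Cmod h => /Rabs_le_between; lra.
have d1 := dominated_qexp hzh; have d2 := dominated_qexp hz.
rewrite /theta3 -(Zseries_minus d1 d2) -(Zseries_scal h dD) -(Zseries_minus (dominated_minus d1 d2) (dominated_scal h dD)).
have -> : 4 * (PI ^ 2 * A) * Cmod h ^ 2 = 4 * (PI ^ 2 * A * Cmod h ^ 2) by ring.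
apply: Zseries_bound => n; have [n1 [_ n0]] := n4 n.
set u := (RtoC (PI * IZR (n * n)) * Ci * h)%C.
have -> : (qexp (IZR (n * n)) (z + h) - qexp (IZR (n * n)) z - h * Dn n = qexp (IZR (n * n)) z * (Cexp u - 1 - u))%C.
  by rewrite qexp_addr /Dn {2}/qexp -/u /u; ring.
rewrite Cmod_mult Cmod_qexp.
have ua : Cmod u = PI * IZR (n * n) * Cmod h.
  by rewrite /u !Cmod_mult Cmod_Ci Rmult_1_r Cmod_R Rabs_pos_eq //; apply: Rmult_le_pos; lra.
have b := Cexp_bound2 u; rewrite ua in b.
apply: (Rle_trans _ (exp (- (PI * Im z) * IZR (n * n)) * ((PI * IZR (n * n) * Cmod h) ^ 2 * exp (PI * IZR (n * n) * Cmod h)))).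
  by apply: Rmult_le_compat_l => //; apply/Rlt_le/exp_pos.
have -> : PI ^ 2 * A * Cmod h ^ 2 * exp (- Rabs (IZR n)) = PI ^ 2 * Cmod h ^ 2 * (A * exp (- Rabs (IZR n))) by ring.
have -> : exp (- (PI * Im z) * IZR (n * n)) * ((PI * IZR (n * n) * Cmod h) ^ 2 * exp (PI * IZR (n * n) * Cmod h)) =
  PI ^ 2 * Cmod h ^ 2 * ((exp (- (PI * Im z) * IZR (n * n)) * exp (PI * IZR (n * n) * Cmod h)) * IZR (n * n) ^ 2) by ring.
apply: Rmult_le_compat_l.
  by apply: Rmult_le_pos; apply: pow2_ge_0.
apply: Rle_trans (abs n); rewrite -exp_plus [X in _ <= X]exp_plus.
apply: Rmult_le_compat => //; [apply/Rlt_le/exp_pos | exact: pow2_ge_0 |].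
apply: exp_le.
have : PI * IZR (n * n) * Cmod h <= PI * IZR (n * n) * (Im z / 2).
  by apply: Rmult_le_compat_l => //; apply: Rmult_le_pos; lra.
lra.
Qed.

Lemma theta2_holomorphic (z : C) : 0 < Im z -> holomorphic_at theta2 z.
Proof.
move=> hz; have r4 : 0 < / 4 by lra.
apply: holomorphic_plus; last by apply: holomorphic_opp; exact: theta3_holomorphic.
by apply: (holomorphic_scal r4); apply: theta3_holomorphic; apply: Im_scal.
Qed.

End Holomorphy.

(** * Bounds at the cusps *)

Section Cusps.
Local Open Scope R_scope.

Definition theta_size (z : C) : R := Cmod (theta2 z) + Cmod (theta3 z) + Cmod (theta4 z).

Lemma theta_size_pos (z : C) : 0 <= theta_size z.
Proof. by have := Cmod_ge_0 (theta2 z); have := Cmod_ge_0 (theta3 z); have := Cmod_ge_0 (theta4 z); rewrite /theta_size; lra. Qed.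

Lemma theta_size_T (z : C) : 0 < Im z -> theta_size (z + 1)%C = theta_size z.
Proof.
move=> hz; rewrite /theta_size theta2_T // theta4_T Cmod_mult Cmod_turn -/(theta4 z).
by rewrite /theta4; ring.
Qed.

Lemma periodic_shift (T : Type) (f : C -> T) : (forall z, 0 < Im z -> f (z + 1)%C = f z) ->
  forall (k : Z) (z : C), 0 < Im z -> f (z + ZtoC k)%C = f z.
Proof.
move=> fT k z hz; move: k; apply: Z.peano_ind.
- by have -> : (z + ZtoC 0 = z)%C by rewrite /ZtoC; ring.
- move=> k IH; have -> : (z + ZtoC (Z.succ k) = (z + ZtoC k) + 1)%C.
    by rewrite -Z.add_1_r ZtoC_plus -Cplus_assoc.
  by rewrite fT ?Im_plus_R.
- move=> k IH; rewrite -IH; have -> : (z + ZtoC k = (z + ZtoC (Z.pred k)) + 1)%C.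
    by rewrite -Cplus_assoc -[RtoC 1]/(ZtoC 1) -ZtoC_plus Z.add_1_r Z.succ_pred.
  by rewrite fT ?Im_plus_R.
Qed.

Lemma theta_size_S (z : C) : 0 < Im z -> theta_size (- / z) = sqrt (Cmod z) * theta_size z.
Proof.
move=> hz; rewrite /theta_size theta2_S // theta3_S // theta4_S // !Cmod_mult.
have -> : Cmod (Csqrt (- Ci * z)) = sqrt (Cmod z).
  have s : (Csqrt (- Ci * z) * Csqrt (- Ci * z) = - Ci * z)%C by apply: Csqrt_sqr; apply: slit_Re; rewrite Re_mCi.
  have := f_equal Cmod s; rewrite !Cmod_mult Cmod_opp Cmod_Ci Rmult_1_l => <-.
  by rewrite sqrt_square //; apply: Cmod_ge_0.
by ring.
Qed.

Lemma theta3_bound (z : C) (A : R) : 0 < A -> A <= Im z ->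
  Cmod (theta3 z) <= 4 * exp (/ (4 * (PI * A))).
Proof.
move=> hA hz; have hz0 : 0 < Im z by lra.
have pi0 := PI_RGT_0.
have pA : 0 < PI * A by apply: Rmult_lt_0_compat.
apply: Zseries_bound; apply: dominated_le (dominated_qexp hz0).
rewrite /gauss_const; apply: exp_le.
have -> : (0 + 1) * (0 + 1) / (4 * (PI * Im z)) + 0 = / (4 * (PI * Im z)) by rewrite /Rdiv; ring.
by apply: Rinv_le_contravar; nra.
Qed.

Lemma theta_size_bound (A : R) : 0 < A -> exists B, 0 <= B /\ forall z, A <= Im z -> theta_size z <= B.
Proof.
move=> hA; pose b x := 4 * exp (/ (4 * (PI * x))).
have b0 x : 0 < b x by rewrite /b; have := exp_pos (/ (4 * (PI * x))); lra.
exists (b (A / 4) + b A + b A + b A); split; first by have := b0 (A / 4); have := b0 A; lra.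
move=> z hz; rewrite /theta_size.
have h3 := theta3_bound hA hz.
have h4 : Cmod (theta4 z) <= b A by apply: theta3_bound => //; rewrite Im_plus_R.
have hA4 : 0 < A / 4 by lra.
have hq : A / 4 <= Im (RtoC (/ 4) * z)%C by rewrite im_scal_l; lra.
have h2 : Cmod (theta2 z) <= b (A / 4) + b A.
  by apply: Rle_trans (Cmod_triangle_minus _ _) _; apply: Rplus_le_compat => //; apply: theta3_bound.
rewrite /b in h2 h4 *; lra.
Qed.

(* Euclid's algorithm on the left column, with [theta_size] playing the role of a form of weight 1/2. *)
Lemma theta_size_cusp (a b c d : Z) : (0 < a * d - b * c)%Z ->
  exists A B, 0 < A /\ 0 <= B /\ forall t, A <= Im t ->
    theta_size (mobius a b c d t) <= B * sqrt (Cmod (automorphy c d t)).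
Proof.
move: {2}(Z.abs_nat c) (leqnn (Z.abs_nat c)) => n.
elim/ltn_ind: n a b c d => n IH a b c d hn hdet.
case: (Z.eq_dec c 0) => hc.
  rewrite hc in hdet *.
  have had : (0 < a * d)%Z by move: hdet; rewrite Z.mul_0_r Z.sub_0_r.
  have d0 : (d <> 0)%Z by move=> h; move: had; rewrite h Z.mul_0_r.
  have dd : 1 <= IZR d * IZR d by rewrite -mult_IZR; apply: IZR_le; nia.
  have ad1 : 1 <= IZR a * IZR d by rewrite -mult_IZR; apply: IZR_le; lia.
  have dd0 : 0 < / (IZR d * IZR d) by apply: Rinv_0_lt_compat; lra.
  have [B [B0 hB]] := theta_size_bound dd0.
  exists 1, B; split; first by lra.
  split=> // t ht.
  have t0 : 0 < Im t by lra.
  have cm : Cmod (automorphy 0 d t) ^ 2 = IZR d * IZR d.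
    by rewrite /automorphy Cmult_0_l Cplus_0_l Cmod_R pow2_abs; ring.
  apply: (Rle_trans _ (B * 1)).
    rewrite Rmult_1_r; apply: hB.
    rewrite Im_mobius_det // Z.mul_0_r Z.sub_0_r mult_IZR cm /Rdiv -{1}(Rmult_1_l (/ _)).
    by apply: Rmult_le_compat_r; nra.
  apply: Rmult_le_compat_l => //; rewrite -sqrt_1; apply: sqrt_le_1_alt.
  have m0 := Cmod_ge_0 (automorphy 0 d t); nra.
(* The matrix factors as translation by k, inversion, and (-c, -d; a', b') with |a'| < |c|; the
   determinant is unchanged. *)
pose k := (a / c)%Z; pose a' := (a - k * c)%Z; pose b' := (b - k * d)%Z.
have ha' : (Z.abs a' < Z.abs c)%Z.
  by rewrite /a' /k; have := Z.div_mod a c hc; have := Z.mod_bound_or a c hc; lia.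
have hdet' : (0 < - c * b' - - d * a')%Z.
  by have -> : (- c * b' - - d * a' = a * d - b * c)%Z by rewrite /a' /b'; ring.
have [|A [B [A0 [B0 hB]]]] := IH (Z.abs_nat a') _ (- c)%Z (- d)%Z a' b' (leqnn _) hdet'.
  by apply: leq_trans hn; apply/ltP; lia.
exists A, B; split=> //; split=> // t ht.
have t0 : 0 < Im t by lra.
have n1 := automorphy_neq_0_det hdet t0; have n2 := automorphy_neq_0_det hdet' t0.
set y := mobius (- c) (- d) a' b' t in hB *.
have hy := upper_mobius_det hdet' t0; rewrite -/y in hy.
have y0 := upper_neq_0 hy.
have yE : y = (- automorphy c d t / automorphy a' b' t)%C.
  by rewrite /y /mobius {1}/automorphy !opp_IZR !RtoC_opp /automorphy; congr Cdiv; ring.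
have -> : mobius a b c d t = (- / y + ZtoC k)%C.
  have e0 : automorphy a b t = (automorphy a' b' t + ZtoC k * automorphy c d t)%C.
    have -> : a = (a' + k * c)%Z by rewrite /a'; ring.
    have -> : b = (b' + k * d)%Z by rewrite /b'; ring.
    by rewrite /automorphy !plus_IZR !mult_IZR !RtoC_plus !RtoC_mult /ZtoC; ring.
  by rewrite yE /mobius e0; field.
rewrite (periodic_shift theta_size_T); last exact: upper_S.
rewrite theta_size_S //.
apply: (Rle_trans _ (sqrt (Cmod y) * (B * sqrt (Cmod (automorphy a' b' t))))).
  by apply: Rmult_le_compat_l; [apply: sqrt_pos | exact: hB].
have -> : Cmod (automorphy c d t) = Cmod y * Cmod (automorphy a' b' t).
  rewrite yE -Cmod_mult; have -> : (- automorphy c d t / automorphy a' b' t * automorphy a' b' t = - automorphy c d t)%C by field.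
  by rewrite Cmod_opp.
rewrite sqrt_mult; try exact: Cmod_ge_0.
by apply: Req_le; ring.
Qed.

End Cusps.

(** * The product of theta constants *)

Section ThetaProducts.
Local Open Scope R_scope.

(** The form itself with q^(h/8) distributed over the last product: each [Psi] takes its q^(c_j/8)
    and becomes half a [theta2]. *)
Definition theta_product (u v k : nat) (a : 'I_u -> nat) (b : 'I_v -> nat) (c : 'I_k -> nat) (t : C) : C :=
  (\big[Cmult/RtoC 1]_(i < u) calF (RtoC (INR (a i)) * t) *
   \big[Cmult/RtoC 1]_(i < v) theta3 (RtoC (INR (2 * b i)%N) * t) *
   \big[Cmult/RtoC 1]_(j < k) (RtoC (/ 2) * theta2 (RtoC (INR (c j)) * t)))%C.

Lemma INR_gt0 (n : nat) : (0 < n)%N -> 0 < INR n.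
Proof. by move/ltP/lt_0_INR. Qed.

Lemma INR_muln (m n : nat) : INR (m * n)%N = INR m * INR n.
Proof. exact: mult_INR. Qed.

Lemma INR_addn (m n : nat) : INR (m + n)%N = INR m + INR n.
Proof. exact: plus_INR. Qed.

Lemma Psi_product (k : nat) (c : 'I_k -> nat) (t : C) : (forall j, 0 < c j)%N -> 0 < Im t ->
  (qpow t (INR (\sum_(j < k) c j)%N / 8) * \big[Cmult/RtoC 1]_(j < k) Psi (RtoC (INR (c j)) * t))%C =
  \big[Cmult/RtoC 1]_(j < k) (RtoC (/ 2) * theta2 (RtoC (INR (c j)) * t))%C.
Proof.
move=> c0 ht; elim: k c c0 => [|k IH] c c0.
  by rewrite !big_ord0 qpow_qexp Rdiv_0_l Rmult_0_r qexp_0 Cmult_1_l.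
rewrite !big_ord_recl -IH => [|j]; last exact: c0.
have hc : 0 < INR (c ord0) by apply: INR_gt0.
rewrite -Psi_theta2; last exact: Im_scal.
rewrite !qpow_qexp qexp_scal INR_addn.
have -> : 2 * ((INR (c ord0) + INR (\sum_(i < k) c (lift ord0 i))%N) / 8) =
  2 * (1 / 8) * INR (c ord0) + 2 * (INR (\sum_(i < k) c (lift ord0 i))%N / 8) by field.
by rewrite qexp_addl; ring.
Qed.

Lemma Phi_theta_product (u v k : nat) (a : 'I_u -> nat) (b : 'I_v -> nat) (c : 'I_k -> nat) (t : C) :
  (forall j, 0 < c j)%N -> 0 < Im t ->
  (qpow t (INR (\sum_(j < k) c j)%N / 8) * Phi a b c t)%C = theta_product a b c t.
Proof.
move=> c0 ht; rewrite /Phi /theta_product -Psi_product //.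
have -> : \big[Cmult/RtoC 1]_(i < v) theta (RtoC (INR (b i)) * t) =
  \big[Cmult/RtoC 1]_(i < v) theta3 (RtoC (INR (2 * b i)%N) * t).
  by apply: eq_bigr => i _; rewrite theta_theta3 INR_muln RtoC_mult Cmult_assoc.
by ring.
Qed.

Lemma holomorphic_prod (n : nat) (F : 'I_n -> C -> C) (z : C) :
  (forall i, holomorphic_at (F i) z) -> holomorphic_at (fun t => \big[Cmult/RtoC 1]_(i < n) F i t) z.
Proof.
elim: n F => [|n IH] F hF.
  have -> : (fun t => \big[Cmult/RtoC 1]_(i < 0) F i t) = (fun _ => RtoC 1).
    by apply: FunctionalExtensionality.functional_extensionality => t; rewrite big_ord0.
  exact: holomorphic_const.
have -> : (fun t => \big[Cmult/RtoC 1]_(i < n.+1) F i t) =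
    (fun t => F ord0 t * \big[Cmult/RtoC 1]_(i < n) F (lift ord0 i) t)%C.
  by apply: FunctionalExtensionality.functional_extensionality => t; rewrite big_ord_recl.
by apply: holomorphic_mult; [exact: hF | apply: IH => i; exact: hF].
Qed.

Lemma calF_holomorphic (z : C) : 0 < Im z -> holomorphic_at calF z.
Proof.
move=> hz; apply: (@holomorphic_ext_upper (fun t => theta3 (RtoC 2 * t) * theta3 (RtoC 6 * t) + theta2 (RtoC 2 * t) * theta2 (RtoC 6 * t))%C) => //.
  by move=> x hx; rewrite calF_theta.
have h2 : 0 < 2 by lra.
have h6 : 0 < 6 by lra.
apply: holomorphic_plus; apply: holomorphic_mult.
- by apply: (holomorphic_scal h2); apply/theta3_holomorphic/Im_scal.
- by apply: (holomorphic_scal h6); apply/theta3_holomorphic/Im_scal.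
- by apply: (holomorphic_scal h2); apply/theta2_holomorphic/Im_scal.
- by apply: (holomorphic_scal h6); apply/theta2_holomorphic/Im_scal.
Qed.

Lemma theta_product_holomorphic (u v k : nat) (a : 'I_u -> nat) (b : 'I_v -> nat) (c : 'I_k -> nat) (t : C) :
  (forall i, 0 < a i)%N -> (forall i, 0 < b i)%N -> (forall j, 0 < c j)%N -> 0 < Im t ->
  holomorphic_at (theta_product a b c) t.
Proof.
move=> a0 b0 c0 ht; apply: holomorphic_mult; first apply: holomorphic_mult.
- apply: holomorphic_prod => i; have h := INR_gt0 (a0 i).
  by apply: (holomorphic_scal h); apply: calF_holomorphic; apply: Im_scal.
- apply: holomorphic_prod => i; have h : 0 < INR (2 * b i)%N by apply: INR_gt0; rewrite muln_gt0 ?b0 ?n0.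
  by apply: (holomorphic_scal h); apply: theta3_holomorphic; apply: Im_scal.
- apply: holomorphic_prod => j; have h := INR_gt0 (c0 j).
  apply: holomorphic_mult; first exact: holomorphic_const.
  by apply: (holomorphic_scal h); apply: theta2_holomorphic; apply: Im_scal.
Qed.

(* Boundedness at the cusps of a form of weight [w / 2]. *)
Definition cusp_bounded (w : nat) (f : C -> C) : Prop :=
  forall a b c d : Z, (a * d - b * c = 1)%Z ->
  exists A B, 0 < A /\ 0 <= B /\ forall t, A <= Im t ->
    Cmod (f (mobius a b c d t)) <= B * sqrt (Cmod (automorphy c d t)) ^ w.

Lemma cusp_bounded_const (k : C) : cusp_bounded 0 (fun _ => k).
Proof.
move=> a b c d hdet; exists 1, (Cmod k); split; first by lra.
by split=> [|t _]; [exact: Cmod_ge_0 | rewrite /= Rmult_1_r; lra].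
Qed.

Lemma cusp_bounded_mult (w1 w2 : nat) (f g : C -> C) : cusp_bounded w1 f -> cusp_bounded w2 g ->
  cusp_bounded (w1 + w2) (fun t => f t * g t)%C.
Proof.
move=> hf hg a b c d hdet.
have [A1 [B1 [A10 [B10 H1]]]] := hf a b c d hdet; have [A2 [B2 [A20 [B20 H2]]]] := hg a b c d hdet.
exists (Rmax A1 A2), (B1 * B2); split; first by apply: Rlt_le_trans A10 (Rmax_l _ _).
split=> [|t ht]; first exact: Rmult_le_pos.
have h1 := H1 t (Rle_trans _ _ _ (Rmax_l _ _) ht); have h2 := H2 t (Rle_trans _ _ _ (Rmax_r _ _) ht).
rewrite Cmod_mult Rdef_pow_add; set s := sqrt _ in h1 h2 *.
have -> : B1 * B2 * (s ^ w1 * s ^ w2) = (B1 * s ^ w1) * (B2 * s ^ w2) by ring.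
by apply: Rmult_le_compat => //; apply: Cmod_ge_0.
Qed.

Lemma cusp_bounded_le (w : nat) (f g : C -> C) : (forall t, 0 < Im t -> Cmod (f t) <= Cmod (g t)) ->
  cusp_bounded w g -> cusp_bounded w f.
Proof.
move=> h hg a b c d hdet; have [A [B [A0 [B0 H]]]] := hg a b c d hdet.
exists A, B; split=> //; split=> // t ht; apply: Rle_trans (H t ht); apply: h.
by apply: upper_mobius => //; lra.
Qed.

Lemma cusp_bounded_prod (w n : nat) (F : 'I_n -> C -> C) : (forall i, cusp_bounded w (F i)) ->
  cusp_bounded (n * w) (fun t => \big[Cmult/RtoC 1]_(i < n) F i t).
Proof.
elim: n F => [|n IH] F hF.
  rewrite mul0n; apply: cusp_bounded_le (cusp_bounded_const (RtoC 1)) => t _.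
  by rewrite big_ord0; apply: Rle_refl.
rewrite mulSn; have := cusp_bounded_mult (hF ord0) (IH (fun i => F (lift ord0 i)) (fun i => hF _)).
by apply: cusp_bounded_le => t _; rewrite big_ord_recl; apply: Rle_refl.
Qed.

Lemma mobius_scal_l (a b c d : Z) (n : nat) (t : C) :
  (RtoC (INR n) * mobius a b c d t = mobius (Z.of_nat n * a) (Z.of_nat n * b) c d t)%C.
Proof. by rewrite /mobius /automorphy INR_IZR_INZ !mult_IZR !RtoC_mult /Cdiv; ring. Qed.

Lemma cusp_bounded_theta_size (n : nat) : (0 < n)%N -> cusp_bounded 1 (fun t => RtoC (theta_size (RtoC (INR n) * t))).
Proof.
move=> n0 a b c d hdet.
have [|A [B [A0 [B0 H]]]] := @theta_size_cusp (Z.of_nat n * a) (Z.of_nat n * b) c d.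
  have -> : (Z.of_nat n * a * d - Z.of_nat n * b * c = Z.of_nat n * (a * d - b * c))%Z by ring.
  by rewrite hdet; move/ltP: n0; lia.
exists A, B; split=> //; split=> // t ht.
rewrite Cmod_R Rabs_pos_eq; last exact: theta_size_pos.
by rewrite mobius_scal_l /= Rmult_1_r; exact: H.
Qed.

Lemma theta_size_ge (z : C) : Cmod (theta2 z) <= theta_size z /\ Cmod (theta3 z) <= theta_size z.
Proof.
rewrite /theta_size.
by have := Cmod_ge_0 (theta2 z); have := Cmod_ge_0 (theta3 z); have := Cmod_ge_0 (theta4 z); lra.
Qed.

Lemma cusp_bounded_theta3 (n : nat) : (0 < n)%N -> cusp_bounded 1 (fun t => theta3 (RtoC (INR n) * t)).
Proof.
move=> /cusp_bounded_theta_size; apply: cusp_bounded_le => t _.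
rewrite Cmod_R Rabs_pos_eq; last exact: theta_size_pos.
exact: (proj2 (theta_size_ge _)).
Qed.

Lemma cusp_bounded_theta2 (n : nat) : (0 < n)%N -> cusp_bounded 1 (fun t => RtoC (/ 2) * theta2 (RtoC (INR n) * t))%C.
Proof.
move=> n0; apply: (cusp_bounded_mult (w1 := 0) (w2 := 1)); first exact: cusp_bounded_const.
apply: cusp_bounded_le (cusp_bounded_theta_size n0) => t _.
rewrite Cmod_R Rabs_pos_eq; last exact: theta_size_pos.
exact: (proj1 (theta_size_ge _)).
Qed.

(** [calF] at nt is at most the product of [theta_size] at 2nt and at 6nt, two factors of weight
    1/2. *)
Lemma cusp_bounded_calF (n : nat) : (0 < n)%N -> cusp_bounded 2 (fun t => calF (RtoC (INR n) * t)).
Proof.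
move=> n0.
have h2 : (0 < 2 * n)%N by rewrite muln_gt0 ?b0 ?n0.
have h6 : (0 < 6 * n)%N by rewrite muln_gt0 ?b0 ?n0.
have := cusp_bounded_mult (cusp_bounded_theta_size h2) (cusp_bounded_theta_size h6).
apply: cusp_bounded_le => t ht; rewrite calF_theta; last by apply: Im_scal => //; apply: INR_gt0.
rewrite !Cmult_assoc -!RtoC_mult !INR_muln.
have -> : INR 2 = 2 by [].
have -> : INR 6 = 6 by rewrite /=; ring.
set x := (_ * t)%C; set y := (_ * t)%C.
rewrite Cmod_R Rabs_pos_eq; last by apply: Rmult_le_pos; apply: theta_size_pos.
apply: Rle_trans (Cmod_triangle _ _) _; rewrite !Cmod_mult /theta_size.
have := Cmod_ge_0 (theta2 x); have := Cmod_ge_0 (theta3 x); have := Cmod_ge_0 (theta4 x).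
have := Cmod_ge_0 (theta2 y); have := Cmod_ge_0 (theta3 y); have := Cmod_ge_0 (theta4 y).
nra.
Qed.

Lemma theta_product_cusps (u v k : nat) (a : 'I_u -> nat) (b : 'I_v -> nat) (c : 'I_k -> nat) :
  (forall i, 0 < a i)%N -> (forall i, 0 < b i)%N -> (forall j, 0 < c j)%N ->
  cusp_bounded (u * 2 + v * 1 + k * 1) (theta_product a b c).
Proof.
move=> a0 b0 c0; apply: cusp_bounded_mult; first apply: cusp_bounded_mult.
- by apply: cusp_bounded_prod => i; apply: cusp_bounded_calF.
- by apply: cusp_bounded_prod => i; apply: cusp_bounded_theta3; rewrite muln_gt0 ?b0 ?n0.
- by apply: cusp_bounded_prod => i; apply: cusp_bounded_theta2.
Qed.

Lemma theta2_shift_nat (z : C) (n : nat) : 0 < Im z ->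
  theta2 (z + RtoC (INR n)) = (turn (INR n / 8) * theta2 z)%C.
Proof.
move=> hz; elim: n => [|n IH]; first by rewrite Rdiv_0_l turn_0 Cplus_0_r Cmult_1_l.
rewrite S_INR RtoC_plus Cplus_assoc theta2_T ?Im_plus_R // IH Rdiv_plus_distr turn_add.
by ring.
Qed.

Lemma theta2_product_T (k : nat) (c : 'I_k -> nat) (t : C) : (forall j, 0 < c j)%N -> 0 < Im t ->
  \big[Cmult/RtoC 1]_(j < k) (RtoC (/ 2) * theta2 (RtoC (INR (c j)) * (t + 1)))%C =
  (turn (INR (\sum_(j < k) c j)%N / 8) * \big[Cmult/RtoC 1]_(j < k) (RtoC (/ 2) * theta2 (RtoC (INR (c j)) * t)))%C.
Proof.
move=> c0 ht; elim: k c c0 => [|k IH] c c0; first by rewrite !big_ord0 Rdiv_0_l turn_0 Cmult_1_l.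
rewrite !big_ord_recl IH => [|j]; last exact: c0.
rewrite Cmult_plus_distr_l Cmult_1_r theta2_shift_nat; last by apply: Im_scal => //; apply: INR_gt0.
by rewrite INR_addn Rdiv_plus_distr turn_add; ring.
Qed.

(** The [theta2] factors together contribute exp(2 pi i h/8); this is where 8 | h enters. The other
    factors are invariant one by one. *)
Lemma theta_product_T (u v k : nat) (a : 'I_u -> nat) (b : 'I_v -> nat) (c : 'I_k -> nat) (t : C) :
  (forall j, 0 < c j)%N -> (8 %| \sum_(j < k) c j)%N -> 0 < Im t ->
  theta_product a b c (t + 1)%C = theta_product a b c t.
Proof.
move=> c0 /dvdnP [m hm] ht; rewrite /theta_product theta2_product_T // hm INR_muln.
have -> : INR m * INR 8 / 8 = INR m by rewrite /=; field.
rewrite turn_nat Cmult_1_l; congr (_ * _ * _)%C; apply: eq_bigr => i _;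
  rewrite Cmult_plus_distr_l Cmult_1_r INR_IZR_INZ.
  exact: calF_T.
have -> : Z.of_nat (2 * b i) = (2 * Z.of_nat (b i))%Z by rewrite mulnE Nat2Z.inj_mul.
exact: theta3_shift.
Qed.

End ThetaProducts.

(** * Transformation of the product when 24 divides the upper right entry *)

Section Transformation.
Local Open Scope R_scope.

(* Also excludes 0, where [logn] is 0. *)
Definition smooth23 (n : nat) : bool := n == (2 ^ logn 2 n * 3 ^ logn 3 n)%N.

(** For d prime to 6 and n = 2^i 3^j this is the Kronecker symbol (n/d) up to the convention at
    negative d; as n > 0, no sign arises. *)
Definition chi_smooth (d : Z) (n : nat) : Z :=
  (chi8 d ^ Z.of_nat (logn 2 n) * chi12 d ^ Z.of_nat (logn 3 n))%Z.

Lemma smooth23_gt0 (n : nat) : smooth23 n -> (0 < n)%N.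
Proof. by move=> /eqP ->; rewrite muln_gt0 !expn_gt0. Qed.

Lemma smooth23_mul (m n : nat) : smooth23 m -> smooth23 n -> smooth23 (m * n).
Proof.
move=> hm hn; rewrite /smooth23 !lognM ?smooth23_gt0 // !expnD mulnACA.
by rewrite -(eqP hm) -(eqP hn).
Qed.

Lemma chi_smooth_mul (d : Z) (m n : nat) : (0 < m)%N -> (0 < n)%N ->
  chi_smooth d (m * n) = (chi_smooth d m * chi_smooth d n)%Z.
Proof.
move=> hm hn; rewrite /chi_smooth !lognM // -!plusE !Nat2Z.inj_add !Z.pow_add_r; lia.
Qed.

Lemma smooth23_prod (n : nat) (F : 'I_n -> nat) : (forall i, smooth23 (F i)) -> smooth23 (\prod_(i < n) F i).
Proof.
elim: n F => [|n IH] F hF; first by rewrite big_ord0.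
by rewrite big_ord_recl; apply: smooth23_mul; [exact: hF | apply: IH => i; exact: hF].
Qed.

Lemma smooth23_Z (n : nat) : smooth23 n ->
  (2 ^ Z.of_nat (logn 2 n) * 3 ^ Z.of_nat (logn 3 n))%Z = Z.of_nat n.
Proof.
move=> h; rewrite {3}(eqP h); have := num_23_nat 0 (logn 2 n) (logn 3 n).
by rewrite /num_23 Z.mul_1_l.
Qed.

Lemma ZtoC_pow (x : Z) (n : nat) : ZtoC (x ^ Z.of_nat n) = (ZtoC x ^ n)%C.
Proof. by rewrite /ZtoC -pow_IZR RtoC_pow. Qed.

(* On [t / 12] the matrix acts as (a, b / 12; 12 c, d), which has even off-diagonal entries. *)
Lemma theta3_multiplier (a b c d : Z) : (a * d - b * c = 1)%Z -> (24 | b)%Z ->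
  exists J : C -> C, forall t, 0 < Im t ->
    (J t * J t = ZtoC (chi4 d) * automorphy c d t)%C /\
    forall n : nat, smooth23 n -> (Z.of_nat n | 6 * c)%Z ->
    theta3 (RtoC (INR n / 12) * mobius a b c d t) =
      (J t * ZtoC (chi_smooth d n) * theta3 (RtoC (INR n / 12) * t))%C.
Proof.
move=> hdet [b' hb].
have [||| J hJ] := @theta3_multiple a (2 * b') (12 * c) d.
- by rewrite -hdet hb; ring.
- by rewrite Z.even_mul.
- by rewrite Z.even_mul.
exists (fun t => J (RtoC (/ 12) * t)%C) => t ht; set z := (RtoC (/ 12) * t)%C.
have hz : 0 < Im z by apply: Im_scal => //; lra.
have tz : t = (ZtoC 12 * z)%C.
  by rewrite /z /ZtoC Cmult_assoc -RtoC_mult Rinv_r ?Cmult_1_l //; lra.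
have [hm ha] : mobius a b c d t = (ZtoC 12 * mobius a (2 * b') (12 * c) d z)%C /\
  automorphy c d t = automorphy (12 * c) d z.
  have n12 : (12 <> 0)%Z by [].
  have := @mobius_scal a (2 * b') (12 * c) d 12 z n12 (Z.divide_factor_l _ _).
  rewrite -tz; have -> : (12 * c / 12 = c)%Z by rewrite Z.mul_comm Z.div_mul.
  by have -> : (12 * (2 * b') = b)%Z by rewrite hb; ring.
have [h1 h2] := hJ z hz; split; first by rewrite h1 ha.
move=> n hn hd.
have := h2 (logn 2 n) (logn 3 n); cbv zeta; rewrite smooth23_Z // => h3.
have e w : (RtoC (INR n / 12) * (ZtoC 12 * w) = ZtoC (Z.of_nat n) * w)%C.
  rewrite Cmult_assoc /ZtoC -RtoC_mult INR_IZR_INZ.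
  by have -> : IZR (Z.of_nat n) / 12 * 12 = IZR (Z.of_nat n) by field.
rewrite hm e h3; last first.
  have -> : (12 * c = 2 * (6 * c))%Z by ring.
  exact: Z.mul_divide_mono_l.
by rewrite [in RHS]tz e.
Qed.

Lemma prod_multiplier (n : nat) (F G : 'I_n -> C) (J : C) (e : 'I_n -> Z) :
  (forall i, F i = J * ZtoC (e i) * G i)%C ->
  \big[Cmult/RtoC 1]_(i < n) F i =
    (J ^ n * ZtoC (\big[Z.mul/1%Z]_(i < n) e i) * \big[Cmult/RtoC 1]_(i < n) G i)%C.
Proof.
elim: n F G e => [|n IH] F G e h; first by rewrite !big_ord0 /ZtoC /=; ring.
by rewrite !big_ord_recl (IH _ (fun i => G (lift ord0 i)) (fun i => e (lift ord0 i))) // h ZtoC_mult /=; ring.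
Qed.

Lemma chi_smooth_prod (d x : Z) (n : nat) (F : 'I_n -> nat) : (forall i, 0 < F i)%N ->
  (\big[Z.mul/1]_(i < n) (x * chi_smooth d (F i)) = x ^ Z.of_nat n * chi_smooth d (\prod_(i < n) F i)%N)%Z.
Proof.
elim: n F => [|n IH] F h; first by rewrite !big_ord0 /chi_smooth !logn1.
rewrite !big_ord_recl IH // chi_smooth_mul //; last by apply: prodn_gt0.
by rewrite Nat2Z.inj_succ Z.pow_succ_r; [ring | lia].
Qed.

Lemma theta_product_law (u v k : nat) (al : 'I_u -> nat) (be : 'I_v -> nat) (ga : 'I_k -> nat) (a b c d : Z) (t : C) :
  (a * d - b * c = 1)%Z -> (24 | b)%Z -> 0 < Im t -> ~~ odd (v + k) ->
  (forall i, 0 < al i)%N -> (forall i, smooth23 (be i)) -> (forall j, smooth23 (ga j)) ->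
  (forall i, (Z.of_nat (3 * al i)%N | c)%Z) -> (forall i, (Z.of_nat (4 * be i)%N | c)%Z) ->
  (forall j, (Z.of_nat (2 * ga j)%N | c)%Z) ->
  theta_product al be ga (mobius a b c d t) =
    (ZtoC (chi3 d ^ Z.of_nat u * (chi4 d ^ Z.of_nat ((v + k)./2) * chi8 d ^ Z.of_nat v *
       chi_smooth d (\prod_(i < v) be i * \prod_(j < k) ga j)%N)) *
     automorphy c d t ^ (u + (v + k)./2)%N * theta_product al be ga t)%C.
Proof.
move=> hdet hb ht hvk al0 be23 ga23 hal hbe hga.
(* Scaling the argument by a_i replaces c by c/a_i, still divisible by 3 because 3 a_i divides c. *)
have hcalF i : calF (RtoC (INR (al i)) * mobius a b c d t) =
    (automorphy c d t * ZtoC (chi3 d) * calF (RtoC (INR (al i)) * t))%C.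
  have n0 : Z.of_nat (al i) <> 0%Z by move/ltP: (al0 i); lia.
  have [q hq] := hal i.
  have {}hq : c = (q * 3 * Z.of_nat (al i))%Z by rewrite hq mulnE Nat2Z.inj_mul; ring.
  have hd : (Z.of_nat (al i) | c)%Z by exists (q * 3)%Z.
  have [hm ha] := @mobius_scal a b c d (Z.of_nat (al i)) t n0 hd.
  have hdiv : (c / Z.of_nat (al i) = q * 3)%Z by rewrite hq Z.div_mul.
  rewrite INR_IZR_INZ -/(ZtoC _) -hm calF_law_Gamma0_3.
  - by rewrite ha; ring.
  - by rewrite hdiv -hdet hq; ring.
  - by rewrite hdiv; exists q.
  - by rewrite /ZtoC -INR_IZR_INZ; apply: Im_scal => //; apply: INR_gt0.
have [J hJ] := theta3_multiplier hdet hb; have [hJJ hJ3] := hJ t ht.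
have [h4 [h88 h3]] := chi_sqr d; have h12 := chi12_sqr d.
have htheta3 i : theta3 (RtoC (INR (2 * be i)%N) * mobius a b c d t) =
    (J t * ZtoC (chi8 d * chi12 d * chi_smooth d (be i)) * theta3 (RtoC (INR (2 * be i)%N) * t))%C.
  (* In the variable t/12 the multiple is 24 b_i, and 24 = 2^3 3 contributes [chi8 d * chi12 d]. *)
  have -> : INR (2 * be i)%N = INR (24 * be i)%N / 12.
    by rewrite !INR_muln; have -> : INR 24 = 24 by [rewrite /=; ring]; rewrite /=; field.
  rewrite hJ3.
  - rewrite chi_smooth_mul ?smooth23_gt0 //.
    have -> // : chi_smooth d 24 = (chi8 d * chi12 d)%Z.
    by rewrite /chi_smooth !pow_involution.
  - exact: smooth23_mul.
  - have -> : Z.of_nat (24 * be i)%N = (6 * Z.of_nat (4 * be i)%N)%Z.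
      by rewrite !mulnE !Nat2Z.inj_mul; ring.
    exact: Z.mul_divide_mono_l.
have htheta2 j : (RtoC (/ 2) * theta2 (RtoC (INR (ga j)) * mobius a b c d t) =
    J t * ZtoC (chi12 d * chi_smooth d (ga j)) * (RtoC (/ 2) * theta2 (RtoC (INR (ga j)) * t)))%C.
  (* The multiples 3 c_j and 12 c_j differ by the square 4, so both terms of [theta2] carry the same
     character and the difference transforms with a single factor. *)
  have e w : theta2 (RtoC (INR (ga j)) * w) =
      (theta3 (RtoC (INR (3 * ga j)%N / 12) * w) - theta3 (RtoC (INR (12 * ga j)%N / 12) * w))%C.
    rewrite /theta2 !INR_muln Cmult_assoc -RtoC_mult.
    have -> : INR 12 = 12 by rewrite /=; ring.
    have -> : INR 3 = 3 by rewrite /=; ring.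
    have -> : 3 * INR (ga j) / 12 = / 4 * INR (ga j) by field.
    by have -> : 12 * INR (ga j) / 12 = INR (ga j) by field.
  have div6 : (Z.of_nat (12 * ga j)%N | 6 * c)%Z.
    have -> : Z.of_nat (12 * ga j)%N = (6 * Z.of_nat (2 * ga j)%N)%Z by rewrite !mulnE !Nat2Z.inj_mul; ring.
    exact: Z.mul_divide_mono_l.
  rewrite !e !hJ3 ?smooth23_mul //.
    rewrite !chi_smooth_mul ?smooth23_gt0 //.
    have -> : chi_smooth d 3 = chi12 d.
      by rewrite /chi_smooth !pow_involution // (_ : logn 2 3 = 0%N) // (_ : logn 3 3 = 1%N) // Z.mul_1_l.
    have -> : chi_smooth d 12 = chi12 d.
      by rewrite /chi_smooth !pow_involution // (_ : logn 2 12 = 2%N) // (_ : logn 3 12 = 1%N) // Z.mul_1_l.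
    by ring.
  apply: Z.divide_trans div6; exists 4%Z; rewrite !mulnE !Nat2Z.inj_mul; ring.
rewrite /theta_product (prod_multiplier hcalF) (prod_multiplier htheta3) (prod_multiplier htheta2).
have sm i : (0 < be i)%N by apply: smooth23_gt0.
have sg i : (0 < ga i)%N by apply: smooth23_gt0.
rewrite !chi_smooth_prod // chi_smooth_mul ?prodn_gt0 //.
have -> : \big[Z.mul/1%Z]_(i < u) chi3 d = (chi3 d ^ Z.of_nat u)%Z.
  elim: (u) => [|n IH]; first by rewrite big_ord0.
  by rewrite big_ord_recl IH Nat2Z.inj_succ Z.pow_succ_r //; lia.
have hm : (v + k)%N = ((v + k)./2 + (v + k)./2)%N by rewrite addnn -[LHS]odd_double_half (negbTE hvk).
have hpow : (J t ^ v * J t ^ k = ZtoC (chi4 d ^ Z.of_nat (v + k)./2) * automorphy c d t ^ (v + k)./2)%C.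
  rewrite -Cpow_add_r; have -> : Nat.add v k = ((v + k)./2 + (v + k)./2)%N by rewrite -hm plusE.
  by rewrite -plusE Cpow_add_r -Cpow_mult_l hJJ Cpow_mult_l ZtoC_pow.
(* Each of the v + k theta factors brings one [chi12]; their number is even, so only [chi8 d ^ v]
   survives. *)
have hchi : ((chi8 d * chi12 d) ^ Z.of_nat v * chi12 d ^ Z.of_nat k = chi8 d ^ Z.of_nat v)%Z.
  rewrite Z.pow_mul_l -Z.mul_assoc -Z.pow_add_r; try lia.
  by rewrite -Nat2Z.inj_add plusE [(chi12 d ^ _)%Z]pow_involution // (negbTE hvk) Z.mul_1_r.
move: (chi_smooth d (\prod_(i < v) be i)%N) (chi_smooth d (\prod_(j < k) ga j)%N) => p q.
rewrite -hchi -plusE Cpow_add_r !ZtoC_mult plusE.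
set X := \big[Cmult/RtoC 1]_(i < u) _; set Y := \big[Cmult/RtoC 1]_(i < v) _; set W := \big[Cmult/RtoC 1]_(i < k) _.
set y := ZtoC (_ ^ Z.of_nat v)%Z; set w := ZtoC (_ ^ Z.of_nat k)%Z; set A := automorphy c d t.
transitivity ((J t ^ v * J t ^ k) * (A ^ u * ZtoC (chi3 d ^ Z.of_nat u) * X * y * ZtoC p * Y * w * ZtoC q * W))%C; first by ring.
by rewrite hpow -/A; ring.
Qed.

End Transformation.

(** * The level, the character and the final assembly *)

Section Level.
Local Open Scope R_scope.

Lemma coprime6_sqr (d : Z) : coprime6 d -> (24 | 1 - d * d)%Z.
Proof.
move=> [/odd_mod8 h8 h3].
have [q [r [-> hr]]] : exists q r, (d = 24 * q + r)%Z /\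
  (r = 1 \/ r = 5 \/ r = 7 \/ r = 11 \/ r = 13 \/ r = 17 \/ r = 19 \/ r = 23)%Z.
  exists (d / 24)%Z, (d mod 24)%Z; split; first by apply: Z.div_mod.
  by intros; Z.to_euclidean_division_equations; lia.
have -> : (1 - (24 * q + r) * (24 * q + r) = 24 * (- 24 * q * q - 2 * q * r) + (1 - r * r))%Z by ring.
apply: Z.divide_add_r; first exact: Z.divide_factor_l.
(* The witnesses are the quotients (1 - r^2)/24. *)
by case: hr => [|[|[|[|[|[|[|]]]]]]] ->; [exists 0%Z | exists (-1)%Z | exists (-2)%Z | exists (-5)%Z | exists (-7)%Z |
  exists (-12)%Z | exists (-15)%Z | exists (-22)%Z].
Qed.

Lemma det1_coprime6 (a b c d : Z) : (a * d - b * c = 1)%Z -> (12 | c)%Z -> coprime6 d.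
Proof.
move=> hdet [q hq]; split.
  have := f_equal Z.odd hdet; rewrite hq Z.odd_sub !Z.odd_mul /=.
  by rewrite !andbF; case: (Z.odd a); case: (Z.odd d).
move=> /Z.mod_divide [//|p hp]; have : (3 * (a * p - 4 * b * q) = 1)%Z by rewrite -hdet hq hp; ring.
by lia.
Qed.

Lemma Zdivide_of_dvdn (m n : nat) : m %| n -> (Z.of_nat m | Z.of_nat n)%Z.
Proof. by move=> /dvdnP [k ->]; exists (Z.of_nat k); rewrite mulnE Nat2Z.inj_mul. Qed.

Lemma dvdn_level (u v k : nat) (a : 'I_u -> nat) (b : 'I_v -> nat) (c : 'I_k -> nat) :
  [/\ forall i, (3 * a i)%N %| level_N1 a b c, forall i, (4 * b i)%N %| level_N1 a b c &
      forall j, (2 * c j)%N %| level_N1 a b c].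
Proof.
rewrite /level_N1 /level_M; split=> i.
- by apply: dvdn_trans (dvdn_lcml _ _); rewrite dvdn_pmul2l //; apply: biglcmn_sup (dvdnn _).
- apply: dvdn_trans (dvdn_lcmr _ _); apply: dvdn_trans (dvdn_lcml _ _).
  by rewrite dvdn_pmul2l //; apply: biglcmn_sup (dvdnn _).
- apply: dvdn_trans (dvdn_lcmr _ _); apply: dvdn_trans (dvdn_lcmr _ _).
  by rewrite dvdn_pmul2l //; apply: biglcmn_sup (dvdnn _).
Qed.

Lemma chi''_chi_smooth (v k : nat) (b : 'I_v -> nat) (c : 'I_k -> nat) (d : Z) :
  ~~ odd (v + k) -> (forall i, smooth23 (b i)) -> (forall j, smooth23 (c j)) -> coprime6 d ->
  chi'' b c d = (chi4 d ^ Z.of_nat ((v + k)./2) * chi8 d ^ Z.of_nat v *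
    chi_smooth d (\prod_(i < v) b i * \prod_(j < k) c j)%N)%Z.
Proof.
move=> hvk hb hc hd; rewrite /chi''.
have hP : smooth23 (\prod_(i < v) b i * \prod_(j < k) c j)%N by apply: smooth23_mul; apply: smooth23_prod.
set P := (_ * _)%N in hP *.
have hodd : odd v && odd k = odd v by move: hvk; rewrite oddD; case: (odd v); case: (odd k).
have [_ [h88 _]] := chi_sqr d.
(* 4 = 2^2 and 8 = 2^3: the choice between them encodes the [chi8 d ^ v] that comes from the doubled
   arguments 2 b_i in [theta (b_i t) = theta3 (2 b_i t)]. *)
pose e := if odd v then 3%N else 2%N.
have -> : ((-1) ^ Z.of_nat (v + k)./2 * (if odd v && odd k then 8 else 4) * Z.of_nat P)%Z =
    num_23 (v + k)./2 (e + logn 2 P) (logn 3 P).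
  rewrite /num_23 -plusE Nat2Z.inj_add Z.pow_add_r; try lia.
  rewrite -[in LHS](smooth23_Z hP) hodd.
  have -> : (if odd v then 8 else 4)%Z = (2 ^ Z.of_nat e)%Z by rewrite /e; case: (odd v).
  by ring.
rewrite kronecker_23 // /chi_23 -plusE Nat2Z.inj_add Z.pow_add_r; try lia.
have -> : (chi8 d ^ Z.of_nat e = chi8 d ^ Z.of_nat v)%Z.
  by rewrite !(pow_involution _ h88) /e; case: (odd v).
by rewrite /chi_smooth; ring.
Qed.

End Level.

Theorem corollary1p4 (u v k : nat)
    (hu : (0 < u)%N) (hv : (0 < v)%N) (hk : (0 < k)%N)
    (hvk : ~~ odd (v + k)%N)
    (a : 'I_u -> nat) (b : 'I_v -> nat) (c : 'I_k -> nat)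
    (ha : forall i, a i \in [:: 1; 2; 4; 8]%N)
    (hb : forall i, b i \in [:: 1; 2; 3; 6]%N)
    (hc : forall j, c j \in [:: 1; 2; 3; 4; 6]%N)
    (h8 : (8 %| \sum_(j < k) c j)%N) :
  modular_form (u + (v + k)./2)%N (level_N1 a b c) (omega u b c)
    (fun t : C =>
       (qpow t (INR (\sum_(j < k) c j)%N / 8) * Phi a b c t)%C).
Proof.
have a0 i : (0 < a i)%N by have := ha i; rewrite !inE; case/or4P => /eqP ->.
have b23 i : smooth23 (b i) by have := hb i; rewrite !inE; case/or4P => /eqP ->.
have c23 j : smooth23 (c j) by have := hc j; rewrite !inE; case/or4P => [||| /orP []] /eqP ->.
have b0 i := smooth23_gt0 (b23 i); have c0 j := smooth23_gt0 (c23 j).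
have fE t : (0 < Im t)%R -> (qpow t (INR (\sum_(j < k) c j)%N / 8) * Phi a b c t)%C = theta_product a b c t.
  exact: Phi_theta_product.
split.
- move=> t ht; apply: holomorphic_ex_derive.
  apply: (holomorphic_ext_upper (f := theta_product a b c)) => // [x hx|]; first by rewrite fE.
  exact: theta_product_holomorphic.
- move=> x y z w hdet hN t ht.
  have [d3 d4 d2] := dvdn_level a b c.
  have div m : m %| level_N1 a b c -> (Z.of_nat m | z)%Z.
    by move=> /Zdivide_of_dvdn h; apply: Z.divide_trans h hN.
  (* Positivity of u and v provides an a_i and a b_i, so 3 and 4 both divide the level. *)
  have h12 : (12 | z)%Z.
    change (Z.of_nat 12 | z)%Z; apply: div; rewrite -[12%N]/(3 * 4)%N Gauss_dvd //.
    by rewrite (dvdn_trans _ (d3 (Ordinal hu))) ?dvdn_mulr // (dvdn_trans _ (d4 (Ordinal hv))) // dvdn_mulr.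
  have hw := det1_coprime6 hdet h12.
  rewrite !fE //; last exact: upper_mobius.
  (* Subtracting y w times the bottom row makes the upper right entry y (1 - w^2), a multiple of 24.
     The translation by y w undoes this and leaves the product fixed. *)
  have hdet' : ((x - y * w * z) * w - (y - y * w * w) * z = 1)%Z by rewrite -hdet; ring.
  have -> : mobius x y z w t = (mobius (x - y * w * z) (y - y * w * w) z w t + ZtoC (y * w))%C.
    have n0 := automorphy_neq_0 hdet ht.
    have e : automorphy x y t = (automorphy (x - y * w * z) (y - y * w * w) t + ZtoC (y * w) * automorphy z w t)%C.
      by rewrite /automorphy /ZtoC !minus_IZR !mult_IZR !RtoC_minus !RtoC_mult; ring.
    by rewrite /mobius e; field.
  rewrite (periodic_shift (f := theta_product a b c)) //; last exact: upper_mobius.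
    rewrite (theta_product_law hdet') //.
    + congr (_ * _ * _)%C; rewrite /omega /ZtoC -chi''_chi_smooth //; congr (RtoC (IZR _)).
      have [_ [_ h33]] := chi_sqr w; rewrite pow_involution // kronecker_3; last exact: (proj2 hw).
      by case: (odd u); rewrite ?Z.mul_1_l.
    + have -> : (y - y * w * w = y * (1 - w * w))%Z by ring.
      exact: Z.divide_mul_r (coprime6_sqr hw).
    + by move=> i; apply: div.
    + by move=> i; apply: div.
    + by move=> i; apply: div.
  by move=> s hs; apply: theta_product_T.
- move=> x y z w hdet.
  have [A [B [A0 [B0 H]]]] := theta_product_cusps a0 b0 c0 hdet.
  exists A, B; split=> // t ht; have t0 : (0 < Im t)%R by apply: Rlt_le_trans A0 ht.
  have n0 := automorphy_neq_0 hdet t0; have m0 := proj1 (Cmod_gt_0 _) n0.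
  rewrite /slash fE; last exact: upper_mobius.
  have := H t ht; set X := theta_product _ _ _ _; set m := Cmod (automorphy z w t) in m0 *.
  (* The cusp bounds count weight in halves; an even total turns the power of the square root into
     an integral power of |cz + d|. *)
  have -> : (u * 2 + v * 1 + k * 1)%N = (2 * (u + (v + k)./2))%N.
    rewrite !muln1 mulnDr [(u * 2)%N]mulnC -addnA; congr addn.
    by rewrite mul2n -[LHS]odd_double_half (negbTE hvk).
  rewrite mulnE pow_mult /= Rmult_1_r sqrt_sqrt; last exact: Rlt_le.
  move=> hX; rewrite Cmod_div ?Cmod_pow -/m; last by apply: Cpow_nz.
  apply/Rle_div_l => //; exact: pow_lt.
Qed.
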